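(* Let $M$ be a loopless sparse paving matroid of rank $d$ on $m+d$ elements, let $\lambda$ be its number of circuit-hyperplanes, and suppose $m\geq 2$ and $d\geq 5$. Define $$\kappa(m,d)=\begin{cases}\lfloor d/3\rfloor+1,& d\leq 3m-7\text{ and }d\equiv 2\pmod 3,\\ \lfloor d/3\rfloor,&\text{otherwise}.\end{cases}$$ Then $\kappa(m,d)$ is a mode of the Kazhdan--Lusztig polynomial $P_M(t)$ unless one of the following conditions holds: $(m,d)=(4,5)$ and $\lambda\geq 4$; $(m,d)=(5,5)$ and $\lambda\geq 26$; $(m,d)=(5,8)$ and $\lambda\geq 83$; $(m,d)=(6,11)$ and $\lambda\geq 940$. In each such case, the unique mode of $P_M(t)$ is $\lfloor d/3\rfloor$.
   Context: A matroid of rank $d$ is paving if every circuit has at least $d$ elements; it is sparse paving if both it and its dual are paving. A circuit-hyperplane is a subset of the ground set that is both a circuit and a hyperplane. For a loopless matroid $M$, let $L(M)$ be its lattice of flats, $\chi_M(t)$ its characteristic polynomial and $\operatorname{rk}M$ its rank. The Kazhdan--Lusztig polynomials $P_M(t)\in\mathbb Z[t]$ of loopless matroids are uniquely determined by: (i) $P_M(t)=1$ if $\operatorname{rk}M=0$; (ii) $\deg P_M(t)<\operatorname{rk}M/2$ if $\operatorname{rk}M>0$; (iii) $t^{\operatorname{rk}M}P_M(t^{-1})=\sum_{F\in L(M)}\chi_{M_F}(t)P_{M^F}(t)$, where $M_F$ is the restriction of $M$ to $F$ and $M^F$ is the contraction of $M$ by $F$. For a polynomial with coefficient sequence $(c_0,\ldots,c_s)$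 (ending at its actual degree $s$), an index $r$ is a mode if $c_r=\max_{0\leq j\leq s}c_j$. *)

(* Defs.v *)
From HB Require Import structures.
From mathcomp Require Import all_boot all_order all_algebra zify.
Set Implicit Arguments.
Unset Strict Implicit.
Unset Printing Implicit Defensive.
Import Order.TTheory GRing.Theory Num.Theory.
Local Open Scope ring_scope.

(* Matroids are given by their ground set E and rank function r.  As r is a
   function on all of {set T}, the last clause normalises it outside E, so that
   equal matroids are Leibniz-equal; minors of M are again matroids over T. *)
Definition matroid_axiom (T : finType) (E : {set T})
    (r : {ffun {set T} -> nat}) : bool :=
  [&& [forall A, r A <= #|A|]%N,
      [forall A : {set T}, forall B : {set T}, (A \subset B) ==> (r A <= r B)%N],
      [forall A, forall B, r (A :|: B) + r (A :&: B) <= r A + r B]%N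
    & [forall A, r A == r (A :&: E)]].

Record matroid (T : finType) := Matroid {
  ground : {set T};
  rkf : {ffun {set T} -> nat};
  matroidP : matroid_axiom ground rkf
}.

Section BasicNotions.
Variables (T : finType) (M : matroid T).
Implicit Types A B F : {set T}.

Definition rk : nat := rkf M (ground M).

Definition cl A : {set T} := [set x in ground M | rkf M (x |: A) == rkf M A].

Definition flats : {set {set T}} := [set F | cl F == F].

Definition dependent A : bool := (A \subset ground M) && (rkf M A < #|A|)%N.

Definition circuit A : bool := minset dependent A.

Definition hyperplane A : bool := (A \in flats) && ((rkf M A).+1 == rk).

Definition circuit_hyperplanes : {set {set T}} :=
  [set H | circuit H && hyperplane H].

Definition loopless : bool := [forall x in ground M, ~~ circuit [set x]].

Definition paving : bool := [forall C, circuit C ==> (rk <= #|C|)%N].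

Lemma rkf_card A : (rkf M A <= #|A|)%N.
Proof. by case/and4P: (matroidP M) => /forallP/(_ A). Qed.

Lemma rkf_mono A B : A \subset B -> (rkf M A <= rkf M B)%N.
Proof.
by case/and4P: (matroidP M) => _ /forallP/(_ A)/forallP/(_ B)/implyP + _ _; apply.
Qed.

Lemma rkf_submod A B :
  (rkf M (A :|: B) + rkf M (A :&: B) <= rkf M A + rkf M B)%N.
Proof. by case/and4P: (matroidP M) => _ _ /forallP/(_ A)/forallP/(_ B). Qed.

Lemma rkfI A : rkf M A = rkf M (A :&: ground M).
Proof. by case/and4P: (matroidP M) => _ _ _ /forallP/(_ A)/eqP. Qed.

Lemma rkf0 : rkf M set0 = 0%N.
Proof. by apply/eqP; rewrite -leqn0 -(@cards0 T) rkf_card. Qed.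

Lemma rkf_le_rk A : (rkf M A <= rk)%N.
Proof. by rewrite rkfI rkf_mono ?subsetIr. Qed.

End BasicNotions.

Section Constructions.
Variables (T : finType) (M : matroid T).
Implicit Types A B F : {set T}.

Lemma restr_axiom F :
  matroid_axiom (ground M :&: F) [ffun A : {set T} => rkf M (A :&: F)].
Proof.
apply/and4P; split; apply/forallP => A.
- by rewrite ffunE (leq_trans (rkf_card _ _)) // subset_leq_card ?subsetIl.
- by apply/forallP=> B; apply/implyP=> sAB; rewrite !ffunE rkf_mono ?setSI.
- by apply/forallP=> B; rewrite !ffunE setIUl setIIl rkf_submod.
- rewrite !ffunE rkfI [X in _ == X]rkfI; apply/eqP; congr (rkf M _).
  by apply/setP=> x; rewrite !inE; case: (x \in A); case: (x \in F); case: (x \in ground M).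
Qed.

(* The restriction of M to F. *)
Definition restr F : matroid T := Matroid (restr_axiom F).

Lemma contr_axiom F :
  matroid_axiom (ground M :\: F)
    [ffun A : {set T} => (rkf M (A :|: F) - rkf M F)%N].
Proof.
have leF A : (rkf M F <= rkf M (A :|: F))%N by rewrite rkf_mono ?subsetUr.
apply/and4P; split; apply/forallP => A.
- rewrite ffunE leq_subLR addnC.
  rewrite (leq_trans _ (leq_add (rkf_card M A) (leqnn _))) //.
  exact: leq_trans (leq_addr _ _) (rkf_submod M A F).
- by apply/forallP=> B; apply/implyP=> sAB; rewrite !ffunE leq_sub2r ?rkf_mono ?setSU.
- apply/forallP=> B; rewrite !ffunE.
  rewrite -(leq_add2r (rkf M F + rkf M F)).
  rewrite [leqLHS]addnACA [leqRHS]addnACA !subnK //.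
  by rewrite setUUl setUIl rkf_submod.
- rewrite !ffunE; apply/eqP; congr (_ - _)%N.
  rewrite rkfI [RHS]rkfI; congr (rkf M _).
  by apply/setP=> x; rewrite !inE; case: (x \in A); case: (x \in F); case: (x \in ground M).
Qed.

(* The contraction of M by F. *)
Definition contr F : matroid T := Matroid (contr_axiom F).

Lemma dual_axiom :
  matroid_axiom (ground M)
    [ffun A : {set T} => (#|A :&: ground M| + rkf M (ground M :\: A) - rk M)%N].
Proof.
set E := ground M.
have leE A : (rk M <= #|A :&: E| + rkf M (E :\: A))%N.
  rewrite (leq_trans _ (leq_add (rkf_card M (A :&: E)) (leqnn _))) //.
  rewrite (leq_trans _ (rkf_submod M _ _)) // (leq_trans _ (leq_addr _ _)) //.
  by rewrite setIC setID.
apply/and4P; split; apply/forallP => A.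
- rewrite ffunE leq_subLR addnC leq_add ?rkf_le_rk //.
  by rewrite subset_leq_card ?subsetIl.
- apply/forallP=> B; apply/implyP=> sAB; rewrite !ffunE leq_sub2r //.
  have sI: A :&: E \subset B :&: E by rewrite setSI.
  have -> : #|B :&: E| = (#|A :&: E| + #|(B :&: E) :\: (A :&: E)|)%N.
    by rewrite -(cardsID (A :&: E) (B :&: E)) (setIidPr sI).
  rewrite -addnA leq_add2l.
  rewrite (leq_trans _ (leq_add (rkf_card M _) (leqnn _))) //.
  rewrite (leq_trans _ (rkf_submod M _ _)) // (leq_trans _ (leq_addr _ _)) //.
  by rewrite rkf_mono //; apply/subsetP=> x; rewrite !inE; case: (x \in A); case: (x \in B); case: (x \in E).
- apply/forallP=> B; rewrite !ffunE.
  rewrite -(leq_add2r (rk M + rk M)).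
  rewrite [leqLHS]addnACA [leqRHS]addnACA !subnK //.
  rewrite [leqLHS]addnACA [leqRHS]addnACA setIUl setIIl cardsUI leq_add2l addnC.
  by rewrite setDUr setDIr rkf_submod.
- rewrite !ffunE; apply/eqP; congr (_ + _ - _)%N.
    by rewrite -setIA setIid.
  by congr (rkf M _); apply/setP=> x; rewrite !inE; case: (x \in A); case: (x \in E).
Qed.

Definition dual : matroid T := Matroid dual_axiom.

Definition sparse_paving : bool := paving M && paving dual.

End Constructions.

(* The Moebius function of the poset (L, \subset).  The recursion on n <= #|B|
   only serves termination: see mobiusE. *)
Fixpoint mobius_rec (T : finType) (L : {set {set T}}) (n : nat)
    (A B : {set T}) : int :=
  if A == B then 1 else
  if n is n'.+1 then
    - \sum_(C in L | (A \subset C) && (C \proper B)) mobius_rec L n' A C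
  else 0.

Definition mobius (T : finType) (L : {set {set T}}) (A B : {set T}) : int :=
  mobius_rec L #|B| A B.

(* cl M set0 is the bottom element of the lattice of flats. *)
Definition char_poly_matroid (T : finType) (M : matroid T) : {poly int} :=
  \sum_(F in flats M)
    (mobius (flats M) (cl M set0) F)%:P * 'X^(rk M - rkf M F).

(* t^d p(t^-1), for p of degree at most d. *)
Definition revp (d : nat) (p : {poly int}) : {poly int} :=
  \poly_(i < d.+1) p`_(d - i).

(* P assigns to each loopless matroid over T its Kazhdan-Lusztig polynomial.
   All minors of a matroid over T are matroids over T, so the conditions pin
   down P on loopless matroids (KL_unique); such a P exists (KL_exists). *)
Definition is_KL (T : finType) (P : matroid T -> {poly int}) : Prop :=
  forall M : matroid T, loopless M ->
  [/\ rk M = 0%N -> P M = 1,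
      (0 < rk M)%N -> ((size (P M)).-1.*2 < rk M)%N
    & revp (rk M) (P M) =
      \sum_(F in flats M) char_poly_matroid (restr M F) * P (contr M F)].

Definition is_mode (p : {poly int}) (r : nat) : Prop :=
  (r < size p)%N /\ (forall j, (j < size p)%N -> p`_j <= p`_r).

Definition is_unique_mode (p : {poly int}) (r : nat) : Prop :=
  is_mode p r /\ (forall j, is_mode p j -> j = r).

(* d + 7 <= 3 * m is d <= 3m - 7 without truncated subtraction. *)
Definition kappa (m d : nat) : nat :=
  if (d + 7 <= 3 * m)%N && (d %% 3 == 2)%N then (d %/ 3).+1 else (d %/ 3)%N.

Definition exceptional (m d lambda : nat) : Prop :=
  [\/ ((m, d) = (4, 5) /\ 4 <= lambda)%N,
      ((m, d) = (5, 5) /\ 26 <= lambda)%N,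
      ((m, d) = (5, 8) /\ 83 <= lambda)%N
    | ((m, d) = (6, 11) /\ 940 <= lambda)%N].

Lemma setDUK (T : finType) (F G : {set T}) : F \subset G -> F :|: (G :\: F) = G.
Proof. by move=> /setIidPr e; rewrite -{1}e setID. Qed.

Section MatroidTheory.
Variables (T : finType) (M : matroid T).
Implicit Types A B F G H : {set T}.

Lemma looplessP :
  reflect (forall x, x \in ground M -> (0 < rkf M [set x])%N) (loopless M).
Proof.
apply: (iffP forall_inP) => h x Ex; have := h x Ex.
  apply: contraR; rewrite -leqNgt leqn0 => /eqP r0.
  apply/minsetP; split; first by rewrite /dependent sub1set Ex r0 cards1.
  move=> B /andP[_ rB] sB; apply/eqP; rewrite eqEcard sB cards1.
  exact: leq_ltn_trans rB.
apply: contraL => /minsetp/andP[_].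
by rewrite cards1 ltnS leqn0 => /eqP->.
Qed.

Lemma cl_sub A : cl M A \subset ground M.
Proof. by apply/subsetP=> x; rewrite inE => /andP[]. Qed.

Lemma cl_ext A : A \subset ground M -> A \subset cl M A.
Proof.
move=> sA; apply/subsetP=> x Ax; rewrite inE (subsetP sA) //=.
by rewrite (setUidPr _) ?sub1set.
Qed.

Lemma cl_mono A B : A \subset B -> cl M A \subset cl M B.
Proof.
move=> sAB; apply/subsetP=> x; rewrite !inE => /andP[-> /eqP rA] /=.
rewrite eqn_leq [X in _ && X]rkf_mono ?subsetUr // andbT.
have [xB|xB] := boolP (x \in B); first by rewrite (setUidPr _) ?sub1set.
have := rkf_submod M (x |: A) B.
rewrite -setUA (setUidPr sAB) setIUl (setIidPl sAB).
rewrite (_ : [set x] :&: B = set0) ?set0U; last first.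
  by apply/setP=> y; rewrite !inE; case: eqP => // ->; apply: negbTE.
by rewrite rA addnC leq_add2l.
Qed.

Lemma flat_sub F : F \in flats M -> F \subset ground M.
Proof. by rewrite inE => /eqP <-; apply: cl_sub. Qed.

Lemma ground_flat : ground M \in flats M.
Proof. by rewrite inE eqEsubset cl_sub cl_ext. Qed.

Lemma flat_lt_rkf F G : F \in flats M -> F \proper G -> G \subset ground M ->
  (rkf M F < rkf M G)%N.
Proof.
move=> Ff /properP[sFG [x xG xF]] sG.
move: Ff xF; rewrite inE => /eqP {1}<-; rewrite inE (subsetP sG) //= => rx.
rewrite ltnNge; apply: contra rx => rGF.
rewrite eqn_leq [X in _ && X]rkf_mono ?subsetUr // andbT.
by apply: leq_trans rGF; rewrite rkf_mono // subUset sub1set xG.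
Qed.

Lemma set0_flat : loopless M -> set0 \in flats M.
Proof.
move/looplessP => h; rewrite inE -subset0; apply/subsetP=> x.
rewrite inE setU0 rkf0 => /andP[/h]; rewrite lt0n => /negbTE->.
by [].
Qed.

Lemma cl_contr F A : cl (contr M F) A = cl M (A :|: F) :\: F.
Proof.
apply/setP=> x; rewrite !inE /= !ffunE -andbA; congr (_ && (_ && _)).
have l B : (rkf M F <= rkf M (B :|: F))%N by rewrite rkf_mono ?subsetUr.
by rewrite -(eqn_add2r (rkf M F)) !subnK // setUA.
Qed.

Lemma flats_contr F A : F \subset ground M ->
  (A \in flats (contr M F)) = [disjoint A & F] && (A :|: F \in flats M).
Proof.
move=> sF; rewrite !inE cl_contr; apply/eqP/andP => [e|[dA /eqP->]].
  split; first by rewrite -e -setI_eq0 setIDAC setDIl setDv setI0.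
  have sc: F \subset cl M (A :|: F).
    by apply: subset_trans (cl_mono (subsetUr A F)); apply: cl_ext.
  have <- : F :|: (cl M (A :|: F) :\: F) = cl M (A :|: F) by rewrite setDUK.
  by rewrite e setUC.
by rewrite setDUl setDv setU0; apply/setDidPl.
Qed.

Lemma flats_restr F A : F \in flats M ->
  (A \in flats (restr M F)) = (A \subset F) && (A \in flats M).
Proof.
move=> Ff; have sF := flat_sub Ff.
have E B : B \subset F -> cl (restr M F) B = cl M B :&: F.
  move=> sB; apply/setP=> x; rewrite !inE /= !ffunE (setIidPl sB).
  have [xF|xF] := boolP (x \in F); last by rewrite !andbF.
  by rewrite !andbT (setIidPl _) // subUset sub1set xF.
have [sA|nA] /= := boolP (A \subset F); last first.
  apply: contraNF nA; rewrite inE => /eqP <-.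
  by apply/subsetP=> x; rewrite inE /= inE => /andP[/andP[]].
rewrite inE E // (setIidPl _) ?inE //.
by move: Ff; rewrite inE => /eqP <-; apply: cl_mono.
Qed.
End MatroidTheory.

Section Minors.
Variables (T : finType) (M : matroid T).
Implicit Types A B F G H : {set T}.

Lemma matroid_eq (N N' : matroid T) : ground N = ground N' ->
  (forall A, rkf N A = rkf N' A) -> N = N'.
Proof.
case: N N' => [E r p] [E' r' p'] /= eE er; move: p p'.
rewrite -eE (_ : r' = r) => [p p'|]; last by apply/ffunP.
by rewrite (bool_irrelevance p p').
Qed.

Lemma contr0 : contr M set0 = M.
Proof.
apply: matroid_eq => /= [|A]; first by rewrite setD0.
by rewrite ffunE setU0 rkf0 subn0.
Qed.

Lemma contr_contr F G : F \subset G ->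
  contr (contr M F) (G :\: F) = contr M G.
Proof.
move=> sFG; have e : (G :\: F) :|: F = G by rewrite setUC setDUK.
apply: matroid_eq => /= [|A]; first by rewrite setDDl setUC e.
rewrite !ffunE -setUA e subnBA ?rkf_mono // subnK //.
by rewrite rkf_mono // (subset_trans sFG) ?subsetUr.
Qed.

Lemma rk_contr F : F \subset ground M -> rk (contr M F) = (rk M - rkf M F)%N.
Proof. by move=> sF; rewrite /rk /= ffunE setUC setDUK. Qed.

Lemma rk_restr F : F \subset ground M -> rk (restr M F) = rkf M F.
Proof. by move=> sF; rewrite /rk /= ffunE -setIA setIid (setIidPr sF). Qed.

Lemma loopless_contr F : F \in flats M -> loopless (contr M F).
Proof.
move=> Ff; apply/looplessP => x; rewrite inE ffunE /= subn_gt0 => /andP[xF xE].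
apply: (flat_lt_rkf Ff); last by rewrite subUset sub1set xE flat_sub.
by apply/properP; split; [rewrite subsetUr | exists x; rewrite ?inE ?eqxx].
Qed.

Lemma loopless_restr F : loopless M -> loopless (restr M F).
Proof.
move/looplessP=> h; apply/looplessP => x; rewrite inE ffunE => /andP[xE xF].
by rewrite (setIidPl _) ?h // sub1set.
Qed.

Lemma flat_rkf_gt0 F : loopless M -> F \in flats M -> F != set0 ->
  (0 < rkf M F)%N.
Proof.
move=> hl Ff F0; rewrite -(rkf0 M) (flat_lt_rkf (set0_flat hl)) ?flat_sub //.
by rewrite proper0.
Qed.

Lemma sum_flats_contr (V : nmodType) F (f : {set T} -> V) : F \in flats M ->
  \sum_(A in flats (contr M F)) f A =
  \sum_(G in flats M | F \subset G) f (G :\: F).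
Proof.
move=> Ff; have sF := flat_sub Ff.
rewrite (reindex_onto (fun G => G :\: F) (fun A => A :|: F)) /=.
  apply: eq_bigl => G; rewrite flats_contr //.
  have [sFG|nFG] := boolP (F \subset G).
    have e : (G :\: F) :|: F = G by rewrite setUC setDUK.
    rewrite e eqxx !andbT (_ : [disjoint _ & _]) //.
    by rewrite disjoints_subset; apply/subsetP=> x; rewrite !inE => /andP[].
  rewrite andbF; apply/negP => /andP[_ /eqP e].
  by case/negP: nFG; rewrite -e subsetUr.
move=> A; rewrite flats_contr // => /andP[dA _].
by rewrite setDUl setDv setU0; apply/setDidPl.
Qed.
End Minors.

Section Mobius.
Variables (T : finType).
Implicit Types (L : {set {set T}}) (A B C : {set T}).

Lemma mobius_rec_fuel L n k A B : (#|B| <= n)%N -> (#|B| <= k)%N ->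
  mobius_rec L n A B = mobius_rec L k A B.
Proof.
elim: n k B => [|n IH] [|k] B //=.
- rewrite leqn0 cards_eq0 => /eqP-> _; case: eqP => // _.
  by rewrite big1 ?oppr0 // => C /and3P[_ _ /properP[_ []]] x; rewrite inE.
- move=> _; rewrite leqn0 cards_eq0 => /eqP->; case: eqP => // _.
  by rewrite big1 ?oppr0 // => C /and3P[_ _ /properP[_ []]] x; rewrite inE.
move=> hn hk; case: eqP => // _; congr (- _).
apply: eq_bigr => C /and3P[_ _ /proper_card ltC].
by apply: IH; rewrite -ltnS; apply: leq_trans ltC _.
Qed.

Lemma mobiusE L A B : mobius L A B =
  if A == B then 1 else
  - \sum_(C in L | (A \subset C) && (C \proper B)) mobius L A C.
Proof.
rewrite {1}/mobius (@mobius_rec_fuel L #|B| #|B|.+1) //=.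
case: eqP => // _; congr (- _); apply: eq_bigr => C /and3P[_ _ /proper_card ltC].
by apply: mobius_rec_fuel => //; apply: ltnW.
Qed.

Lemma sum_mobius_l L A B : B \in L -> A \subset B ->
  \sum_(C in L | (A \subset C) && (C \subset B)) mobius L A C = (A == B)%:R.
Proof.
move=> LB sAB; rewrite (bigD1 B) /=; last by rewrite LB sAB subxx.
rewrite mobiusE.
rewrite (eq_bigl (fun C => [&& C \in L, A \subset C & C \proper B])); last first.
  by move=> C; rewrite properEneq -!andbA; do !bool_congr; rewrite andbC.
have [->|_] := eqVneq A B; last by rewrite addNr.
by rewrite big1 ?addr0 // => C /and3P[_ /sub_proper_trans h /h]; rewrite properxx.
Qed.

Lemma sum_mobius_r L A B : A \in L -> B \in L -> A \subset B ->
  \sum_(C in L | (A \subset C) && (C \subset B)) mobius L C B = (A == B)%:R.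
Proof.
move=> + LB; have [n] := ubnP (#|B| - #|A|)%N; elim: n A => // n IH A ltn LA sAB.
pose f (K : {set T}) := \sum_(C in L | (K \subset C) && (C \subset B)) mobius L C B.
have e : \sum_(K in L | (A \subset K) && (K \subset B)) mobius L A K * f K
         = mobius L A B.
  under eq_bigr => K _ do rewrite mulr_sumr.
  rewrite (exchange_big_dep
    (fun C => (C \in L) && ((A \subset C) && (C \subset B)))) /=; last first.
    move=> K C /and3P[_ sAK _] /and3P[-> sKC ->].
    by rewrite (subset_trans sAK).
  rewrite (bigD1 A) ?LA ?subxx ?sAB //= [X in X + _](_ : _ = mobius L A B).
    rewrite big1 ?addr0 // => C /andP[/and3P[LC sAC sCB] nCA].
    rewrite -mulr_suml (eq_bigl
      (fun K => (K \in L) && ((A \subset K) && (K \subset C)))); last first.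
      move=> K; rewrite LC sCB andbT /=.
      case: (K \in L) => //=; case: (A \subset K) => //=.
      by case sKC: (K \subset C); rewrite ?andbF // (subset_trans sKC sCB).
    by rewrite sum_mobius_l // eq_sym (negbTE nCA) mul0r.
  rewrite (big_pred1 A) ?mobiusE ?eqxx ?mul1r // => K /=.
  rewrite andbT [K == A]eqEsubset.
  case sKA: (K \subset A); rewrite ?andbF ?andbT //=.
  case sAK: (A \subset K); rewrite ?andbF //=.
  by have /eqP -> : K == A; rewrite ?LA ?sAB // eqEsubset sKA sAK.
rewrite -/(f A); have fE K : K \in L -> A \proper K -> K \subset B ->
    f K = (K == B)%:R.
  move=> LK pAK sKB; apply: IH => //; rewrite -ltnS; apply: leq_trans ltn.
  rewrite ltnS; apply: ltn_sub2l; last exact: proper_card.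
  exact: leq_trans (proper_card pAK) (subset_leq_card sKB).
move: e; rewrite (bigD1 A) /= ?LA ?subxx ?sAB // mobiusE eqxx mul1r.
have [eAB|nAB] := eqVneq A B.
  rewrite big1 ?addr0 => [->|K /andP[/and3P[_ sAK sKB] nKA]]; first by rewrite -eAB mobiusE eqxx.
  by case/negP: nKA; rewrite eqEsubset sAK andbT eAB.
rewrite (bigD1 B) /=; last by rewrite LB subxx sAB eq_sym.
rewrite (fE B) // ?eqxx ?mulr1; last by rewrite properEneq nAB.
rewrite big1 ?addr0; first by move/(canRL (addrK _)); rewrite subrr.
move=> K /andP[/andP[/and3P[LK sAK sKB] nKA] nKB].
by rewrite (fE K) // ?(negbTE nKB) ?mulr0 // properEneq eq_sym nKA.
Qed.

Lemma mobius_local L L' A B :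
  (forall C, C \proper B -> (C \in L) = (C \in L')) ->
  mobius L A B = mobius L' A B.
Proof.
have [n] := ubnP #|B|; elim: n B => // n IH B ltn h.
rewrite !mobiusE; case: eqP => // _; congr (- _).
rewrite (eq_bigl (fun C => (C \in L') && ((A \subset C) && (C \proper B)))).
  apply: eq_bigr => C /and3P[_ _ pCB]; apply: IH.
    by apply: leq_trans (proper_card pCB) _.
  by move=> D pDC; apply: h; apply: proper_trans pCB.
move=> C; case pCB: (C \proper B); rewrite ?andbF //.
by rewrite h.
Qed.
End Mobius.

Section Revp.
Implicit Types p q : {poly int}.

Lemma coef_revp d p i : (revp d p)`_i = if (i <= d)%N then p`_(d - i) else 0.
Proof. by rewrite coef_poly ltnS. Qed.

Lemma revpD d p q : revp d (p + q) = revp d p + revp d q.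
Proof.
by apply/polyP=> i; rewrite coefD !coef_revp coefD; case: leqP; rewrite ?addr0.
Qed.

Lemma revp0 d : revp d 0 = 0.
Proof. by apply/polyP=> i; rewrite coef_revp !coef0 if_same. Qed.

Lemma revpN d p : revp d (- p) = - revp d p.
Proof.
by apply/polyP=> i; rewrite coefN !coef_revp coefN; case: leqP; rewrite ?oppr0.
Qed.

Lemma revp_sum d (I : finType) (Q : pred I) (F : I -> {poly int}) :
  revp d (\sum_(i | Q i) F i) = \sum_(i | Q i) revp d (F i).
Proof. exact: (big_morph (revp d) (revpD d) (revp0 d)). Qed.

Lemma revpCX d (c : int) i : (i <= d)%N ->
  revp d (c%:P * 'X^i) = c%:P * 'X^(d - i).
Proof.
move=> le_id; apply/polyP=> j; rewrite coef_revp !coefCM !coefXn.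
case: (leqP j d) => [le_jd|lt_dj].
  congr (c * (nat_of_bool _)%:R); apply/eqP/eqP; first by move<-; rewrite subKn.
  by move->; rewrite subKn.
by case: eqP => [e|]; rewrite ?mulr0 //; move: lt_dj; rewrite e ltnNge leq_subr.
Qed.

Lemma poly_sumCX d p : (size p <= d.+1)%N ->
  p = \sum_(i < d.+1) (p`_i)%:P * 'X^i.
Proof.
move=> sp; rewrite -{1}(coefK p); rewrite poly_def.
under eq_bigr => i _ do rewrite -mul_polyC.
rewrite [RHS](bigID (fun i : 'I_d.+1 => (i < size p)%N)) /=.
rewrite [X in _ + X]big1 => [|i]; last first.
  by rewrite -leqNgt => /(nth_default 0)->; rewrite mul0r.
by rewrite addr0 (big_ord_widen _ (fun i => (p`_i)%:P * 'X^i) sp).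
Qed.

Lemma revpM a b p q : (size p <= a.+1)%N -> (size q <= b.+1)%N ->
  revp (a + b) (p * q) = revp a p * revp b q.
Proof.
move=> sp sq; rewrite {1 2}(poly_sumCX sp) {1 2}(poly_sumCX sq).
rewrite big_distrlr /= !revp_sum big_distrlr /=.
apply: eq_bigr => i _; rewrite revp_sum; apply: eq_bigr => j _.
have ia : (i <= a)%N by rewrite -ltnS.
have jb : (j <= b)%N by rewrite -ltnS.
rewrite mulrACA -polyCM -exprD !revpCX ?leq_add // mulrACA -polyCM -exprD.
by congr (_ * 'X^_); lia.
Qed.
End Revp.

Section CharPoly.
Variables (T : finType).
Implicit Types (M : matroid T) (F G H : {set T}).

Lemma char_poly_restr M G : loopless M -> G \in flats M ->
  char_poly_matroid (restr M G) =
  \sum_(H in flats M | H \subset G)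
    (mobius (flats M) set0 H)%:P * 'X^(rkf M G - rkf M H).
Proof.
move=> hl Gf; rewrite /char_poly_matroid.
have /set0_flat := loopless_restr G hl; rewrite inE => /eqP->.
rewrite rk_restr ?flat_sub //; under eq_bigl => H do rewrite flats_restr // andbC.
apply: eq_bigr => H /andP[_ sHG]; rewrite ffunE (setIidPl sHG).
congr (_%:P * _); apply: mobius_local => C pC.
by rewrite flats_restr // (subset_trans (proper_sub pC)).
Qed.

Lemma mobius_contr M F H : F \in flats M -> F \subset H ->
  mobius (flats (contr M F)) set0 (H :\: F) = mobius (flats M) F H.
Proof.
move=> Ff; have sF := flat_sub Ff.
have [n] := ubnP #|H|; elim: n H => // n IH H ltn sFH.
rewrite !mobiusE.
rewrite (_ : (set0 == H :\: F) = (F == H)); last first.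
  by rewrite eq_sym setD_eq0 eqEsubset sFH.
case: eqP => // /eqP nFH; congr (- _).
rewrite (eq_bigl (fun C => (C \in flats (contr M F)) && (C \proper H :\: F)));
  last by move=> C; rewrite sub0set.
rewrite big_mkcondr sum_flats_contr //= -big_mkcondr /=.
have sub (X Y : {set T}) : F \subset X -> F \subset Y ->
    (X :\: F \subset Y :\: F) = (X \subset Y).
  by move=> sX sY; rewrite subDset setDUK.
apply: eq_big => [G|G /andP[/andP[Gf sFG] pG]].
  rewrite -andbA; congr (_ && _); case sFG: (F \subset G) => //=.
  by rewrite !properE !sub.
apply: IH => //; move: pG; rewrite properE !sub // -properE => /proper_card pG.
exact: leq_trans pG _.
Qed.

Lemma char_poly_minor M F G : F \in flats M -> G \in flats M -> F \subset G ->
  char_poly_matroid (restr (contr M F) (G :\: F)) =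
  \sum_(H in flats M | (F \subset H) && (H \subset G))
    (mobius (flats M) F H)%:P * 'X^(rkf M G - rkf M H).
Proof.
move=> Ff Gf sFG; have sF := flat_sub Ff.
have e (X : {set T}) : F \subset X -> (X :\: F) :|: F = X by move=> /setDUK; rewrite setUC.
rewrite char_poly_restr ?loopless_contr //; last first.
  rewrite flats_contr // e // Gf andbT.
  by rewrite disjoints_subset; apply/subsetP=> x; rewrite !inE => /andP[].
rewrite big_mkcondr sum_flats_contr //= -big_mkcondr /=.
apply: eq_big => [H|H /andP[/andP[Hf sFH] _]].
  rewrite -andbA; congr (_ && _); case sFH: (F \subset H) => //=.
  by rewrite subDset setDUK.
rewrite mobius_contr // !ffunE !e //; congr (_ * 'X^_).
by rewrite subnBA ?subnK // rkf_mono.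
Qed.

Lemma size_char_poly_restr M G : loopless M -> G \in flats M ->
  (size (char_poly_matroid (restr M G)) <= (rkf M G).+1)%N.
Proof.
move=> hl Gf; rewrite char_poly_restr //; apply: leq_trans (size_sum _ _ _) _.
apply/bigmax_leqP=> H _; rewrite mul_polyC.
by apply: leq_trans (size_scale_leq _ _) _; rewrite size_polyXn ltnS leq_subr.
Qed.

Lemma char_poly_restr0 M : loopless M -> char_poly_matroid (restr M set0) = 1.
Proof.
move=> hl; rewrite char_poly_restr ?set0_flat //.
rewrite (big_pred1 set0) => [|H].
  by rewrite mobiusE eqxx subnn mulr1.
rewrite subset0 andbC /=; case: eqP => // ->; exact: set0_flat.
Qed.

Lemma char_poly_inv M G : loopless M -> G \in flats M -> G != set0 ->
  \sum_(F in flats M | F \subset G)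
    revp (rkf M F) (char_poly_matroid (restr M F)) *
    char_poly_matroid (restr (contr M F) (G :\: F)) = 0.
Proof.
move=> hl Gf G0; set L := flats M.
pose t K := (mobius L set0 K)%:P * 'X^(rkf M K).
pose s H := 'X^(rkf M G - rkf M H) : {poly int}.
transitivity (\sum_(F in L | F \subset G)
  \sum_(K in L | K \subset F) \sum_(H in L | (F \subset H) && (H \subset G))
     (mobius L F H)%:P * (t K * s H)).
  apply: eq_bigr => F /andP[Ff sFG].
  rewrite char_poly_restr // char_poly_minor // revp_sum mulr_suml.
  apply: eq_bigr => K /andP[Kf sKF]; rewrite mulr_sumr; apply: eq_bigr => H _.
  by rewrite revpCX ?leq_subr // subKn ?rkf_mono // /t /s mulrCA.
rewrite (exchange_big_dep (fun K => (K \in L) && (K \subset G))) /=; last first.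
  by move=> F K /andP[_ sFG] /andP[-> sKF]; rewrite (subset_trans sKF).
transitivity (\sum_(K in L | K \subset G) t K * s K).
  apply: eq_bigr => K /andP[LK sKG].
  rewrite (exchange_big_dep
    (fun H => (H \in L) && ((K \subset H) && (H \subset G)))) /=; last first.
    move=> F H /andP[_ /andP[_ sKF]] /and3P[-> sFH ->].
    by rewrite (subset_trans sKF).
  transitivity (\sum_(H in L | (K \subset H) && (H \subset G))
      (K == H)%:R * (t K * s H)).
    apply: eq_bigr => H /and3P[LH sKH sHG]; rewrite -mulr_suml; congr (_ * _).
    rewrite -rmorph_sum /= (eq_bigl
      (fun F => (F \in L) && ((K \subset F) && (F \subset H)))); last first.
      move=> F; rewrite LH sHG LK /= andbT.
      case: (F \in L) => //=; case sFH: (F \subset H); rewrite ?andbF ?andbT //.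
      by rewrite (subset_trans sFH sHG).
    by rewrite sum_mobius_r // rmorph_nat.
  rewrite (bigD1 K) /=; last by rewrite LK subxx.
  rewrite eqxx mul1r big1 ?addr0 // => H /andP[_ nHK].
  by rewrite eq_sym (negbTE nHK) mul0r.
transitivity (\sum_(K in L | (set0 \subset K) && (K \subset G))
    (mobius L set0 K)%:P * 'X^(rkf M G)).
  apply: eq_big => [K|K /andP[LK sKG]]; first by rewrite sub0set.
  by rewrite /t /s -mulrA -exprD subnKC ?rkf_mono.
by rewrite -mulr_suml -rmorph_sum /= sum_mobius_l ?sub0set // eq_sym (negbTE G0)
  mul0r.
Qed.
End CharPoly.

Section KL.
Variable T : finType.
Implicit Types (M : matroid T) (P : matroid T -> {poly int}).

Definition KL_cond P M : Prop :=
  [/\ rk M = 0%N -> P M = 1,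
      (0 < rk M)%N -> ((size (P M)).-1.*2 < rk M)%N
    & revp (rk M) (P M) =
      \sum_(F in flats M) char_poly_matroid (restr M F) * P (contr M F)].

Definition KL_rest P M : {poly int} :=
  \sum_(F in flats M | F != set0)
    char_poly_matroid (restr M F) * P (contr M F).

Lemma KL_sumE P M : loopless M ->
  \sum_(F in flats M) char_poly_matroid (restr M F) * P (contr M F) =
  P M + KL_rest P M.
Proof.
move=> hl; rewrite (bigD1 set0) /= ?set0_flat //.
by rewrite char_poly_restr0 // contr0 mul1r.
Qed.

Lemma rk_contr_lt M F : loopless M -> F \in flats M -> F != set0 ->
  (rk (contr M F) < rk M)%N.
Proof.
move=> hl Ff F0; rewrite rk_contr ?flat_sub //.
have r0 := flat_rkf_gt0 hl Ff F0.
by rewrite ltn_subrL r0 (leq_trans r0) ?rkf_le_rk.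
Qed.

Lemma KL_size P M : KL_cond P M -> (size (P M) <= (rk M).+1)%N.
Proof.
case=> h0 h1 _; case: (posnP (rk M)) => [r0|/h1 h].
  by rewrite h0 // size_poly1.
have : ((size (P M)).-1 <= rk M)%N.
  by rewrite (leq_trans _ (ltnW h)) // -addnn leq_addr.
by case: (size (P M)).
Qed.

Lemma KL_rest_anti P M : loopless M ->
  (forall N, loopless N -> (rk N < rk M)%N -> KL_cond P N) ->
  (size (KL_rest P M) <= (rk M).+1)%N /\
  revp (rk M) (KL_rest P M) = - KL_rest P M.
Proof.
move=> hl hP.
have hc F : F \in flats M -> F != set0 -> KL_cond P (contr M F).
  by move=> Ff F0; apply: hP; rewrite ?loopless_contr ?rk_contr_lt.
have sz F : F \in flats M -> F != set0 ->
    (size (P (contr M F)) <= (rk M - rkf M F).+1)%N.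
  by move=> Ff F0; rewrite -rk_contr ?flat_sub //; apply: KL_size; apply: hc.
split.
  apply: leq_trans (size_sum _ _ _) _; apply/bigmax_leqP => F /andP[Ff F0].
  apply: leq_trans (size_polyMleq _ _) _; rewrite -subn1 leq_subLR add1n.
  apply: leq_trans (leq_add (size_char_poly_restr hl Ff) (sz F Ff F0)) _.
  by rewrite addSn addnS subnKC ?rkf_le_rk.
transitivity (\sum_(F in flats M | F != set0)
  revp (rkf M F) (char_poly_matroid (restr M F)) *
  \sum_(G in flats M | F \subset G)
    char_poly_matroid (restr (contr M F) (G :\: F)) * P (contr M G)).
  rewrite revp_sum; apply: eq_bigr => F /andP[Ff F0].
  rewrite -{1}(subnKC (rkf_le_rk M F)) revpM ?sz ?size_char_poly_restr //.
  congr (_ * _); rewrite -rk_contr ?flat_sub //.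
  have [_ _ ->] := hc F Ff F0; rewrite sum_flats_contr //.
  by apply: eq_bigr => G /andP[_ sFG]; rewrite contr_contr.
under eq_bigr => F _ do rewrite mulr_sumr.
rewrite (exchange_big_dep (fun G => (G \in flats M) && (G != set0))) /=;
    last first.
  move=> F G /andP[_ F0] /andP[-> sFG]; apply: contraNneq F0 => G0.
  by rewrite -subset0 -G0.
rewrite -sumrN; apply: eq_bigr => G /andP[Gf G0].
have := char_poly_inv hl Gf G0.
rewrite (bigD1 set0) /=; last by rewrite set0_flat // sub0set.
rewrite setD0 contr0 rkf0 char_poly_restr0 //.
rewrite (_ : revp 0 1 = 1); last first.
  by apply/polyP => i; rewrite coef_revp !coef1; case: i.
rewrite mul1r => /eqP; rewrite addrC addr_eq0 => /eqP e.
rewrite -mulNr -e mulr_suml; apply: eq_big => [F|F _]; last by rewrite mulrA.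
by rewrite Gf /= -!andbA; congr (_ && _); rewrite andbC.
Qed.

Lemma double_ltP i n : (i.*2 < n)%N = (i < uphalf n)%N.
Proof. lia. Qed.

Lemma KL_step P M p : loopless M -> (0 < rk M)%N ->
  (forall N, loopless N -> (rk N < rk M)%N -> KL_cond P N) ->
  p = \poly_(i < uphalf (rk M)) (- (KL_rest P M)`_i) ->
  ((size p).-1.*2 < rk M)%N /\ revp (rk M) p = p + KL_rest P M.
Proof.
move=> hl r0 hP ->; have [sR aR] := KL_rest_anti hl hP; set R := KL_rest P M.
split.
  rewrite double_ltP; have := size_poly (uphalf (rk M)) (fun i => - R`_i).
  case: (size _) => //= _; by case: (rk M) r0.
apply/polyP => i; rewrite coef_revp coefD !coef_poly -!double_ltP.
have := congr1 (fun p : {poly int} => p`_i) aR.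
rewrite /= coef_revp coefN => aRi.
case: (leqP i (rk M)) aRi => [le_i|lt_i] aRi; last first.
  rewrite nth_default; last exact: leq_trans sR lt_i.
  by rewrite addr0 ltnNge (leq_trans (ltnW lt_i)) // -addnn leq_addr.
have oR (x : int) : x = - x -> x = 0 by lia.
case: (ltngtP i.*2 (rk M)) => h.
- by rewrite ifN ?addNr //; lia.
- by rewrite ifT ?add0r ?aRi ?opprK //; lia.
- rewrite ifN ?add0r; last by lia.
  by apply/esym/oR; rewrite -aRi; congr (_`_ _); lia.
Qed.

Theorem KL_exists : exists P, is_KL P.
Proof.
suff [P hP] : exists P, forall M, loopless M -> (rk M <= #|T|)%N -> KL_cond P M.
  exists P => M hl; apply: hP => //.
  by rewrite (leq_trans (rkf_card _ _)) // max_card.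
elim: #|T| => [|n [P hP]].
  exists (fun=> 1) => M hl; rewrite leqn0 => /eqP r0.
  rewrite /KL_cond (KL_sumE (fun=> 1)) //; split=> //; first by rewrite r0.
  rewrite /KL_rest big1 => [|F /andP[Ff F0]]; last first.
    by have := flat_rkf_gt0 hl Ff F0; have := rkf_le_rk M F; rewrite r0; lia.
  by rewrite r0 addr0; apply/polyP=> -[|i]; rewrite coef_revp ?coef1.
pose Q M := if (rk M <= n)%N then P M else
  \poly_(i < uphalf (rk M)) (- (KL_rest P M)`_i).
have restE M : loopless M -> (rk M <= n.+1)%N -> KL_rest Q M = KL_rest P M.
  move=> hl le_n; apply: eq_bigr => F /andP[Ff F0]; rewrite /Q ifT //.
  by have := rk_contr_lt hl Ff F0; lia.
exists Q => M hl le_n; rewrite /KL_cond KL_sumE // restE // /Q.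
case: (leqP (rk M) n) => [le_rn|lt_nr].
  by have := hP M hl le_rn; rewrite /KL_cond KL_sumE.
have r0 : (0 < rk M)%N by lia.
have hN N : loopless N -> (rk N < rk M)%N -> KL_cond P N.
  by move=> hN ltN; apply: hP => //; lia.
have [h1 h2] := KL_step hl r0 hN (erefl _).
by split=> //; lia.
Qed.

Theorem KL_unique P Q M : is_KL P -> is_KL Q -> loopless M -> P M = Q M.
Proof.
move=> hP hQ; have [n] := ubnP (rk M); elim: n M => // n IH M ltn hl.
have [p0 p1 p2] := hP M hl; have [q0 q1 q2] := hQ M hl.
case: (posnP (rk M)) => [r0|r0]; first by rewrite p0 ?q0.
have eR : KL_rest P M = KL_rest Q M.
  apply: eq_bigr => F /andP[Ff F0]; rewrite IH ?loopless_contr //.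
  by have := rk_contr_lt hl Ff F0; lia.
move: p2 q2; rewrite !KL_sumE // eR => p2 q2; apply/polyP => i.
have small (p : {poly int}) j : ((size p).-1.*2 < rk M)%N -> (rk M <= j.*2)%N -> p`_j = 0.
  move=> sp hj; apply: nth_default; move: sp hj.
  by move: (size p) (rk M) => s r; lia.
case: (ltnP i.*2 (rk M)) => hi; last by rewrite !(small _ i) ?p1 ?q1.
have := congr1 (fun p : {poly int} => p`_i) p2.
have := congr1 (fun p : {poly int} => p`_i) q2.
rewrite /= !coefD !coef_revp !(small _ (rk M - i)%N) ?p1 ?q1 //; try lia.
rewrite !if_same => e1 e2.
by apply: (addIr (KL_rest Q M)`_i); rewrite -e1 -e2.
Qed.
End KL.

(* Main.v *)
(* In a sparse paving matroid M of rank d every subset of fewer than d elements is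
   independent and every subset of more than d elements spans, so the flats, the
   characteristic polynomials and the minors depend only on m, d and the
   circuit-hyperplanes.  The recursion for P_M is then affine in lambda: P_M is
   the polynomial of the uniform matroid minus lambda times a universal
   polynomial.  The recursion is a binomial transform, which is inverted in closed
   form.  For i >= 1 this makes the i-th coefficient of P_M a positive factor times
   an affine function of x = lambda / 'C(m + d, d) whose constant term is the sum
   \sum_(h < m) (d - i + h)! / (h! (h + i) (h + i + 1)).
   A contiguity relation links the sums for i and i + 1, and iterated summation by
   parts bounds them below by rational functions.  Two circuit-hyperplanes never
   share d - 1 elements, hence x <= 1 / (d + 1) and x <= 1 / (m + 1).  With these
   bounds the sign of each coefficient difference reduces to polynomials that have
   nonnegative coefficients after a shift of the variables: the coefficients
   increase up to i with 3i + 3 <= d and decrease once d <= 3i + 1.  The remaining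
   difference, d = 3i + 2, is nonpositive for m <= i + 2 and nonnegative for
   m >= i + 3 except at four values of (m, d), where it is computed exactly. *)

(* Affineness in lambda comes from double counting. Contracting a flat F with fewer than d elements
   gives a matroid of the same kind, whose circuit-hyperplanes correspond to those of M above F.
   Summed over all F of size k, their number is lambda * 'C(d, k), so the correction obeys the
   uniform recursion with m = 0 and an inhomogeneous term of its own. The contiguity relation
   expresses a coefficient difference through either of the two neighbouring sums alone, each time
   with the sign for which a lower bound on that sum suffices. The delicate place is the line d = 3i
   + 2, where the sign flips between m = i + 2 and m = i + 3. The basic bound is sharpened there by
   one further summation by parts for the ascent and by three for the descent. The four thresholds
   on lambda are the places where the exact difference, affine in lambda, becomes negative. *)
Require Import Defs.
From HB Require Import structures.
From Stdlib Require Import ZArith.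
From mathcomp Require Import all_boot all_order all_algebra zify ssrZ ring lra.
Set Implicit Arguments.
Unset Strict Implicit.
Unset Printing Implicit Defensive.
Import Order.TTheory GRing.Theory Num.Theory.
Local Open Scope ring_scope.

(** * Polynomials with nonnegative coefficients *)

(* Dense recursive polynomials in n variables over Z. *)
Fixpoint mpol (n : nat) : Type := if n is n'.+1 then seq (mpol n') else Z.

Fixpoint mp_add n : mpol n -> mpol n -> mpol n :=
  match n with
  | 0 => Z.add
  | n'.+1 => fix add (p q : seq (mpol n')) : seq (mpol n') :=
      match p, q with
      | [::], _ => q
      | _, [::] => p
      | a :: p', b :: q' => mp_add a b :: add p' q'
      end
  end.

Fixpoint mp_const n (z : Z) : mpol n :=
  match n with 0 => z | n'.+1 => [:: mp_const n' z] end.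

Fixpoint mp_var n (i : nat) : mpol n :=
  match n with
  | 0 => Z0
  | n'.+1 => if i is i'.+1 then [:: mp_var n' i']
             else [:: mp_const n' Z0; mp_const n' (Zpos xH)]
  end.

Fixpoint mp_mul n : mpol n -> mpol n -> mpol n :=
  match n with
  | 0 => Z.mul
  | n'.+1 => fix mul (p q : seq (mpol n')) : seq (mpol n') :=
      if p is a :: p' then
        @mp_add n'.+1 (map (mp_mul a) q) (mp_const n' Z0 :: mul p' q)
      else [::]
  end.

Fixpoint mp_nneg n : mpol n -> bool :=
  match n with
  | 0 => Z.leb 0
  | n'.+1 => all (@mp_nneg n')
  end.

Inductive pexpr :=
  | PVar of nat | PZero | POne | PNat of nat | PAdd of pexpr & pexpr
  | POpp of pexpr | PMul of pexpr & pexpr.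

Fixpoint pnorm n (e : pexpr) : mpol n :=
  match e with
  | PVar i => mp_var n i
  | PZero => mp_const n Z0
  | POne => mp_const n (Zpos xH)
  | PNat k => mp_const n (Z.of_nat k)
  | PAdd e1 e2 => mp_add (pnorm n e1) (pnorm n e2)
  | POpp e1 => mp_mul (mp_const n (Zneg xH)) (pnorm n e1)
  | PMul e1 e2 => mp_mul (pnorm n e1) (pnorm n e2)
  end.

Section Eval.
Variable R : realDomainType.
Implicit Types (env : seq R).

Definition zr (z : Z) : R := (int_of_Z z)%:~R.

Fixpoint peval env (e : pexpr) : R :=
  match e with
  | PVar i => env`_i
  | PZero => 0
  | POne => 1
  | PNat k => k%:R
  | PAdd e1 e2 => peval env e1 + peval env e2
  | POpp e1 => - peval env e1
  | PMul e1 e2 => peval env e1 * peval env e2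
  end.

Fixpoint mp_eval n env : mpol n -> R :=
  match n with
  | 0 => zr
  | n'.+1 => foldr (fun c acc => mp_eval (behead env) c + head 0 env * acc) 0
  end.

Lemma mp_evalD n env p q :
  @mp_eval n env (mp_add p q) = mp_eval env p + mp_eval env q.
Proof.
elim: n env p q => [|n IH] env p q /=; first by rewrite /zr rmorphD rmorphD.
elim: p q => [|a p IHp] [|b q] /=; rewrite ?add0r ?addr0 //.
by rewrite IH IHp mulrDr addrACA.
Qed.

Lemma mp_eval_const n env z : mp_eval env (mp_const n z) = zr z.
Proof. by elim: n env => [|n IH] env //=; rewrite IH mulr0 addr0. Qed.

Lemma mp_eval_var n env i : (size env <= n)%N ->
  mp_eval env (mp_var n i) = env`_i.
Proof.
elim: n env i => [|n IH] [|x env] [|i] //= h.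
- by rewrite !mp_eval_const mulr0 mul0r !addr0.
- by rewrite IH // nth_nil mul0r addr0.
- by rewrite !mp_eval_const mulr0 addr0 mulr1 add0r.
- by rewrite IH // mulr0 addr0.
Qed.

Lemma mp_eval_cons n env (a : mpol n) (p : seq (mpol n)) :
  @mp_eval n.+1 env (a :: p) =
  mp_eval (behead env) a + head 0 env * @mp_eval n.+1 env p.
Proof. by []. Qed.

Lemma mp_evalM n env p q :
  @mp_eval n env (mp_mul p q) = mp_eval env p * mp_eval env q.
Proof.
elim: n env p q => [|n IH] env p q; first by rewrite /= /zr rmorphM rmorphM.
have scaleE (a : mpol n) : @mp_eval n.+1 env (map (mp_mul a) q) =
    mp_eval (behead env) a * mp_eval env q.
  elim: q => [|b q IHq]; first by rewrite /= mulr0.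
  rewrite [map _ _]/= !(mp_eval_cons env) IHq IH mulrDr; congr (_ + _).
  by rewrite mulrCA.
elim: p => [|a p IHp]; first by rewrite /= mul0r.
rewrite -[LHS]/(@mp_eval n.+1 env (@mp_add n.+1 (map (mp_mul a) q)
  (mp_const n Z0 :: @mp_mul n.+1 p q))) mp_evalD scaleE.
by rewrite !(mp_eval_cons env) mp_eval_const add0r IHp [RHS]mulrDl mulrA.
Qed.

Lemma mp_eval_ge0 n env p : all (fun x => 0 <= x) env ->
  @mp_nneg n p -> 0 <= mp_eval env p.
Proof.
elim: n env p => [|n IH] env p; first by move=> _ /=; rewrite /zr ler0z; case: p.
move=> henv; elim: p => [|a p IHp] //= /andP[ha hp].
apply: addr_ge0; first by apply: IH => //; case: env henv {IHp} => //= x s /andP[].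
by apply: mulr_ge0; [case: env henv {IHp} => //= x s /andP[] | exact: IHp].
Qed.

Lemma zr_nat n : zr (Z.of_nat n) = n%:R.
Proof. by rewrite /zr -[int_of_Z _]/(int_of_Z (Z_of_int n)) Z_of_intK. Qed.

Lemma pnormP env e : mp_eval env (pnorm (size env) e) = peval env e.
Proof.
elim: e => [i|||k|e1 IH1 e2 IH2|e IH|e1 IH1 e2 IH2] /=.
- by rewrite mp_eval_var.
- exact: mp_eval_const.
- by rewrite mp_eval_const.
- by rewrite mp_eval_const zr_nat.
- by rewrite mp_evalD IH1 IH2.
- by rewrite mp_evalM IH mp_eval_const mulN1r.
- by rewrite mp_evalM IH1 IH2.
Qed.

Lemma peval_ge0 env e : all (fun x => 0 <= x) env ->
  mp_nneg (pnorm (size env) e) -> 0 <= peval env e.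
Proof. by move=> henv he; rewrite -pnormP mp_eval_ge0. Qed.

End Eval.

Ltac mem_index x s :=
  match s with
  | x :: _ => constr:(0%N)
  | _ :: ?s' => let i := mem_index x s' in constr:(S i)
  end.

(** The lookup in the list comes first: a listed atom such as [a%:R] would otherwise be read as a
    numeral. *)
Ltac reify s t :=
  match t with
  | _ => let i := mem_index t s in constr:(PVar i)
  | ?a + ?b => let x := reify s a in let y := reify s b in constr:(PAdd x y)
  | - ?a => let x := reify s a in constr:(POpp x)
  | ?a * ?b => let x := reify s a in let y := reify s b in constr:(PMul x y)
  | 0 => constr:(PZero)
  | 1 => constr:(POne)
  | ?n%:R => constr:(PNat n)
  end.

(* Proves 0 <= t when the expansion of t as a polynomial in the nonnegative
   quantities listed in s has nonnegative coefficients. *)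
Ltac poly_nneg s :=
  match goal with |- is_true (0 <= ?t) =>
    let e := reify s t in
    change (is_true (0 <= peval s e)); apply: peval_ge0;
    [by rewrite /= ?andbT; repeat (apply/andP; split) | by vm_compute]
  end.

(** * Polynomial inequalities *)

Section Rational.
Implicit Types e i m x r w A B : rat.

(* In what follows d is the rank, e = d - i, and x = lambda / 'C(m + d, d).
   QA, QB, QB2 and Q4 are the denominators of the lower bounds obtained from
   hsum_lower; the descent and ascent polynomials are what remains of the sign
   of the i-th coefficient difference after clearing denominators, x having been
   replaced by an upper bound xn / xd. *)
Definition gap e i := e - i - 1.

(** The right-hand side of the contiguity relation [hsum_contiguity], divided by [weight]. *)
Definition bracket e i m :=
  e * (e - 1) * gap e i / (m + i) + e * i
  - e * gap e i * (gap e i - 1) / (m + i + 1)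
  - (e - 1) * i * (e + m - 1) / (m + i).

(** The coefficient of x in [coef_diff], up to [weight]. Its sign, which is that of [ell_num],
    decides whether an upper or a lower bound on x is used. *)
Definition ell e i m :=
  2 * (e + m) * (e + m - 1) *
  (e * i - gap e i * (gap e i - 1) * (e * e - 1) / ((i + 2) * (e - 2)))
  / (m * (e + 1)).

Definition bracket_num e i m :=
  e * (e - 1) * gap e i * (m + i + 1) + e * i * (m + i) * (m + i + 1)
  - e * gap e i * (gap e i - 1) * (m + i)
  - (e - 1) * i * (e + m - 1) * (m + i + 1).

Definition ell_num e i :=
  e * i * (i + 2) * (e - 2) - gap e i * (gap e i - 1) * (e * e - 1).

Definition QA e i m := (e + 1) * (m + i + 1) - 2 * (e + m).
Definition QB e i m := e * (m + i + 2) - 2 * (e + m - 1).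
Definition QB2 e i m := (e + 1) * (m + i + 3) - 3 * (e + m).

Definition descent_poly e i m xn xd :=
  (i * (e - 1) * (e + m + i + 1) * (e + m - 1) * (m + i + 1)
   - bracket_num e i m * QA e i m) * (xd * m * (e + 1) * (i + 2) * (e - 2))
  - 2 * xn * (e + m - 1) * ell_num e i * ((m + i) * (m + i + 1) * QA e i m).

Definition ascent_poly e i m xn xd :=
  ((e + m + i + 1) * e * gap e i * (gap e i - 1) * (e + m - 1) * (m + i)
   - (i + 1) * bracket_num e i m * QB e i m)
  * (xd * m * (e + 1) * (i + 2) * (e - 2))
  + 2 * xn * (e + m) * (e + m - 1) * ell_num e i
    * ((m + i) * (m + i + 1) * QB e i m).

Definition ascent_poly2 e i m xn xd :=
  ((e + m + i + 1) * gap e i * (gap e i - 1) * (e + m - 1)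
     * (QB2 e i m + 2 * (e + m)) * (m + i)
   - (i + 1) * bracket_num e i m * QB2 e i m * (m + i + 2))
  * (xd * m * (e + 1) * (i + 2) * (e - 2))
  + 2 * xn * (e + m) * (e + m - 1) * ell_num e i
    * ((m + i) * (m + i + 1) * (m + i + 2) * QB2 e i m).

Ltac unfold_polys := rewrite /descent_poly /ascent_poly /ascent_poly2 /bracket
  /ell /bracket_num /ell_num /QA /QB /QB2 /gap.

Lemma descent_polyE e i m xn xd :
  m + i != 0 -> m + i + 1 != 0 -> QA e i m != 0 -> xd != 0 -> m != 0 ->
  e + 1 != 0 -> i + 2 != 0 -> e - 2 != 0 ->
  (e + m) * bracket e i m
  - (e - 1) * i * (e + m + i + 1) *
     ((e + m) * (e + m - 1) / (QA e i m * (m + i))) + xn / xd * ell e i m =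
  - ((e + m) * descent_poly e i m xn xd /
     ((m + i) * (m + i + 1) * QA e i m * (xd * m * (e + 1) * (i + 2) * (e - 2)))).
Proof.
rewrite /descent_poly /bracket /ell /bracket_num /ell_num; move: (QA e i m) => q.
by move: (gap e i) => g *; field; repeat (apply/andP; split); assumption.
Qed.

Lemma ascent_polyE e i m xn xd :
  m + i != 0 -> m + i + 1 != 0 -> QB e i m != 0 -> xd != 0 -> m != 0 ->
  e + 1 != 0 -> i + 2 != 0 -> e - 2 != 0 ->
  (e + m + i + 1) * e * gap e i * (gap e i - 1) *
     ((e + m - 1) / (QB e i m * (m + i + 1)))
  - (i + 1) * bracket e i m + xn / xd * ell e i m =
  ascent_poly e i m xn xd /
     ((m + i) * (m + i + 1) * QB e i m * (xd * m * (e + 1) * (i + 2) * (e - 2))).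
Proof.
rewrite /ascent_poly /bracket /ell /bracket_num /ell_num; move: (QB e i m) => q.
by move: (gap e i) => g *; field; repeat (apply/andP; split); assumption.
Qed.

Lemma ascent_poly2E e i m xn xd :
  m + i != 0 -> m + i + 1 != 0 -> m + i + 2 != 0 -> QB2 e i m != 0 -> xd != 0 ->
  m != 0 -> e != 0 -> e + 1 != 0 -> i + 2 != 0 -> e - 2 != 0 ->
  (e + m + i + 1) * e * gap e i * (gap e i - 1) *
     ((e + m - 1) / (e * (m + i + 1) * (m + i + 2))
       * (1 + 2 * (e + m) / QB2 e i m))
  - (i + 1) * bracket e i m + xn / xd * ell e i m =
  ascent_poly2 e i m xn xd /
     ((m + i) * (m + i + 1) * (m + i + 2) * QB2 e i m
      * (xd * m * (e + 1) * (i + 2) * (e - 2))).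
Proof.
rewrite /ascent_poly2 /bracket /ell /bracket_num /ell_num; move: (QB2 e i m) => q.
move: (gap e i) => g *; field; repeat (apply/andP; split); assumption.
Qed.

(* The bounds x <= 1 / (d + 1) and x <= 1 / (m + 1), combined with weights d + 1 and m + 1. *)
Definition xn_mean (d m : rat) := m + d + 2.
Definition xd_mean (d m : rat) := (m + 1) * (m + 1) + (d + 1) * (d + 1).

Ltac expand := unfold_polys; rewrite /xn_mean /xd_mean.

Lemma ascent_poly_ge0 (a t s : rat) : 0 <= a -> 0 <= t -> 0 <= s ->
  forall i e m, i = a + 1 -> e = 2 * i + 3 + t -> m = s + 3 ->
  0 <= ascent_poly e i m (xn_mean (e + i) m) (xd_mean (e + i) m).
Proof. by move=> ha ht hs i e m -> -> ->; expand; poly_nneg [:: a; t; s]. Qed.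

(** Here xn / xd is 1 / (d + 1), the stronger of the two density bounds when m = 2. *)
Lemma ascent_poly_ge0_2 (a t : rat) : 0 <= a -> 0 <= t ->
  forall i e, i = a + 1 -> e = 2 * i + 3 + t ->
  0 <= ascent_poly e i 2 1 (e + i + 1).
Proof. by move=> ha ht i e -> ->; expand; poly_nneg [:: a; t]. Qed.

Lemma descent_poly_ge0_1 (a t s : rat) : 0 <= a -> 0 <= t -> 0 <= s ->
  forall i e m, i = a + t + 2 -> e = 2 * a + t + 3 -> m = s + 2 ->
  0 <= descent_poly e i m (xn_mean (e + i) m) (xd_mean (e + i) m).
Proof. by move=> ? ? ? i e m -> -> ->; expand; poly_nneg [:: a; t; s]. Qed.

Lemma descent_poly_ge0_2 (a s : rat) : 0 <= a -> 0 <= s ->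
  forall i e m, i = a + 3 -> e = 2 * a + 6 -> m = s + 2 ->
  0 <= descent_poly e i m (xn_mean (e + i) m) (xd_mean (e + i) m).
Proof. by move=> ? ? i e m -> -> ->; expand; poly_nneg [:: a; s]. Qed.

Lemma descent_poly_ge0_3 (a s : rat) : 0 <= a -> 0 <= s ->
  forall i e m, i = a + 4 -> e = 2 * a + 9 -> m = s + 2 ->
  0 <= descent_poly e i m (xn_mean (e + i) m) (xd_mean (e + i) m).
Proof. by move=> ? ? i e m -> -> ->; expand; poly_nneg [:: a; s]. Qed.

(** These are the three pairs (i, e) that the preceding shifts miss. The bound x <= 1 / (m + 1)
    serves from m = 6 on; for m <= 5 the next lemma uses x <= 1 / (d + 1). *)
Lemma descent_poly_ge0_4 (s : rat) : 0 <= s ->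
  forall m, m = s + 6 ->
  [/\ 0 <= descent_poly 4 2 m 1 (m + 1), 0 <= descent_poly 5 2 m 1 (m + 1)
    & 0 <= descent_poly 7 3 m 1 (m + 1)].
Proof. by move=> ? m ->; split; expand; poly_nneg [:: s]. Qed.

Lemma descent_poly_ge0_5 (m : nat) : (2 <= m <= 5)%N ->
  [/\ 0 <= descent_poly 4 2 m%:R 1 (4 + 2 + 1), 0 <= descent_poly 5 2 m%:R 1 (5 + 2 + 1)
    & 0 <= descent_poly 7 3 m%:R 1 (7 + 3 + 1)].
Proof.
move=> hm; have /or4P[] : [|| m == 2, m == 3, m == 4 | m == 5]%N by lia.
all: by move/eqP->; split; expand; poly_nneg ([::] : seq rat).
Qed.

(** The line e = 2i + 2 is d = 3i + 2. Four overlapping cones cover m >= i + 3 up to seven points;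
    the closer a cone comes to m = i + 3, the larger the i at which it starts. *)
Lemma ascent_poly2_ge0 (a s : rat) : 0 <= a -> 0 <= s ->
  forall i e m, e = 2 * i + 2 ->
  [\/ i = a + 1 /\ m = i + 6 + s, i = a + 2 /\ m = i + 5 + s,
      i = a + 3 /\ m = i + 4 + s | i = a + 5 /\ m = i + 3 + s] ->
  0 <= ascent_poly2 e i m (xn_mean (e + i) m) (xd_mean (e + i) m).
Proof.
by move=> ? ? i e m -> [] [-> ->]; expand; poly_nneg [:: a; s].
Qed.

Lemma ascent_poly2_ge0_pt :
  [/\ 0 <= ascent_poly2 4 1 6 1 (6 + 1), 0 <= ascent_poly2 6 2 6 1 (6 + 2 + 1)
    & 0 <= ascent_poly2 10 4 7 1 (10 + 4 + 1)].
Proof. by split; expand; poly_nneg ([::] : seq rat). Qed.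

Definition Q4 e i m := (e + 4) * (m + i + 4) - 5 * (e + m + 3).
(** [N4 / D4] is the nested expression 1 + 2(e+m+1)/((e+2)(m+i+2)) (1 + 3(e+m+2)/((e+3)(m+i+3)) (1 +
    4(e+m+3)/[Q4])), which results from three summations by parts closed by [hsum_lower] at J =
    4. *)
Definition N4 e i m :=
  (e + 2) * (m + i + 2) * (e + 3) * (m + i + 3) * Q4 e i m +
  2 * (e + m + 1) * ((e + 3) * (m + i + 3) * Q4 e i m +
                     3 * (e + m + 2) * (Q4 e i m + 4 * (e + m + 3))).
Definition D4 e i m := (e + 2) * (e + 3) * (m + i + 2) * (m + i + 3) * Q4 e i m.

Definition descent_poly4 e i m :=
  (e - 1) * i * (e + m + i + 1) * (e + m - 1) * N4 e i m
  - bracket_num e i m * (e + 1) * D4 e i m.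

(** The variable t is the slack i + 1 - m. The line m = i + 2 has its own shift in the next lemma,
    from i = 2 on. *)
Lemma descent_poly4_ge0 (t s : rat) : 0 <= t -> 0 <= s ->
  forall i e m, i = s + t + 1 -> e = 2 * i + 2 -> m = s + 2 ->
  0 <= descent_poly4 e i m.
Proof.
move=> ? ? i e m -> -> ->; rewrite /descent_poly4 /N4 /D4 /Q4; expand.
by poly_nneg [:: t; s].
Qed.

Lemma descent_poly4_ge0_2 (a : rat) : 0 <= a ->
  forall i e m, i = a + 2 -> e = 2 * i + 2 -> m = i + 2 ->
  0 <= descent_poly4 e i m.
Proof.
move=> ? i e m -> -> ->; rewrite /descent_poly4 /N4 /D4 /Q4; expand.
by poly_nneg [:: a].
Qed.
End Rational.

(** * Truncated hypergeometric sums *)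

Definition shifted_prod (J i h : nat) : rat := \prod_(j < J.+1) (h + i + j)%:R.

Definition hsum (J E i m : nat) : rat :=
  \sum_(h < m) (E + h)`!%:R / (h`!%:R * shifted_prod J i h).

(** The boundary term at h = m in the summation by parts; the factor m makes the one at h = 0
    vanish. *)
Definition hlead (J E i m : nat) : rat :=
  (E + m)`!%:R * m%:R / (m`!%:R * shifted_prod J i m).

Lemma natr_gt0 (n : nat) : (0 < n)%N -> 0 < n%:R :> rat.
Proof. by rewrite ltr0n. Qed.

Lemma fact_neq0 (n : nat) : n`!%:R != 0 :> rat.
Proof. by rewrite pnatr_eq0 -lt0n fact_gt0. Qed.

Lemma shifted_prod_gt0 J i h : (0 < i)%N -> 0 < shifted_prod J i h.
Proof. by move=> i0; apply: prodr_gt0 => j _; apply: natr_gt0; lia. Qed.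

Lemma shifted_prodSr J i h :
  shifted_prod J.+1 i h = shifted_prod J i h * (h + i + J.+1)%:R.
Proof. by rewrite /shifted_prod big_ord_recr. Qed.

Lemma shifted_prodS J i h :
  shifted_prod J i h.+1 * (h + i)%:R = shifted_prod J i h * (h + i + J.+1)%:R.
Proof.
rewrite -shifted_prodSr /shifted_prod [RHS]big_ord_recl mulrC addn0.
by congr (_ * _); apply: eq_bigr => j _; congr (_%:R); rewrite /= /bump; lia.
Qed.

Lemma hsumS J E i m :
  hsum J E i m.+1 = hsum J E i m + (E + m)`!%:R / (m`!%:R * shifted_prod J i m).
Proof. by rewrite /hsum big_ord_recr. Qed.

(* Summation by parts against (E+h)!/h!, the difference in h of
   h (E+h)! / (h! (E+1)). *)
Lemma hsum_rec J E i m : (0 < i)%N ->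
  E.+1%:R * hsum J E i m = hlead J E i m + J.+1%:R * hsum J.+1 E.+1 i m.
Proof.
move=> i0; elim: m => [|m IH].
  by rewrite /hlead /hsum !big_ord0 !(mulr0, mul0r, addr0).
rewrite !hsumS !mulrDr IH.
suff : E.+1%:R * ((E + m)`!%:R / (m`!%:R * shifted_prod J i m)) =
    hlead J E i m.+1 - hlead J E i m +
    J.+1%:R * ((E.+1 + m)`!%:R / (m`!%:R * shifted_prod J.+1 i m)).
  by move=> ->; ring.
rewrite /hlead shifted_prodSr addnS !addSn.
have p0 : shifted_prod J i m != 0 by rewrite gt_eqF ?shifted_prod_gt0.
have pS : shifted_prod J i m.+1 = shifted_prod J i m * (m + i + J.+1)%:R / (m + i)%:R.
  by rewrite -shifted_prodS mulfK // pnatr_eq0; lia.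
have mi0 : (m + i)%:R != 0 :> rat by rewrite pnatr_eq0; lia.
have q0 : (m + i + J.+1)%:R != 0 :> rat by rewrite pnatr_eq0; lia.
rewrite pS !factS !natrM; have := fact_neq0 m; have m0 : m.+1%:R != 0 :> rat by rewrite pnatr_eq0.
move: mi0 q0 m0 p0; rewrite !natrD -!natr1 !natrD.
set p := shifted_prod _ _ _; set F := (_`!%:R); set f := (_`!%:R) => *.
by field; repeat (apply/andP; split).
Qed.

(** The quotient of the h-th terms is (E + h + 1) / (h + i + J + 1). As i + J <= E it is
    nonincreasing in h, so its least value for h < m is (E + m) / (m + i + J), at h = m - 1. *)
Lemma hsum_ratio J E i m : (0 < i)%N -> (i + J <= E)%N ->
  (E + m)%:R * hsum J E i m <= (m + i + J)%:R * hsum J.+1 E.+1 i m.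
Proof.
move=> i0 hE; rewrite /hsum !mulr_sumr; apply: ler_sum => h _.
rewrite shifted_prodSr addSn factS natrM.
have p0 := shifted_prod_gt0 J h i0.
have f0 := fact_gt0 h; have F0 := fact_gt0 (E + h).
have q0 : 0 < (h + i + J.+1)%:R :> rat by apply: natr_gt0; lia.
rewrite [leRHS](_ : _ = (E + h)`!%:R / (h`!%:R * shifted_prod J i h) *
  ((m + i + J)%:R * (E + h).+1%:R / (h + i + J.+1)%:R)); last first.
  move: (lt0r_neq0 p0) (fact_neq0 h) (lt0r_neq0 q0).
  move: (shifted_prod _ _ _) (h`!%:R) ((h + i + J.+1)%:R : rat) => p f q *.
  by field; repeat (apply/andP; split).
rewrite mulrC; apply: ler_wpM2l; first by rewrite divr_ge0 ?mulr_ge0 ?ler0n // ltW.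
rewrite ler_pdivlMr // -!natrM ler_nat.
move: (nat_of_ord h) (ltn_ord h) {p0 f0 F0 q0} => {}h hm.
have [k ->] : exists k, E = (i + J + k)%N by exists (E - (i + J))%N; lia.
have [l ->] : exists l, m = (h + l.+1)%N by exists (m - h.+1)%N; lia.
nia.
Qed.

(** [hsum_ratio] bounds the remainder sum in [hsum_rec] below by a multiple of the original sum,
    which closes the recursion. The bound is informative when the factor on the right is positive;
    [QA], [QB], [QB2] and [Q4] are its instances. *)
Lemma hsum_lower J E i m : (0 < i)%N -> (i + J <= E)%N ->
  hlead J E i m * (m + i + J)%:R <=
  hsum J E i m * (E.+1%:R * (m + i + J)%:R - J.+1%:R * (E + m)%:R).
Proof.
move=> i0 hE; have := hsum_ratio m i0 hE; have := hsum_rec J E m i0.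
move=> h1 h2; set S := hsum J E i m in h1 h2 *; set S' := hsum J.+1 _ _ _ in h1 h2.
rewrite -subr_ge0 (_ : _ - _ = J.+1%:R * ((m + i + J)%:R * S' - (E + m)%:R * S)).
  by rewrite mulr_ge0 ?ler0n // subr_ge0.
rewrite mulrBr mulrA [S * _]mulrC h1; ring.
Qed.

(** * Sign of the coefficient differences *)

Definition weight (e m : nat) : rat := (e + m)`!%:R * m%:R / m`!%:R.

Lemma weight_gt0 e m : (0 < m)%N -> 0 < weight e m.
Proof. by move=> m0; rewrite divr_gt0 ?mulr_gt0 ?ltr0n ?fact_gt0. Qed.

Lemma shifted_prod1 i h : shifted_prod 1 i h = (h%:R + i%:R) * (h%:R + i%:R + 1).
Proof. by rewrite /shifted_prod !big_ord_recr big_ord0 /= mul1r addn0 !natrD. Qed.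

(* Both sums reduce to sum_h (e+1+h)!/(h! (h+i)) modulo closed forms; eliminating
   it gives this relation. *)
Lemma hsum_contiguity e i m : (0 < i)%N ->
  e.+2%:R * gap e.+2%:R i%:R * (gap e.+2%:R i%:R - 1) * hsum 1 e.+1 i.+1 m +
  (e.+2%:R - 1) * i%:R * hsum 1 e.+2 i m =
  weight e m * bracket e.+2%:R i%:R m%:R.
Proof.
move=> i0; elim: m => [|m IH].
  by rewrite /hsum !big_ord0 /weight !(mulr0, mul0r, addr0).
rewrite !hsumS; set c1 := _ * (gap _ _ - 1) in IH *.
set c2 := (_ - 1) * i%:R in IH *.
rewrite (mulrDr c1) (mulrDr c2) addrACA IH /c1 /c2 {c1 c2 IH} !shifted_prod1 /weight !addSn
  addnS !factS !natrM.
rewrite /bracket /gap -!natr1 !natrD.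
have {}i0 : 0 < i%:R :> rat by rewrite ltr0n.
have m0 : 0 <= m%:R :> rat by rewrite ler0n.
have := fact_neq0 m.
move: ((e + m)`!%:R : rat) (m`!%:R : rat) => F f.
move: (e%:R : rat) (i%:R : rat) (m%:R : rat) i0 m0 => {}e {}i {}m i0 m0 f0.
field.
rewrite f0 /=; repeat (apply/andP; split); apply: lt0r_neq0; lra.
Qed.

Section Comparison.
Variables (e i m : rat) (A B w x : rat).
Hypotheses (w_gt0 : 0 < w)
  (contiguity : e * gap e i * (gap e i - 1) * B + (e - 1) * i * A = w * bracket e i m).

Definition coef_diff : rat :=
  e * gap e i * (gap e i - 1) * (e + m) * B - (i + 1) * i * (e - 1) * A + x * ell e i m * w.

(** Eliminating B by contiguity leaves A with a nonpositive coefficient, so a lower bound on A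
    bounds the difference from above. *)
Lemma coef_diff_le0 r : 0 <= (e - 1) * i * (e + m + i + 1) -> w * r <= A ->
  (e + m) * bracket e i m - (e - 1) * i * (e + m + i + 1) * r + x * ell e i m <= 0 ->
  coef_diff <= 0.
Proof.
move=> c0 hr h.
have -> : coef_diff = (e + m) * (w * bracket e i m)
    - (e - 1) * i * (e + m + i + 1) * A + x * ell e i m * w.
  by rewrite -contiguity /coef_diff; ring.
apply: le_trans (_ : w * ((e + m) * bracket e i m -
  (e - 1) * i * (e + m + i + 1) * r + x * ell e i m) <= 0); last first.
  by rewrite pmulr_rle0.
rewrite -subr_ge0 (_ : _ - _ = (e - 1) * i * (e + m + i + 1) * (A - w * r)); last by ring.
by rewrite mulr_ge0 // subr_ge0.
Qed.

(** Eliminating A instead leaves B with a nonnegative coefficient, and a lower bound on B bounds the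
    difference from below. *)
Lemma coef_diff_ge0 r : 0 <= (e + m + i + 1) * e * gap e i * (gap e i - 1) ->
  w * r <= B ->
  0 <= (e + m + i + 1) * e * gap e i * (gap e i - 1) * r
       - (i + 1) * bracket e i m + x * ell e i m ->
  0 <= coef_diff.
Proof.
move=> c0 hr h.
have -> : coef_diff = (e + m + i + 1) * e * gap e i * (gap e i - 1) * B
    - (i + 1) * (w * bracket e i m) + x * ell e i m * w.
  by rewrite -contiguity /coef_diff; ring.
apply: (@le_trans _ _ (w * ((e + m + i + 1) * e * gap e i * (gap e i - 1) * r -
  (i + 1) * bracket e i m + x * ell e i m))).
  by rewrite pmulr_rge0.
rewrite -subr_ge0 (_ : _ - _ =
  (e + m + i + 1) * e * gap e i * (gap e i - 1) * (B - w * r)); last by ring.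
by rewrite mulr_ge0 // subr_ge0.
Qed.
End Comparison.

(* A positive multiple of the difference of the coefficients of index i + 1 and i,
   see sparse_coef_step. *)
Definition step_sign (e i m : nat) (x : rat) : rat :=
  coef_diff e%:R i%:R m%:R (hsum 1 e i m) (hsum 1 e.-1 i.+1 m) (weight e.-2 m) x.

Lemma step_contiguity e i m : (0 < i)%N -> (2 <= e)%N ->
  e%:R * gap e%:R i%:R * (gap e%:R i%:R - 1) * hsum 1 e.-1 i.+1 m +
  (e%:R - 1) * i%:R * hsum 1 e i m = weight e.-2 m * bracket e%:R i%:R m%:R.
Proof. by case: e => [|[|e]] // i0 _; apply: hsum_contiguity. Qed.

Lemma shifted_prod2 i h :
  shifted_prod 2 i h = (h%:R + i%:R) * (h%:R + i%:R + 1) * (h%:R + i%:R + 2).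
Proof. by rewrite shifted_prodSr shifted_prod1 !natrD. Qed.

Lemma hlead_weight J E k i m (c : rat) :
  (E + m)`!%:R = c * (k + m)`!%:R -> hlead J E i m = weight k m * c / shifted_prod J i m.
Proof. by move=> h; rewrite /hlead /weight h invfM; ring. Qed.

Lemma factD2 e m : (2 <= e)%N ->
  (e + m)`!%:R = (e%:R + m%:R) * (e%:R + m%:R - 1) * (e.-2 + m)`!%:R :> rat.
Proof.
case: e => [|[|e]] // _; rewrite !addSn !factS !natrM -!natr1 !natrD /=; ring.
Qed.

Lemma factD1 e m : (2 <= e)%N ->
  (e.-1 + m)`!%:R = (e%:R + m%:R - 1) * (e.-2 + m)`!%:R :> rat.
Proof.
by case: e => [|[|e]] // _; rewrite !addSn !factS !natrM -!natr1 !natrD /=; ring.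
Qed.

Lemma QA_gt0 (e i m : rat) : 1 <= i -> i + 1 <= e -> 0 <= m -> 0 < QA e i m.
Proof. by rewrite /QA => *; nra. Qed.

Lemma QB_gt0 (e i m : rat) : 1 <= i -> i + 3 <= e -> 0 <= m -> 0 < QB e i m.
Proof. by rewrite /QB => *; nra. Qed.

Lemma QB2_gt0 (e i m : rat) : 1 <= i -> i + 3 <= e -> 0 <= m -> 0 < QB2 e i m.
Proof. by rewrite /QB2 => *; nra. Qed.

Lemma hsum_A_lower e i m : (0 < i)%N -> (i < e)%N -> (0 < m)%N ->
  weight e.-2 m * ((e%:R + m%:R) * (e%:R + m%:R - 1) /
    (QA e%:R i%:R m%:R * (m%:R + i%:R))) <= hsum 1 e i m.
Proof.
move=> i0 ie m0; have := @hsum_lower 1 e i m i0; rewrite addn1 => /(_ ie).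
rewrite (hlead_weight (k := e.-2) _ _ (factD2 _ _)); last by lia.
rewrite shifted_prod1 -natr1 !natrD.
have i1 : 1 <= i%:R :> rat by rewrite ler1n.
have ie1 : i%:R + 1 <= e%:R :> rat by rewrite natr1 ler_nat.
have m1 : 1 <= m%:R :> rat by rewrite ler1n.
have q0 : 0 < QA e%:R i%:R m%:R by apply: QA_gt0; rewrite ?ler0n.
rewrite -[_ * _ - _]/(QA e%:R i%:R m%:R).
move: (e%:R : rat) (i%:R : rat) (m%:R : rat) i1 ie1 m1 q0 (hsum _ _ _ _) (weight _ _)
  => {}e {}i {}m {i0 ie m0} i0 ie m0 q0 S w h.
rewrite -ler_pdivrMr // in h; apply: le_trans h; rewrite le_eqVlt; apply/orP; left; apply/eqP;
  field.
by repeat (apply/andP; split); apply: lt0r_neq0; lra.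
Qed.

Lemma hsum_B_lower e i m : (0 < i)%N -> (i + 3 <= e)%N -> (0 < m)%N ->
  weight e.-2 m * ((e%:R + m%:R - 1) / (QB e%:R i%:R m%:R * (m%:R + i%:R + 1)))
  <= hsum 1 e.-1 i.+1 m.
Proof.
move=> i0 ie m0; have := @hsum_lower 1 e.-1 i.+1 m isT; rewrite addn1.
have -> : (e.-1).+1 = e by lia.
have h1 : (i.+2 <= e.-1)%N by lia.
move=> /(_ h1); rewrite (hlead_weight (k := e.-2) _ _ (factD1 _ _)); last by lia.
have -> : (e.-1 + m)%:R = e%:R + m%:R - 1 :> rat.
  by rewrite (_ : e = (e.-1).+1) -?natr1 ?natrD /=; [ring | lia].
rewrite shifted_prod1 -!natr1 !natrD.
have i1 : 1 <= i%:R :> rat by rewrite ler1n.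
have ie1 : i%:R + 3 <= e%:R :> rat by rewrite -natrD ler_nat.
have m1 : 1 <= m%:R :> rat by rewrite ler1n.
have q0 : 0 < QB e%:R i%:R m%:R by apply: QB_gt0; rewrite ?ler0n.
rewrite -!natr1 [X in _ <= _ * X](_ : _ = QB e%:R i%:R m%:R); last by rewrite /QB; ring.
move: (e%:R : rat) (i%:R : rat) (m%:R : rat) i1 ie1 m1 q0 (hsum _ _ _ _) (weight _ _)
  => {}e {}i {}m {i0 ie m0 h1} i0 ie m0 q0 S w h.
rewrite -ler_pdivrMr // in h; apply: le_trans h; rewrite le_eqVlt; apply/orP; left; apply/eqP;
  field.
by repeat (apply/andP; split); apply: lt0r_neq0; lra.
Qed.

(** A sharper form for the line d = 3i + 2: one exact summation by parts comes first, and
    [hsum_lower] is applied only to the remainder sum, at J = 2. *)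
Lemma hsum_B_lower2 e i m : (0 < i)%N -> (i + 3 <= e)%N -> (0 < m)%N ->
  weight e.-2 m * ((e%:R + m%:R - 1) / (e%:R * (m%:R + i%:R + 1) * (m%:R + i%:R + 2))
     * (1 + 2 * (e%:R + m%:R) / QB2 e%:R i%:R m%:R))
  <= hsum 1 e.-1 i.+1 m.
Proof.
move=> i0 ie m0; have := @hsum_rec 1 e.-1 i.+1 m isT.
have h2 : (i.+1 + 2 <= e)%N by lia.
have := @hsum_lower 2 e i.+1 m isT h2.
have -> : (e.-1).+1 = e by lia.
rewrite (hlead_weight (k := e.-2) _ _ (factD1 _ _)); last by lia.
rewrite (hlead_weight (k := e.-2) _ _ (factD2 _ _)); last by lia.
rewrite shifted_prod1 shifted_prod2 -!natr1 !natrD -!natr1.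
have i1 : 1 <= i%:R :> rat by rewrite ler1n.
have ie1 : i%:R + 3 <= e%:R :> rat by rewrite -natrD ler_nat.
have m1 : 1 <= m%:R :> rat by rewrite ler1n.
have q0 : 0 < QB2 e%:R i%:R m%:R by apply: QB2_gt0; rewrite ?ler0n.
rewrite [X in _ <= _ * X](_ : _ = QB2 e%:R i%:R m%:R); last by rewrite /QB2; ring.
move: (e%:R : rat) (i%:R : rat) (m%:R : rat) i1 ie1 m1 q0 (hsum 2 _ _ _) (hsum 1 _ _ _)
  (weight _ _) => {}e {}i {}m {i0 ie m0 h2} i0 ie m0 q0 S2 S w h hS.
have e0 : 0 < e by lra.
rewrite -(ler_pM2l e0) [leRHS](_ : _ = w * (e + m - 1) / ((m + (i + 1)) * (m + (i + 1) + 1)) + 2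
  * S2).
  rewrite -ler_pdivrMr // in h; rewrite -lerBlDl.
  apply: (@le_trans _ _ (2 * (w * ((e + m) * (e + m - 1)) / ((m + (i + 1)) *
    (m + (i + 1) + 1) * (m + (i + 1) + 2)) * (m + i + 3) / QB2 e i m))).
    rewrite le_eqVlt; apply/orP; left; apply/eqP; field.
    by repeat (apply/andP; split); apply: lt0r_neq0; lra.
  rewrite ler_pM2l //; apply: le_trans h; rewrite le_eqVlt; apply/orP; left.
  by apply/eqP; congr (_ * _ / _); ring.
by rewrite mulrC in hS *; rewrite (_ : S * e = S * (e - 1 + 1)); [|ring]; lra.
Qed.

Lemma hlead_succ J E i m : (0 < i)%N ->
  hlead J.+1 E.+1 i m = hlead J E i m * ((E%:R + m%:R + 1) / (m%:R + i%:R + J.+1%:R)).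
Proof.
move=> i0; rewrite /hlead shifted_prodSr addSn factS natrM -natr1 !natrD !invfM; ring.
Qed.

Lemma Q4_gt0 (e i m : rat) : 1 <= i -> i + 1 <= e -> 0 <= m -> 0 < Q4 e i m.
Proof. by rewrite /Q4 => *; nra. Qed.

Lemma hsum_A_lower4 e i m : (0 < i)%N -> (i < e)%N -> (0 < m)%N ->
  weight e.-2 m * ((e%:R + m%:R) * (e%:R + m%:R - 1) /
    ((e%:R + 1) * (m%:R + i%:R) * (m%:R + i%:R + 1)) *
    (N4 e%:R i%:R m%:R / D4 e%:R i%:R m%:R)) <= hsum 1 e i m.
Proof.
move=> i0 ie m0.
have h1 := @hsum_rec 1 e i m i0; have h2 := @hsum_rec 2 e.+1 i m i0.
have h3 := @hsum_rec 3 e.+2 i m i0.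
have ie4 : (i + 4 <= e.+3)%N by lia.
have := @hsum_lower 4 e.+3 i m i0 ie4.
move: h1 h2 h3; rewrite !hlead_succ //.
rewrite (hlead_weight (k := e.-2) _ _ (factD2 _ _)); last by lia.
rewrite shifted_prod1 -!natr1 !natrD.
have i1 : 1 <= i%:R :> rat by rewrite ler1n.
have ie1 : i%:R + 1 <= e%:R :> rat by rewrite natr1 ler_nat.
have m1 : 1 <= m%:R :> rat by rewrite ler1n.
have q0 : 0 < Q4 e%:R i%:R m%:R by apply: Q4_gt0; rewrite ?ler0n.
move: (e%:R : rat) (i%:R : rat) (m%:R : rat) i1 ie1 m1 q0
  (hsum 1 _ _ _) (hsum 2 _ _ _) (hsum 3 _ _ _) (hsum 4 _ _ _) (weight _ _)
  => {}e {}i {}m {i0 ie m0 ie4} i0 ie m0 q0 S1 S2 S3 S4 w h1 h2 h3.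
rewrite [X in _ <= _ * X](_ : _ = Q4 e i m); last by rewrite /Q4; ring.
set l4 := (X in X * _ <= _) => h4.
have {}h4 : l4 * (m + i + 4) / Q4 e i m <= S4.
  rewrite ler_pdivrMr //; apply: le_trans h4; rewrite le_eqVlt; apply/orP; left.
have -> : S1 = (w * ((e + m) * (e + m - 1)) / ((m + i) * (m + i + 1)) + 2 * S2) / (e + 1).
  have e1 : e + 1 != 0 by apply: lt0r_neq0; lra.
  apply: (mulfI e1); rewrite mulrC [in RHS]mulrC divfK //; move: h1; lra.
have -> : S2 = (w * ((e + m) * (e + m - 1)) / ((m + i) * (m + i + 1)) * ((e + m + 1) / (m + i +
  2)) + 3 * S3) / (e + 2).
  have e1 : e + 2 != 0 by apply: lt0r_neq0; lra.
  apply: (mulfI e1); rewrite mulrC [in RHS]mulrC divfK //; move: h2.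
  have -> : (m + i + (1 + 1)) = m + i + 2 by ring.
  lra.
have -> : S3 = (w * ((e + m) * (e + m - 1)) / ((m + i) * (m + i + 1)) * ((e + m + 1) / (m + i +
  2)) * ((e + m + 2) / (m + i + 3)) + 4 * S4) / (e + 3).
  have e1 : e + 3 != 0 by apply: lt0r_neq0; lra.
  apply: (mulfI e1); rewrite mulrC [in RHS]mulrC divfK //; move: h3.
  have -> : (m + i + (1 + 1)) = m + i + 2 by ring.
  have -> : (m + i + (1 + 1 + 1)) = m + i + 3 by ring.
  have -> : (e + 1 + m + 1) = e + m + 2 by ring.
  lra.
(* The constant 24 = 2 * 3 * 4 collects the factors J + 1 of the three summations by parts. *)
have d0 : 0 <= 24 / ((e + 1) * (e + 2) * (e + 3)) by apply: divr_ge0; nra.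
rewrite -subr_ge0 (_ : _ - _ = 24 / ((e + 1) * (e + 2) * (e + 3)) *
   (S4 - l4 * (m + i + 4) / Q4 e i m)); first by rewrite mulr_ge0 // subr_ge0.
rewrite /N4 /D4 /l4 {l4 h4}; move: (Q4 e i m) q0 => q q0.
field; repeat (apply/andP; split); apply: lt0r_neq0; lra.
Qed.

Lemma ellE (e i m : rat) : e - 2 != 0 -> i + 2 != 0 -> m != 0 -> e + 1 != 0 ->
  ell e i m = 2 * (e + m) * (e + m - 1) * ell_num e i /
    ((i + 2) * (e - 2) * (m * (e + 1))).
Proof.
by rewrite /ell /ell_num; move: (gap e i) => *; field; repeat (apply/andP; split).
Qed.

Lemma ell_ge0 (e i m : rat) : 2 < e -> 0 < i -> 0 < m ->
  (0 <= ell e i m) = (0 <= ell_num e i).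
Proof.
move=> e2 i0 m0; rewrite ellE ?lt0r_neq0 //; try lra.
rewrite pmulr_lge0 ?invr_gt0; last by rewrite !mulr_gt0 //; lra.
by rewrite pmulr_rge0 // !mulr_gt0 //; lra.
Qed.

Lemma ell_le0 (e i m : rat) : 2 < e -> 0 < i -> 0 < m ->
  (ell e i m <= 0) = (ell_num e i <= 0).
Proof.
move=> e2 i0 m0; rewrite ellE ?lt0r_neq0 //; try lra.
rewrite pmulr_lle0 ?invr_gt0; last by rewrite !mulr_gt0 //; lra.
by rewrite pmulr_rle0 // !mulr_gt0 //; lra.
Qed.

Lemma descent_expr_le0 (e i m xn xd : rat) : 1 <= i -> 1 <= m -> 0 < xd ->
  i + 1 <= e -> 3 <= e -> 0 <= descent_poly e i m xn xd ->
  (e + m) * bracket e i m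
  - (e - 1) * i * (e + m + i + 1) *
     ((e + m) * (e + m - 1) / (QA e i m * (m + i))) + xn / xd * ell e i m <= 0.
Proof.
move=> i1 m1 d0 ie e3; have q0 : 0 < QA e i m by apply: QA_gt0 => //; lra.
have [a0 a1 a2] : [/\ 0 < m + i, 0 < m + i + 1 & 0 < m] by split; lra.
have [a3 a4 a5] : [/\ 0 < e + 1, 0 < i + 2 & 0 < e - 2] by split; lra.
have a6 : 0 <= e + m by lra.
rewrite descent_polyE ?lt0r_neq0 // oppr_le0 => hp.
by rewrite divr_ge0 ?(mulr_ge0 a6) // ltW // !mulr_gt0.
Qed.

Lemma descent4_expr_le0 (e i m : rat) : 1 <= i -> 1 <= m ->
  i + 1 <= e -> 3 <= e -> 0 <= descent_poly4 e i m ->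
  (e + m) * bracket e i m
  - (e - 1) * i * (e + m + i + 1) *
     ((e + m) * (e + m - 1) / ((e + 1) * (m + i) * (m + i + 1)) *
      (N4 e i m / D4 e i m)) <= 0.
Proof.
move=> i1 m1 ie e3 hp; have q0 : 0 < Q4 e i m by apply: Q4_gt0 => //; lra.
have [a0 a1 a2] : [/\ 0 < m + i, 0 < m + i + 1 & 0 < e + 1] by split; lra.
have a6 : 0 <= e + m by lra.
have d4 : 0 < D4 e i m by rewrite /D4 !mulr_gt0 //; lra.
rewrite [leLHS](_ : _ = - ((e + m) * descent_poly4 e i m /
    ((m + i) * (m + i + 1) * (e + 1) * D4 e i m))).
  rewrite oppr_le0 divr_ge0 ?(mulr_ge0 a6) // ltW //; apply: mulr_gt0 d4.
  by rewrite !mulr_gt0.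
rewrite /descent_poly4 /bracket /bracket_num.
move: (gap e i) (N4 _ _ _) (D4 _ _ _) d4 {hp q0} => g n4 d {}d4.
by field; repeat (apply/andP; split); apply: lt0r_neq0.
Qed.

Lemma ascent_expr_ge0 (e i m xn xd : rat) : 1 <= i -> 1 <= m -> 0 < xd ->
  i + 3 <= e -> 0 <= ascent_poly e i m xn xd ->
  0 <= (e + m + i + 1) * e * gap e i * (gap e i - 1) *
     ((e + m - 1) / (QB e i m * (m + i + 1)))
  - (i + 1) * bracket e i m + xn / xd * ell e i m.
Proof.
move=> i1 m1 d0 ie; have q0 : 0 < QB e i m by apply: QB_gt0 => //; lra.
have [a0 a1 a2] : [/\ 0 < m + i, 0 < m + i + 1 & 0 < m] by split; lra.
have [a3 a4 a5] : [/\ 0 < e + 1, 0 < i + 2 & 0 < e - 2] by split; lra.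
rewrite ascent_polyE ?lt0r_neq0 // => hp.
by rewrite divr_ge0 // ltW // !mulr_gt0.
Qed.

Lemma ascent2_expr_ge0 (e i m xn xd : rat) : 1 <= i -> 1 <= m -> 0 < xd ->
  i + 3 <= e -> 0 <= ascent_poly2 e i m xn xd ->
  0 <= (e + m + i + 1) * e * gap e i * (gap e i - 1) *
     ((e + m - 1) / (e * (m + i + 1) * (m + i + 2))
       * (1 + 2 * (e + m) / QB2 e i m))
  - (i + 1) * bracket e i m + xn / xd * ell e i m.
Proof.
move=> i1 m1 d0 ie; have q0 : 0 < QB2 e i m by apply: QB2_gt0 => //; lra.
have [a0 a1 a2] : [/\ 0 < m + i, 0 < m + i + 1 & 0 < m] by split; lra.
have [a3 a4 a5] : [/\ 0 < e + 1, 0 < i + 2 & 0 < e - 2] by split; lra.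
have [a6 a7] : 0 < m + i + 2 /\ 0 < e by split; lra.
rewrite ascent_poly2E ?lt0r_neq0 // => hp.
by rewrite divr_ge0 // ltW // !mulr_gt0.
Qed.

Section Signs.
Variables (e i m : nat) (x : rat).
Hypotheses (i0 : (0 < i)%N) (m0 : (0 < m)%N) (x0 : 0 <= x).

Let i1 : 1 <= i%:R :> rat. Proof. by rewrite ler1n. Qed.
Let m1 : 1 <= m%:R :> rat. Proof. by rewrite ler1n. Qed.

Lemma descent_coef_ge0 : (i < e)%N ->
  0 <= (e%:R - 1) * i%:R * (e%:R + m%:R + i%:R + 1) :> rat.
Proof.
move=> ie; have e1 : 1 <= e%:R :> rat by rewrite ler1n (leq_ltn_trans _ ie).
by rewrite !mulr_ge0 ?subr_ge0 // ?addr_ge0 ?ler0n.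
Qed.

Lemma ascent_coef_ge0 : (i + 3 <= e)%N ->
  0 <= (e%:R + m%:R + i%:R + 1) * e%:R * gap e%:R i%:R * (gap e%:R i%:R - 1) :> rat.
Proof.
move=> ie; have : i%:R + 3 <= e%:R :> rat by rewrite -natrD ler_nat.
move=> h; have g1 : 1 <= gap e%:R i%:R by rewrite /gap; lra.
have g0 := le_trans ler01 g1; move: (gap _ _) g1 g0 => g g1 g0.
by rewrite !mulr_ge0 ?subr_ge0 // !addr_ge0 ?ler0n.
Qed.

Lemma descent_of_poly xn xd : (i < e)%N -> (2 < e)%N -> 0 <= ell_num e%:R i%:R ->
  0 < xd -> x <= xn / xd -> 0 <= descent_poly e%:R i%:R m%:R xn xd ->
  step_sign e i m x <= 0.
Proof.
move=> ie e2 hl d0 hx hp.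
have e3 : 3 <= e%:R :> rat by rewrite ler_nat.
apply: (coef_diff_le0 (weight_gt0 e.-2 m0) (step_contiguity m i0 (ltnW e2))
  (descent_coef_ge0 ie) (hsum_A_lower i0 ie m0)).
have hl' : 0 <= ell e%:R i%:R m%:R by rewrite ell_ge0 ?ltr0n // (lt_le_trans _ e3).
apply: (le_trans (lerD (lexx _) (ler_wpM2r hl' hx))).
by apply: descent_expr_le0; rewrite // natr1 ler_nat.
Qed.

(** Since [ell] is nonpositive here, the x-term only helps and is dropped: the descent holds for
    every x >= 0, without a density bound. *)
Lemma descent4_of_poly : (i < e)%N -> (2 < e)%N -> ell_num e%:R i%:R <= 0 ->
  0 <= descent_poly4 e%:R i%:R m%:R -> step_sign e i m x <= 0.
Proof.
move=> ie e2 hl hp.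
have e3 : 3 <= e%:R :> rat by rewrite ler_nat.
apply: (coef_diff_le0 (weight_gt0 e.-2 m0) (step_contiguity m i0 (ltnW e2))
  (descent_coef_ge0 ie) (hsum_A_lower4 i0 ie m0)).
have hl' : ell e%:R i%:R m%:R <= 0 by rewrite ell_le0 ?ltr0n // (lt_le_trans _ e3).
rewrite -[leRHS]addr0; apply: lerD; last exact: mulr_ge0_le0.
by apply: descent4_expr_le0; rewrite // natr1 ler_nat.
Qed.

Hypothesis ie : (i + 3 <= e)%N.

Let e2 : (1 < e)%N. Proof. by apply: leq_trans ie; rewrite addn3. Qed.
Let e3 : 3 <= e%:R :> rat.
Proof. by rewrite ler_nat (leq_trans _ ie) // addn3. Qed.

Lemma ascent_of_poly xn xd : ell_num e%:R i%:R <= 0 ->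
  0 < xd -> x <= xn / xd -> 0 <= ascent_poly e%:R i%:R m%:R xn xd ->
  0 <= step_sign e i m x.
Proof.
move=> hl d0 hx hp.
apply: (coef_diff_ge0 (weight_gt0 e.-2 m0) (step_contiguity m i0 e2)
  (ascent_coef_ge0 ie) (hsum_B_lower i0 ie m0)).
have hl' : ell e%:R i%:R m%:R <= 0 by rewrite ell_le0 ?ltr0n // (lt_le_trans _ e3).
apply: le_trans (lerD (lexx _) (ler_wnM2r hl' hx)).
by apply: ascent_expr_ge0; rewrite // -natrD ler_nat.
Qed.

Lemma ascent2_of_poly xn xd : ell_num e%:R i%:R <= 0 ->
  0 < xd -> x <= xn / xd -> 0 <= ascent_poly2 e%:R i%:R m%:R xn xd ->
  0 <= step_sign e i m x.
Proof.
move=> hl d0 hx hp.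
apply: (coef_diff_ge0 (weight_gt0 e.-2 m0) (step_contiguity m i0 e2)
  (ascent_coef_ge0 ie) (hsum_B_lower2 i0 ie m0)).
have hl' : ell e%:R i%:R m%:R <= 0 by rewrite ell_le0 ?ltr0n // (lt_le_trans _ e3).
apply: le_trans (lerD (lexx _) (ler_wnM2r hl' hx)).
by apply: ascent2_expr_ge0; rewrite // -natrD ler_nat.
Qed.
End Signs.

(** The minimum of 1 / (d + 1) and 1 / (m + 1) is not a rational function. This weighted mean is
    one, and it exceeds the minimum by a factor of at most (1 + sqrt 2) / 2, so a single polynomial
    inequality treats d < m and m < d together. *)
Lemma le_mean (d m x : rat) : 0 <= d -> 0 <= m ->
  x * (d + 1) <= 1 -> x * (m + 1) <= 1 -> x <= xn_mean d m / xd_mean d m.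
Proof.
move=> d0 m0 hd hm; have s0 : 0 < xd_mean d m by rewrite /xd_mean; nra.
by rewrite ler_pdivlMr // /xn_mean /xd_mean; nra.
Qed.

Lemma xd_mean_gt0 (d m : rat) : 0 <= d -> 0 <= m -> 0 < xd_mean d m.
Proof. by move=> d0 m0; rewrite /xd_mean; nra. Qed.

Lemma ascent_cases i e : (0 < i)%N -> (2 * i + 3 <= e)%N ->
  exists a t, i = (a + 1)%N /\ e = (2 * i + 3 + t)%N.
Proof. by move=> i0 ie; exists (i - 1)%N, (e - (2 * i + 3))%N; lia. Qed.

Lemma descent_cases i e : (2 <= i)%N -> (i < e)%N -> (e <= 2 * i + 1)%N ->
  [\/ exists a v, i = (a + v + 2)%N /\ e = (2 * a + v + 3)%N,
      exists a, i = (a + 3)%N /\ e = (2 * a + 6)%N,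
      exists a, i = (a + 4)%N /\ e = (2 * a + 9)%N
    | (i, e) \in [:: (2, 4); (2, 5); (3, 7)]%N].
Proof.
move=> i2 ie ei.
have [h|[h|h]] : (e <= 2 * i - 1)%N \/ e = (2 * i)%N \/ e = (2 * i + 1)%N by lia.
- by apply: Or41; exists (e - i - 1)%N, (2 * i - 1 - e)%N; lia.
- have [h'|h'] : (3 <= i)%N \/ i = 2%N by lia.
    by apply: Or42; exists (i - 3)%N; lia.
  by apply: Or44; rewrite h h'.
- have [h'|[h'|h']] : (4 <= i)%N \/ i = 2%N \/ i = 3%N by lia.
  + by apply: Or43; exists (i - 4)%N; lia.
  + by apply: Or44; rewrite h h'.
  + by apply: Or44; rewrite h h'.
Qed.

Definition small_density (e i m : nat) (x : rat) : Prop :=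
  [/\ 0 <= x, x * (e%:R + i%:R + 1) <= 1 & x * (m%:R + 1) <= 1].

Section Density.
Variables (e i m : nat) (x : rat).
Hypothesis hx : small_density e i m x.

Lemma density_le_mean :
  x <= xn_mean (e%:R + i%:R) m%:R / xd_mean (e%:R + i%:R) m%:R.
Proof. by case: hx => *; apply: le_mean; rewrite // -?natrD ?ler0n. Qed.

Lemma density_mean_gt0 : 0 < xd_mean (e%:R + i%:R) m%:R.
Proof. by apply: xd_mean_gt0; rewrite -?natrD ?ler0n. Qed.

Lemma density_d1_gt0 : 0 < e%:R + i%:R + 1 :> rat.
Proof. by rewrite -natrD ltr_wpDl ?ler0n. Qed.

Lemma density_m1_gt0 : 0 < m%:R + 1 :> rat.
Proof. by rewrite ltr_wpDl ?ler0n. Qed.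

Lemma density_le_d : x <= 1 / (e%:R + i%:R + 1).
Proof. by case: hx => *; rewrite ler_pdivlMr ?density_d1_gt0. Qed.

Lemma density_le_m : x <= 1 / (m%:R + 1).
Proof. by case: hx => *; rewrite ler_pdivlMr ?density_m1_gt0. Qed.
End Density.

Lemma ascent_sign e i m x : small_density e i m x ->
  (0 < i)%N -> (2 * i + 3 <= e)%N -> (2 <= m)%N -> 0 <= step_sign e i m x.
Proof.
move=> hx i0 ie m2; have m0 := ltnW m2.
have ie' : (i + 3 <= e)%N by rewrite (leq_trans _ ie) // leq_add2r leq_pmull.
have [a [t [iE eE]]] := ascent_cases i0 ie.
have {}iE : i%:R = a%:R + 1 :> rat by rewrite iE natrD.
have {}eE : e%:R = 2 * i%:R + 3 + t%:R :> rat by rewrite eE 2!natrD natrM.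
have a0 : 0 <= a%:R :> rat by rewrite ler0n.
have t0 : 0 <= t%:R :> rat by rewrite ler0n.
have hl : ell_num e%:R i%:R <= 0 :> rat.
  by rewrite -oppr_ge0 eE iE /ell_num /gap; poly_nneg [:: (a%:R : rat); t%:R].
have [m3|m3] := leqP m 2.
  have m2' : m = 2%N by apply/eqP; rewrite eqn_leq m3.
  have h := ascent_of_poly i0 m0 ie' hl (density_d1_gt0 e i) (density_le_d hx).
  by apply: h; rewrite m2'; exact: (ascent_poly_ge0_2 a0 t0 iE eE).
apply: (ascent_of_poly i0 m0 ie' hl (density_mean_gt0 e i m) (density_le_mean hx)).
apply: (@ascent_poly_ge0 a%:R t%:R (m - 3)%N%:R); rewrite ?ler0n //.
by rewrite -natrD subnK.
Qed.

Lemma descent_sign e i m x : small_density e i m x ->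
  (2 <= i)%N -> (i < e)%N -> (e <= 2 * i + 1)%N -> (2 <= m)%N ->
  step_sign e i m x <= 0.
Proof.
move=> hx i2 ie ei m2; have m0 := ltnW m2; have i0 := ltnW i2.
have e2 : (2 < e)%N := leq_ltn_trans i2 ie.
have mean h := descent_of_poly i0 m0 ie e2 h (density_mean_gt0 e i m) (density_le_mean hx).
have by_d h := descent_of_poly i0 m0 ie e2 h (density_d1_gt0 e i) (density_le_d hx).
have by_m h := descent_of_poly i0 m0 ie e2 h (density_m1_gt0 m) (density_le_m hx).
have s0 : 0 <= (m - 2)%N%:R :> rat by rewrite ler0n.
have mE : m%:R = (m - 2)%N%:R + 2 :> rat by rewrite -natrD subnK.
case: (descent_cases i2 ie ei) => [[a [v [iE eE]]]|[a [iE eE]]|[a [iE eE]]|].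
- have {}iE : i%:R = a%:R + v%:R + 2 :> rat by rewrite iE 2!natrD.
  have {}eE : e%:R = 2 * a%:R + v%:R + 3 :> rat by rewrite eE 2!natrD natrM.
  apply: mean; last by apply: (@descent_poly_ge0_1 a%:R v%:R _ _ _ s0); rewrite ?ler0n.
  have [a0 v0] : 0 <= a%:R :> rat /\ 0 <= v%:R :> rat by rewrite !ler0n.
  by rewrite eE iE /ell_num /gap; poly_nneg [:: (a%:R : rat); v%:R].
- have {}iE : i%:R = a%:R + 3 :> rat by rewrite iE natrD.
  have {}eE : e%:R = 2 * a%:R + 6 :> rat by rewrite eE natrD natrM.
  have a0 : 0 <= a%:R :> rat by rewrite ler0n.
  apply: mean; last exact: (descent_poly_ge0_2 a0 s0).
  by rewrite eE iE /ell_num /gap; poly_nneg [:: (a%:R : rat)].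
- have {}iE : i%:R = a%:R + 4 :> rat by rewrite iE natrD.
  have {}eE : e%:R = 2 * a%:R + 9 :> rat by rewrite eE natrD natrM.
  have a0 : 0 <= a%:R :> rat by rewrite ler0n.
  apply: mean; last exact: (descent_poly_ge0_3 a0 s0).
  by rewrite eE iE /ell_num /gap; poly_nneg [:: (a%:R : rat)].
- have [m5|m6] := leqP m 5.
    have m25 : (2 <= m <= 5)%N by rewrite m2.
    have [h1 h2 h3] := descent_poly_ge0_5 m25.
    rewrite !inE => /or3P[] /eqP[ei' ee]; move: by_d; rewrite ei' ee; apply;
      first [assumption | by rewrite /ell_num /gap; poly_nneg ([::] : seq rat)].
  have m60 : 0 <= (m - 6)%N%:R :> rat by rewrite ler0n.
  have [|h1 h2 h3] := descent_poly_ge0_4 m60 (m := m%:R); first by rewrite -natrD subnK.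
  rewrite !inE => /or3P[] /eqP[ei' ee]; move: by_m; rewrite ei' ee; apply;
    first [assumption | by rewrite /ell_num /gap; poly_nneg ([::] : seq rat)].
Qed.

Lemma factD_S E m : (E + m.+1)`!%:R = (E%:R + m%:R + 1) * (E + m)`!%:R :> rat.
Proof. by rewrite addnS factS natrM -natr1 natrD. Qed.

Lemma hsum0 J E i : hsum J E i 0 = 0.
Proof. by rewrite /hsum big_ord0. Qed.

Lemma factS_rat (n : nat) : n.+1`!%:R = n.+1%:R * n`!%:R :> rat.
Proof. by rewrite factS natrM. Qed.

(** The number e stays a variable of known value in [rat], so that all factorials reduce to (e -
    2)!, which is kept opaque and factored out, while the sum over h < m is written out term by
    term. *)
Ltac step_eval e he e2 e2E F F0 :=
  move=> he;
  have e2 : (1 < e)%N; [by rewrite -(ltr_nat rat) he |];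
  have e2E : e.-2%:R = e%:R - 2 :> rat; [by rewrite -subn2 natrB |];
  rewrite /step_sign /coef_diff /weight /ell /gap /= !hsumS !hsum0 !shifted_prod1
    !(factD2 _ e2) !(factD1 _ e2) !factD_S !addn0 !factS_rat !fact0 e2E he;
  have := fact_neq0 e.-2; move: (e.-2`!%:R : rat) => F F0; field; rewrite ?F0; exact: isT.

Lemma step_sign_4_1_3 e x : e%:R = 4 :> rat ->
  step_sign e 1 3 x = e.-2`!%:R * (- 18 - 168 * x).
Proof. step_eval e he e2 e2E F F0. Qed.

Lemma step_sign_4_1_4 e x : e%:R = 4 :> rat ->
  step_sign e 1 4 x = e.-2`!%:R * (8 - 336 * x).
Proof. step_eval e he e2 e2E F F0. Qed.

Lemma step_sign_4_1_5 e x : e%:R = 4 :> rat ->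
  step_sign e 1 5 x = e.-2`!%:R * (60 - 3024 / 5 * x).
Proof. step_eval e he e2 e2E F F0. Qed.

Lemma step_sign_6_2_5 e x : e%:R = 6 :> rat ->
  step_sign e 2 5 x = e.-2`!%:R * (285 - 4455 * x).
Proof. step_eval e he e2 e2E F F0. Qed.

Lemma step_sign_8_3_6 e x : e%:R = 8 :> rat ->
  step_sign e 3 6 x = e.-2`!%:R * (3404 + 4 / 5 - 224 * 1001 / 5 * x).
Proof. step_eval e he e2 e2E F F0. Qed.

Lemma ell_num_crit i : (0 < i)%N -> ell_num (2 * i + 2)%N%:R i%:R <= 0 :> rat.
Proof.
move=> i0; have s0 : 0 <= (i - 1)%N%:R :> rat by rewrite ler0n.
have -> : i%:R = (i - 1)%N%:R + 1 :> rat by rewrite natr1 subn1 prednK.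
have -> : (2 * i + 2)%:R = 2 * (i - 1)%N%:R + 4 :> rat.
  by rewrite -natrM -natrD; congr (_%:R); lia.
rewrite -oppr_ge0 /ell_num /gap; poly_nneg [:: ((i - 1)%N%:R : rat)].
Qed.

Lemma critical_descent_sign i m x : 0 <= x -> (0 < i)%N -> (2 <= m <= i + 2)%N ->
  step_sign (2 * i + 2) i m x <= 0.
Proof.
move=> x0 i0 /andP[m2 mi]; have m0 := ltnW m2.
have ie : (i < 2 * i + 2)%N by lia.
have e2 : (2 < 2 * i + 2)%N by lia.
have eE : (2 * i + 2)%:R = 2 * i%:R + 2 :> rat by rewrite natrD natrM.
have main := descent4_of_poly i0 m0 x0 ie e2 (ell_num_crit i0).
have [mi1|mi2] := leqP m (i + 1).
  apply/main/(@descent_poly4_ge0 (i + 1 - m)%N%:R (m - 2)%N%:R); rewrite ?ler0n //.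
    by rewrite -[1]/(1%:R) -!natrD; congr (_%:R); lia.
  by rewrite -natrD subnK.
have [i2|i1] := leqP 2 i.
  apply/main/(@descent_poly4_ge0_2 (i - 2)%N%:R); rewrite ?ler0n //.
    by rewrite -natrD subnK.
  by rewrite -natrD; congr (_%:R); lia.
(* The one point outside both shifts is d = 5, m = 3, where the exact value is a positive multiple
   of -18 - 168 x. *)
have [-> ->] : i = 1%N /\ m = 3 by lia.
rewrite (step_sign_4_1_3 _ (erefl : (2 * 1 + 2)%N%:R = 4)) pmulr_rle0; first by lra.
by rewrite ltr0n fact_gt0.
Qed.

(** Of the seven points outside the cones of [ascent_poly2_ge0], three are settled by a single
    density bound. The last list, read as (m, d) with d = 3i + 2, consists of the pairs of the
    exceptional cases. *)
Lemma critical_cases i m : (0 < i)%N -> (i + 3 <= m)%N ->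
  [\/ exists a s, i = (a + 1)%N /\ m = (i + 6 + s)%N,
      exists a s, i = (a + 2)%N /\ m = (i + 5 + s)%N,
      exists a s, i = (a + 3)%N /\ m = (i + 4 + s)%N
    | exists a s, i = (a + 5)%N /\ m = (i + 3 + s)%N] \/
  (i, m) \in [:: (1, 6); (2, 6); (4, 7)]%N \/
  (i, m) \in [:: (1, 4); (1, 5); (2, 5); (3, 6)]%N.
Proof.
move=> i0 im; have [h|h] := leqP (i + 6) m.
  by left; apply: Or41; exists (i - 1)%N, (m - i - 6)%N; lia.
have [i5|i5] := leqP 5 i.
  by left; apply: Or44; exists (i - 5)%N, (m - i - 3)%N; lia.
have [[i3 m4]|] : (3 <= i)%N /\ (i + 4 <= m)%N \/ ~ ((3 <= i)%N /\ (i + 4 <= m)%N) by lia.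
  by left; apply: Or43; exists (i - 3)%N, (m - i - 4)%N; lia.
have [[i2 m5]|] : (2 <= i)%N /\ (i + 5 <= m)%N \/ ~ ((2 <= i)%N /\ (i + 5 <= m)%N) by lia.
  by left; apply: Or42; exists (i - 2)%N, (m - i - 5)%N; lia.
by right; rewrite !inE !xpair_eqE; lia.
Qed.

Lemma critical_ascent_sign i m x : small_density (2 * i + 2) i m x ->
  (0 < i)%N -> (i + 3 <= m)%N ->
  (i, m) \notin [:: (1, 4); (1, 5); (2, 5); (3, 6)]%N ->
  0 <= step_sign (2 * i + 2) i m x.
Proof.
move=> hx i0 im hne; have m0 : (0 < m)%N by apply: leq_trans im; rewrite addn3.
have ie : (i + 3 <= 2 * i + 2)%N by lia.
have hl := ell_num_crit i0.
have mean := ascent2_of_poly i0 m0 ie hl (density_mean_gt0 _ _ _) (density_le_mean hx).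
have eE : (2 * i + 2)%:R = 2 * i%:R + 2 :> rat by rewrite natrD natrM.
have [h|[h|h]] := critical_cases i0 im; last by rewrite h in hne.
- have mE j s : m = (i + j + s)%N -> m%:R = i%:R + j%:R + s%:R :> rat.
    by move->; rewrite !natrD.
  have iE a j : i = (a + j)%N -> i%:R = a%:R + j%:R :> rat by move->; rewrite natrD.
  have fin a s := @ascent_poly2_ge0 a%:R s%:R (ler0n _ a) (ler0n _ s) _ _ m%:R eE.
  apply: mean; case: h => [] [a [s [/iE hi /mE hm]]]; apply: (fin a s).
  + by apply: Or41; split; [exact: hi | exact: hm].
  + by apply: Or42; split; [exact: hi | exact: hm].
  + by apply: Or43; split; [exact: hi | exact: hm].
  + by apply: Or44; split; [exact: hi | exact: hm].
- have by_m := ascent2_of_poly i0 m0 ie hl (density_m1_gt0 m) (density_le_m hx).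
  have by_d := ascent2_of_poly i0 m0 ie hl (density_d1_gt0 _ _) (density_le_d hx).
  have [h1 h2 h3] := ascent_poly2_ge0_pt.
  move: h; rewrite !inE => /or3P[] /eqP[ei em]; move: by_m by_d; rewrite ei em.
  + by move=> + _; apply; exact: h1.
  + by move=> _; apply; exact: h2.
  + by move=> _; apply; exact: h3.
Qed.

(** * Closed forms of the coefficients *)

Lemma alt_sum_binomial (R : comNzRingType) n s K :
  \sum_(j < K) (-1) ^+ j * 'C(n.+1, (s + j).+1)%:R =
  'C(n, s)%:R - (-1) ^+ K * 'C(n, s + K)%:R :> R.
Proof.
elim: K => [|K IH]; first by rewrite big_ord0 expr0 mul1r addn0 subrr.
by rewrite big_ord_recr /= IH binS natrD addnS exprS; ring.
Qed.

Lemma alt_sum_binomial_full (R : comNzRingType) n s K : (n < s + K)%N ->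
  \sum_(j < K) (-1) ^+ j * 'C(n.+1, (s + j).+1)%:R = 'C(n, s)%:R :> R.
Proof. by move=> h; rewrite alt_sum_binomial (bin_small h) mulr0 subr0. Qed.

Lemma trinomial N a b : (b <= a)%N ->
  ('C(N, a) * 'C(a, b) = 'C(N, b) * 'C(N - b, a - b))%N.
Proof.
move=> ba; have [Na|aN] := ltnP N a.
  rewrite (bin_small Na) mul0n; have [Nb|bN] := ltnP N b.
    by rewrite (bin_small Nb).
  by rewrite [X in (_ * X)%N]bin_small ?muln0 // ltn_sub2rE.
have bN := leq_trans ba aN.
apply/eqP; rewrite -(eqn_pmul2r (fact_gt0 b)) -(eqn_pmul2r (fact_gt0 (a - b))).
rewrite -(eqn_pmul2r (fact_gt0 (N - a))); apply/eqP.
have e1 := bin_fact ba; have e2 := bin_fact aN; have e3 := bin_fact bN.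
have e4 : ('C(N - b, a - b) * ((a - b)`! * (N - a)`!) = (N - b)`!)%N.
  by rewrite -(@bin_fact (N - b) (a - b)) ?leq_sub2r // subnBA // subnK.
transitivity N`!; first by rewrite -e2 -e1; ring.
by rewrite -e3 -e4; ring.
Qed.

Section AltSums.
Variable K : nat.

(** The alternating sum left in [uniform_coef] once trinomial revision has pulled out a binomial
    independent of the summation index. The cutoff K is free because terms with s + j > N vanish. *)
Definition altF (N m s : nat) : rat :=
  \sum_(j < K) (-1) ^+ j * ('C(N, s + j) * 'C((s + j).-1, m))%:R.

(** Adding the sums for m and m + 1 merges their second binomials by Pascal's rule; trinomial
    revision then leaves a telescoping alternating sum. *)
Lemma altF_pascal_m m p q : (p < q + K)%N ->
  altF (m + p.+2) m (m + q.+2) + altF (m + p.+2) m.+1 (m + q.+2) =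
  ('C(m + p.+2, m.+1) * 'C(p, q))%:R.
Proof.
move=> pq; rewrite natrM -(alt_sum_binomial_full rat pq) mulr_sumr -big_split /=.
apply: eq_bigr => j _; rewrite -mulrDr -natrD -mulnDr mulrCA -natrM.
have sE : (m + q.+2 + j = (m + q.+1 + j).+1)%N by rewrite addnS.
rewrite sE /= [X in (_ * X)%N]addnC -binS trinomial; last by lia.
by congr (_ * (_ * 'C(_, _))%:R); lia.
Qed.

Lemma altF_pascal_N m p q : (p < q + K)%N ->
  altF (m + p.+2) m (m + q.+2) =
  altF (m + p.+1) m (m + q.+2) + ('C(m + p.+1, m) * 'C(p, q))%:R.
Proof.
move=> pq; rewrite natrM -(alt_sum_binomial_full rat pq) mulr_sumr -big_split /=.
apply: eq_bigr => j _; rewrite mulrCA -mulrDr -natrM -natrD.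
have sE : (m + q.+2 + j = (m + q.+1 + j).+1)%N by rewrite addnS.
rewrite sE addnS binS mulnDl; congr (_ * (_ + _)%:R).
rewrite /= trinomial; last by lia.
by congr (_ * 'C(_, _))%N; lia.
Qed.

Lemma altF_shift N m s : (N < s + K)%N ->
  altF N m s = ('C(N, s) * 'C(s.-1, m))%:R - altF N m s.+1.
Proof.
move=> NK; pose t j : rat := (-1) ^+ j * ('C(N, s + j) * 'C((s + j).-1, m))%:R.
have -> : altF N m s = \sum_(j < K.+1) t j.
  by rewrite big_ord_recr /= {2}/t bin_small // mul0n mulr0 addr0.
rewrite big_ord_recl /t expr0 mul1r !addn0 -sumrN; congr (_ + _).
by apply: eq_bigr => j _; rewrite /bump /= ?add1n exprS addnS -addSn mulN1r mulNr.
Qed.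

(** The Pascal relations in m and in N, combined with the shift of s, eliminate the intermediate
    sums and give a first-order recurrence in m with explicit increment. *)
Lemma altF_step e i m : (0 < i)%N -> (e <= K)%N -> (1 < e)%N ->
  altF (m.+1 + e) m.+1 (m.+1 + i.+1) = altF (m + e) m (m + i.+1) +
    ('C(m.+1 + e, m + i.+1) * 'C(m + i, m.+1))%:R
    - ('C(m + e, m.+1) * 'C(e.-1, i.-1))%:R.
Proof.
case: i e => [|i] [|[|e]] //= _ eK _.
have h1 : (e.+1 < i + K)%N by lia.
have -> : (m.+1 + i.+2 = (m + i.+2).+1)%N by rewrite addSn.
have -> : (m.+1 + e.+2 = m + e.+3)%N by rewrite addSnnS.
have h2 : (m + e.+3 < m + i.+2 + K)%N by lia.
have := altF_shift m.+1 h2; have := altF_pascal_m m h1.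
rewrite (altF_pascal_N m h1) (_ : (m + i.+2).-1 = (m + i.+1)%N); last by rewrite addnS.
have : 'C(m + e.+3, m.+1)%:R = 'C(m + e.+2, m.+1)%:R + 'C(m + e.+2, m)%:R :> rat.
  by rewrite addnS binS natrD.
rewrite !natrM => ->; move: (altF _ _ _) (altF _ _ _) (altF _ _ _) => u v w h3 h4.
by rewrite (_ : u = 'C(m + e.+3, m + i.+2)%:R * 'C(m + i.+1, m.+1)%:R - v); lra.
Qed.

Lemma altF0 e i : (e <= K)%N -> (0 < e)%N -> altF e 0 i.+1 = ('C(e.-1, i))%:R.
Proof.
case: e => // e eK _; rewrite -(@alt_sum_binomial_full rat e i K); last by lia.
by apply: eq_bigr => j _; rewrite bin0 muln1 addSn.
Qed.
End AltSums.

Lemma binr_fact n k : (k <= n)%N ->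
  'C(n, k)%:R = n`!%:R / (k`!%:R * (n - k)`!%:R) :> rat.
Proof.
move=> kn; rewrite -(bin_fact kn) !natrM mulfK //.
by rewrite mulf_neq0 ?fact_neq0.
Qed.

Lemma factr n : n.+1`!%:R = (n%:R + 1) * n`!%:R :> rat.
Proof. by rewrite factS natrM -natr1. Qed.

Lemma binr_fact_eq n k l : n = (k + l)%N ->
  'C(n, k)%:R = n`!%:R / (k`!%:R * l`!%:R) :> rat.
Proof. by move->; rewrite binr_fact ?leq_addr // addKn. Qed.

(** The coefficient index is i + 1, and g is the gap e - (i + 1) - 1. In the induction on m, the
    increment of [altF_step] is the new term of the [hsum] plus the change of the binomial part. *)
Lemma altF_closed K i g e m : (e <= K)%N -> e = (i + g + 2)%N ->
  altF K (m + e) m (m + i.+2) =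
  hsum 1 e i.+1 m / (g`!%:R * i`!%:R * e%:R) +
  'C(m + e, m + i.+1)%:R * 'C(m + i, m)%:R * g.+1%:R / e%:R.
Proof.
move=> eK eE; have e1 : (1 < e)%N by rewrite eE addn2.
have e0 : e%:R != 0 :> rat by rewrite pnatr_eq0 eE addn2.
elim: m => [|m IH].
  rewrite !add0n altF0 //; last exact: ltnW.
  rewrite /hsum big_ord0 mul0r add0r bin0 mulr1; apply: (mulfI e0).
  rewrite [RHS]mulrC divfK // -!natrM mul_bin_down mulnC; congr (_ * _)%:R.
  by rewrite eE; lia.
have h1 : (m.+1 + e = m + i.+2 + g.+1)%N by rewrite eE; lia.
have h2 : (m + e = m.+1 + e.-1)%N by rewrite eE; lia.
have h3 : (e.-1 = i + g.+1)%N by rewrite eE; lia.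
have h4 : (m + e = m + i.+1 + g.+1)%N by rewrite eE; lia.
have h5 : (m + i.+1 = m.+1 + i)%N by rewrite addnS.
have eR : e%:R = i%:R + g%:R + 2 :> rat by rewrite eE !natrD.
rewrite (altF_step m _ eK e1) // IH hsumS shifted_prod1.
rewrite (_ : (m.+1 + i.+1 = m + i.+2)%N); last by rewrite addSnnS.
rewrite (_ : (m.+1 + i = m + i.+1)%N); last by rewrite addSnnS.
rewrite /= !natrM (binr_fact_eq h1) (binr_fact_eq h2) (binr_fact_eq h3) (binr_fact_eq h4).
rewrite (binr_fact_eq h5) (binr_fact_eq (erefl (m + i)%N)).
rewrite addSn !addnS [(e + m)%N]addnC !factr !natrD -!natr1 !natrD.
have := fact_neq0 e.-1; have := fact_neq0 i; have := fact_neq0 g.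
have := fact_neq0 m; have := fact_neq0 (m + i).
have mi : m%:R + i%:R + 1 != 0 :> rat by rewrite -natrD natr1 pnatr_eq0.
have mi2 : m%:R + i%:R + 1 + 1 != 0 :> rat by rewrite -natrD !natr1 pnatr_eq0.
have g1 : g%:R + 1 != 0 :> rat by rewrite natr1 pnatr_eq0.
have m1 : m%:R + 1 != 0 :> rat by rewrite natr1 pnatr_eq0.
move: e0 mi mi2 g1 m1; rewrite eR.
move: ((m + e)`!%:R : rat) (e.-1`!%:R : rat) (i`!%:R : rat) (g`!%:R : rat) (m`!%:R : rat).
move: ((m + i)`!%:R : rat) (hsum _ _ _ _) (m%:R : rat) (i%:R : rat) (g%:R : rat).
move=> {}m0 {}A {}M {}I {}G f1 f2 f3 f4 f5 *.
field; repeat (apply/andP; split); assumption.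
Qed.

Lemma altF_widen k r N m s : (N < s + k)%N -> altF (k + r) N m s = altF k N m s.
Proof.
move=> Nk; elim: r => [|r IH]; first by rewrite addn0.
rewrite /altF addnS big_ord_recr /= -/(altF (k + r) N m s) IH bin_small ?mul0n ?mulr0 ?addr0 //.
by lia.
Qed.

(** The ring is a parameter: over [int] this is a coefficient of [uniform_poly], while the closed
    form needs division and lives in [rat]. *)
Definition uniform_coef (R : comNzRingType) (m d i : nat) : R :=
  \sum_(i.*2.+1 <= D < d.+1) (-1) ^+ D.+1 * 'C(m + d, m + D)%:R *
    ('C(m + D, i)%:R * 'C((m + D - i).-1, m)%:R
     - 'C(m + D, D - i)%:R * 'C((m + i).-1, m)%:R).

Definition relax_coef (R : comNzRingType) (d i : nat) : R :=
  \sum_(i.*2.+1 <= D < d.+1) (-1) ^+ D.+1 * 'C(d, D)%:R *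
    ('C(D, i.+1)%:R - 'C(D, i.-1)%:R).

Lemma uniform_coefE m d i : (0 < i)%N -> (i.*2 < d)%N ->
  uniform_coef rat m d i = 'C(m + d, i)%:R * hsum 1 (d - i) i m /
    ((d - i.*2).-1`!%:R * i.-1`!%:R * (d - i)%:R).
Proof.
case: i => // i _ id /=; set g := (d - (i.+1).*2).-1; set e := (d - i.+1)%N.
have eE : e = (i + g + 2)%N by rewrite /e /g; lia.
have dE : (d = i.+1 + e)%N by rewrite /e; lia.
rewrite /uniform_coef -{1}[(i.+1).*2.+1]add0n big_addn big_mkord.
have -> : (d.+1 - (i.+1).*2.+1 = g.+1)%N by rewrite /g; lia.
have {}id : (i <= d)%N by lia.
(* Trinomial revision pulls 'C(m + d, i + 1) out of the first products and 'C(m + d, m + i + 1) out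
   of the second ones, whose alternating sum is elementary. *)
transitivity ('C(m + d, i.+1)%:R * altF g.+1 (m + e) m (m + i.+2)
  - 'C(m + d, m + i.+1)%:R * 'C(m + i, m)%:R * 'C(e.-1, i.+1)%:R).
  have -> : 'C(e.-1, i.+1)%:R = altF g.+1 e 0 i.+2.
    rewrite -(@altF0 e) //; last by rewrite eE addn2.
    have -> : e = (g.+1 + i.+1)%N by rewrite eE; lia.
    by rewrite altF_widen //; lia.
  rewrite /altF !mulr_sumr -sumrB; apply: eq_bigr => j _.
  have -> : (-1) ^+ (j + (i.+1).*2.+1).+1 = (-1) ^+ j :> rat.
    by rewrite -[LHS]signr_odd -[RHS]signr_odd; congr (_ ^+ nat_of_bool _); lia.
  have h1 : ('C(m + d, m + (j + (i.+1).*2.+1)) * 'C(m + (j + (i.+1).*2.+1), i.+1) =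
     'C(m + d, i.+1) * 'C(m + e, m + i.+2 + j))%N.
    by rewrite trinomial; [congr (_ * 'C(_, _))%N; rewrite /e; lia | lia].
  have h2 : ('C(m + d, m + (j + (i.+1).*2.+1)) * 'C(m + (j + (i.+1).*2.+1), j + (i.+1).*2.+1 -
    i.+1) =
     'C(m + d, m + i.+1) * 'C(e, i.+2 + j))%N.
    rewrite -[X in (_ * X)%N]bin_sub; last by lia.
    by rewrite trinomial; [congr ('C(_, _) * 'C(_, _))%N; rewrite /e; lia | lia].
  rewrite mulrBr -![_ * 'C(m + d, _)%:R * _]mulrA [in LHS](mulrA 'C(m + d, _)%:R).
  rewrite [X in _ - _ * X]mulrA -!natrM h1 h2 bin0 muln1 !natrM.
  have -> : (m + (j + (i.+1).*2.+1) - i.+1).-1 = (m + i.+2 + j).-1 by lia.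
  by rewrite (addnS m i) /=; ring.
have eK : (e <= g.+1 + i.+1)%N by rewrite eE; lia.
rewrite -(@altF_widen g.+1 i.+1); last by rewrite eE; lia.
(* The binomial part of [altF_closed] cancels the second product, so only the [hsum] remains. *)
rewrite (altF_closed m eK eE) mulrDr -!addrA [X in _ + X](_ : _ = 0) ?addr0.
  by rewrite mulrA.
have e0 : e%:R != 0 :> rat by rewrite pnatr_eq0 eE addn2.
apply/eqP; rewrite subr_eq0; apply/eqP/(mulIf e0).
rewrite -[LHS]mulrA divfK // -!natrM; congr (_%:R).
have h : ('C(m + d, i.+1) * 'C(m + e, m + i.+1) = 'C(m + d, m + i.+1) * 'C(e, i.+1))%N.
  have le1 : (i.+1 <= m + (i.+1).*2)%N by lia.
  have le2 : (m + i.+1 <= m + (i.+1).*2)%N by lia.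
  have := trinomial (m + d) le1; have := trinomial (m + d) le2.
  rewrite -(bin_sub le2) (_ : m + (i.+1).*2 - (m + i.+1) = i.+1)%N; last by lia.
  rewrite (_ : m + (i.+1).*2 - i.+1 = m + i.+1)%N; last by lia.
  rewrite (_ : m + d - (m + i.+1) = e)%N; last by rewrite /e; lia.
  by rewrite (_ : m + d - i.+1 = m + e)%N; [move=> -> -> | rewrite /e; lia].
have h' : (e * 'C(e.-1, i.+1) = g.+1 * 'C(e, i.+1))%N.
  by rewrite mul_bin_down; congr (_ * _)%N; rewrite eE; lia.
transitivity ('C(m + d, m + i.+1) * 'C(e, i.+1) * ('C(m + i, m) * g.+1))%N.
  by rewrite -h; ring.
transitivity ('C(m + d, m + i.+1) * 'C(m + i, m) * (e * 'C(e.-1, i.+1)))%N.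
  by rewrite h'; ring.
by ring.
Qed.

Lemma relax_coefE d i : (0 < i)%N -> (i.*2 < d)%N ->
  relax_coef rat d i = 2 * d`!%:R /
    (i.+1`!%:R * i.-1`!%:R * (d - i.*2).-1`!%:R *
     (((d - i)%:R - 1) * ((d - i)%:R + 1))).
Proof.
case: i => // i _ id /=; set g := (d - (i.+1).*2).-1; set e := (d - i.+1)%N.
have [e0 eE] : exists e0, e = e0.+2 by exists (e - 2)%N; rewrite /e; lia.
have gE : (e0 = i + g)%N by rewrite /g; move: eE; rewrite /e; lia.
have dE : (d = i.+1 + e0.+2)%N by move: eE; rewrite /e; lia.
rewrite /relax_coef -{1}[(i.+1).*2.+1]add0n big_addn big_mkord.
have -> : (d.+1 - (i.+1).*2.+1 = g.+1)%N by rewrite /g; lia.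
transitivity ('C(d, i.+2)%:R * 'C(e0, i)%:R - 'C(d, i)%:R * 'C(e0.+2, i.+2)%:R : rat).
  have h1 : (e0 < i + g.+1)%N by lia.
  have h2 : (e0.+2 < i.+2 + g.+1)%N by lia.
  rewrite -(alt_sum_binomial_full rat h1) -(alt_sum_binomial_full rat h2).
  rewrite !mulr_sumr -sumrB; apply: eq_bigr => j _.
  have -> : (-1) ^+ (j + (i.+1).*2.+1).+1 = (-1) ^+ j :> rat.
    by rewrite -[LHS]signr_odd -[RHS]signr_odd; congr (_ ^+ nat_of_bool _); lia.
  have e1 : ('C(d, j + (i.+1).*2.+1) * 'C(j + (i.+1).*2.+1, i.+2) =
      'C(d, i.+2) * 'C(e0.+1, (i + j).+1))%N.
    by rewrite trinomial; [congr (_ * 'C(_, _))%N; lia | lia].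
  have e2 : ('C(d, j + (i.+1).*2.+1) * 'C(j + (i.+1).*2.+1, i) =
      'C(d, i) * 'C(e0.+3, (i.+2 + j).+1))%N.
    by rewrite trinomial; [congr (_ * 'C(_, _))%N; lia | lia].
  rewrite -mulrA mulrBr -!natrM e1 e2 !natrM; ring.
have h1 : (d = i.+2 + e0.+1)%N by rewrite dE; lia.
have h2 : (d = i + e0.+3)%N by rewrite dE; lia.
have h3 : (e0.+2 = i.+2 + g)%N by rewrite gE.
rewrite (binr_fact_eq h1) (binr_fact_eq h2) (binr_fact_eq h3) (binr_fact_eq gE) eE.
rewrite !factr -!natr1.
have f1 := fact_neq0 i; have f2 := fact_neq0 g; have f3 := fact_neq0 e0.
have [a1 a2 a3] : [/\ e0%:R + 1 != 0 :> rat, e0%:R + 1 + 1 != 0 :> rat & e0%:R + 1 + 1 + 1 != 0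
  :> rat].
  by rewrite !natr1 !pnatr_eq0.
have [a4 a5] : i%:R + 1 != 0 :> rat /\ i%:R + 1 + 1 != 0 :> rat by rewrite !natr1 !pnatr_eq0.
move: (d`!%:R : rat) (i`!%:R : rat) (g`!%:R : rat) (e0`!%:R : rat) (e0%:R : rat) (i%:R : rat) f1
  f2 f3 a1 a2 a3 a4 a5.
move=> D f1 f2 f3 E I *.
field; repeat (apply/andP; split); try assumption.
by rewrite addrK.
Qed.

Definition sparse_coef (R : comNzRingType) (m d lambda i : nat) : R :=
  uniform_coef R m d i - lambda%:R * relax_coef R d i.

Lemma uniform_coef_large (R : comNzRingType) m d i : (d <= i.*2)%N -> uniform_coef R m d i = 0.
Proof. by move=> di; rewrite /uniform_coef big_geq. Qed.

Lemma relax_coef_large (R : comNzRingType) d i : (d <= i.*2)%N -> relax_coef R d i = 0.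
Proof. by move=> di; rewrite /relax_coef big_geq. Qed.

Definition coef_unit (m d i : nat) : rat :=
  'C(m + d, i)%:R / ((d - i.*2).-1`!%:R * i.-1`!%:R * (d - i)%:R).

Lemma coef_unit_gt0 m d i : (i.*2 < d)%N -> 0 < coef_unit m d i.
Proof.
move=> id; rewrite divr_gt0 ?mulr_gt0 ?ltr0n ?fact_gt0 ?bin_gt0 ?subn_gt0 //; lia.
Qed.

Lemma sparse_coefE m d lambda i : (0 < i)%N -> (i.*2 < d)%N -> (0 < m)%N ->
  sparse_coef rat m d lambda i = coef_unit m d i *
    (hsum 1 (d - i) i m - lambda%:R / 'C(m + d, d)%:R *
      (2 * (d - i)%:R * (d - i + m)`!%:R /
       (m`!%:R * (i%:R + 1) * (((d - i)%:R - 1) * ((d - i)%:R + 1))))).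
Proof.
case: i => // i _ id m0; rewrite /sparse_coef uniform_coefE // relax_coefE // /coef_unit /=.
set g := (d - (i.+1).*2).-1; set e := (d - i.+1)%N.
rewrite mulrBr; congr (_ - _); first by ring.
have [e0 eE] : exists e0, e = e0.+2 by exists (e - 2)%N; rewrite /e; lia.
have h1 : (m + d = d + m)%N by rewrite addnC.
have h2 : (m + d = i.+1 + (e + m))%N by rewrite /e; lia.
rewrite (binr_fact_eq h1) (binr_fact_eq h2) !factr eE -!natr1.
have := fact_neq0 i; have := fact_neq0 g; have := fact_neq0 d; have := fact_neq0 m.
have := fact_neq0 (e0.+2 + m); have := fact_neq0 (m + d).
have : e0%:R + 1 != 0 :> rat by rewrite natr1 pnatr_eq0.
have : e0%:R + 1 + 1 != 0 :> rat by rewrite !natr1 pnatr_eq0.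
have : e0%:R + 1 + 1 + 1 != 0 :> rat by rewrite !natr1 pnatr_eq0.
have : i%:R + 1 != 0 :> rat by rewrite natr1 pnatr_eq0.
have : i%:R + 1 + 1 != 0 :> rat by rewrite !natr1 pnatr_eq0.
move: (d`!%:R : rat) (i`!%:R : rat) (g`!%:R : rat) ((e0.+2 + m)`!%:R : rat)
  (m`!%:R : rat) ((m + d)`!%:R : rat) (e0%:R : rat) (i%:R : rat) (lambda%:R : rat).
move=> f1 f2 f3 f4 f5 f6 E I L *.
field; repeat (apply/andP; split); try assumption; by rewrite addrK.
Qed.

Lemma gapE d i : (i.*2 < d)%N -> gap (d - i)%:R i%:R = (d - i.*2).-1%:R.
Proof.
move=> id; rewrite /gap -[1]/(1%:R) -!natrB; try lia.
by congr (_%:R); lia.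
Qed.

Lemma sparse_coef_step m d lambda i : (0 < i)%N -> (i.*2 < d)%N -> (0 < m)%N ->
  sparse_coef rat m d lambda i.+1 - sparse_coef rat m d lambda i =
  coef_unit m d i / ((i%:R + 1) * i%:R * ((d - i)%:R - 1)) *
  step_sign (d - i) i m (lambda%:R / 'C(m + d, d)%:R).
Proof.
move=> i0 id m0; rewrite [sparse_coef rat m d lambda i]sparse_coefE //.
rewrite /step_sign /coef_diff /ell gapE //.
set x := _ / 'C(_, _)%:R; set e := (d - i)%N; set g := (d - i.*2).-1.
have [e0 eE] : exists e0, e = e0.+2 by exists (e - 2)%N; rewrite /e; lia.
have wE : weight e.-2 m * (2 * (e%:R + m%:R) * (e%:R + m%:R - 1) / (m%:R * (e%:R + 1))) =
    2 * (e + m)`!%:R / (m`!%:R * (e%:R + 1)).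
  have e2 : (1 < e)%N by rewrite eE.
  rewrite (factD2 m e2) /weight.
  have m1 : m%:R != 0 :> rat by rewrite pnatr_eq0 -lt0n.
  have e1 : e%:R + 1 != 0 :> rat by rewrite natr1 pnatr_eq0.
  have := fact_neq0 m; move: (m`!%:R : rat) (e%:R : rat) (m%:R : rat) m1 e1 => f E M m1 e1 f0.
  field; repeat (apply/andP; split); assumption.
set A := hsum 1 e i m; set B := hsum _ _ _ _.
have e1 : e%:R - 1 != 0 :> rat by rewrite eE -natr1 addrK pnatr_eq0.
have e2 : e%:R + 1 != 0 :> rat by rewrite natr1 pnatr_eq0.
have i1 : i%:R != 0 :> rat by rewrite pnatr_eq0 -lt0n.
have i2 : i%:R + 1 != 0 :> rat by rewrite natr1 pnatr_eq0.
have mf := fact_neq0 m.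
(* Expressing the next coefficient in the unit of the i-th one produces the factor g (g - 1). It
   vanishes exactly when 2(i + 1) >= d, where the coefficient is zero, so one formula covers the end
   of the range too. *)
suff -> : sparse_coef rat m d lambda i.+1 = coef_unit m d i / ((i%:R + 1) * i%:R * (e%:R - 1)) *
   (g%:R * (g%:R - 1)) * (e%:R * (e%:R + m%:R) * B - x * (2 * (e + m)`!%:R / (m`!%:R * (e%:R + 1)) *
     ((e%:R * e%:R - 1) / ((i%:R + 2) * (e%:R - 2))))).
  rewrite [x * _ * weight _ _](_ : _ = x * (e%:R * i%:R - g%:R * (g%:R - 1) * (e%:R * e%:R - 1) /
      ((i%:R + 2) * (e%:R - 2))) * (weight e.-2 m * (2 * (e%:R + m%:R) * (e%:R + m%:R - 1) /
        (m%:R * (e%:R + 1)))));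
    last by ring.
  rewrite wE.
  move: (((i%:R + 2) * (e%:R - 2))^-1 : rat) => z.
  move: (coef_unit m d i) ((e + m)`!%:R : rat) => c f.
  field; repeat (apply/andP; split); assumption.
have [g2|g2] := leqP g 1.
  rewrite /sparse_coef uniform_coef_large ?relax_coef_large ?mulr0 ?subr0; try by move: g2;
    rewrite /g; lia.
  have -> : g%:R * (g%:R - 1) = 0 :> rat.
    by case: (g) g2 => [|[|]] // _; rewrite ?mul0r // subrr mulr0.
  by rewrite mulr0 mul0r.
have id' : ((i.+1).*2 < d)%N by move: g2; rewrite /g; lia.
rewrite sparse_coefE // -/x.
have -> : (d - i.+1 = e.-1)%N by rewrite /e; lia.
rewrite -/B /coef_unit.
have -> : (d - i.+1 = e.-1)%N by rewrite /e; lia.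
have [g0 gE] : exists g0, g = g0.+2 by exists (g - 2)%N; lia.
have -> : (d - (i.+1).*2).-1 = g0 by move: gE; rewrite /g; lia.
rewrite -/g -/e gE.
have fE : ((e + m)`!%:R = (e%:R + m%:R) * (e.-1 + m)`!%:R :> rat).
  by rewrite eE -[e0.+2.-1]/e0.+1 [in LHS]addSn factS natrM -addSn natrD.
have h1 : (m + d = i.+1 + (e.-1 + m))%N by move: eE; rewrite /e; lia.
have h2 : (m + d = i + (e + m))%N by move: eE; rewrite /e; lia.
rewrite (binr_fact_eq h1) (binr_fact_eq h2) fE.
have iE : i`!%:R = i%:R * i.-1`!%:R :> rat.
  by case: (i) i0 => // k _; rewrite factS natrM.
have i1E : i.+1%:R = i%:R + 1 :> rat by rewrite -natr1.
have g1E : g0.+1%:R = g0%:R + 1 :> rat by rewrite -natr1.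
have g2E : g0.+2%:R = g0%:R + 2 :> rat by rewrite -addn2 natrD.
rewrite !factr ?i1E ?g1E g2E /= !iE.
have e3 : e%:R - 2 != 0 :> rat.
  by rewrite eE -[2]/(2%:R) -natrB // subn2 pnatr_eq0; move: gE eE; rewrite /g /e; lia.
have -> : e.-1%:R = e%:R - 1 :> rat by rewrite eE -natr1 addrK.
have := fact_neq0 i.-1; have := fact_neq0 g0.
have := fact_neq0 (e.-1 + m); have := fact_neq0 (m + d).
have : g0%:R + 1 != 0 :> rat by rewrite natr1 pnatr_eq0.
have : i%:R + 2 != 0 :> rat by rewrite -natrD pnatr_eq0 addn2.
have : g0%:R + 2 != 0 :> rat by rewrite -natrD pnatr_eq0 addn2.
have : g0%:R + 1 + 1 != 0 :> rat by rewrite !natr1 pnatr_eq0.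
have : e%:R + m%:R != 0 :> rat by rewrite -natrD pnatr_eq0 eE.
have : e%:R != 0 :> rat by rewrite pnatr_eq0 eE.
move: e1 e2 i1 i2 mf e3.
move: (i.-1`!%:R : rat) (g0`!%:R : rat) ((e.-1 + m)`!%:R : rat) (x : rat)
  (m`!%:R : rat) ((m + d)`!%:R : rat) (e%:R : rat) (i%:R : rat) (g0%:R : rat) (m%:R : rat) (B :
    rat).
move=> f2 f3 f4 f5 f6 f7 E I G M BB *.
field; repeat (apply/andP; split); assumption.
Qed.

Lemma sparse_coef1_gt0 m d lambda : (2 <= m)%N -> (5 <= d)%N ->
  lambda%:R / 'C(m + d, d)%:R * (d%:R + 1) <= 1 :> rat ->
  lambda%:R / 'C(m + d, d)%:R * (m%:R + 1) <= 1 :> rat ->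
  0 < sparse_coef rat m d lambda 1.
Proof.
move=> m2 d5 hd hm; have m0 := ltnW m2.
have id : (1.*2 < d)%N by exact: leq_trans d5.
rewrite sparse_coefE // pmulr_rgt0 ?coef_unit_gt0 // subr_gt0.
have e4 : (4 <= d - 1)%N by rewrite leq_subRL // (leq_trans _ d5).
have dE : d%:R = (d - 1)%N%:R + 1 :> rat by rewrite natr1 subn1 prednK // (leq_trans _ d5).
rewrite dE in hd; move: (d - 1)%N e4 hd hm => e e4 hd hm.
have x0 : 0 <= lambda%:R / 'C(m + d, d)%:R :> rat by rewrite divr_ge0 ?ler0n.
move: (_ / 'C(_, _)%:R) x0 hd hm => x x0 hd hm.
have e2 : (1 < e)%N by apply: leq_trans e4.
apply: lt_le_trans (hsum_A_lower (i := 1) isT e2 m0).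
rewrite (factD2 m e2) /weight /QA.
have f0 : 0 < (e.-2 + m)`!%:R :> rat by rewrite ltr0n fact_gt0.
have g0 : 0 < m`!%:R :> rat by rewrite ltr0n fact_gt0.
have {}e4 : 4 <= e%:R :> rat by rewrite ler_nat.
have m2' : m%:R = 2 :> rat \/ 3 <= m%:R :> rat.
  by case: (leqP 3 m) => h; [right; rewrite ler_nat | left; congr (_%:R); lia].
have {}m2 : 2 <= m%:R :> rat by rewrite ler_nat.
move: ((e.-2 + m)`!%:R : rat) (m`!%:R : rat) (e%:R : rat) (m%:R : rat) f0 g0 m2' hd hm m2 e4 =>
  {m0 e2}F f {}e {}m F0 f0 hm' hd hm m2 e4.
rewrite -subr_gt0.
have q0 : 0 < m * (e - 1) + 2 by nra.
rewrite (_ : _ - _ = F / f * (e + m) * (e + m - 1) / ((m + 1) * (m * (e - 1) + 2) * (e - 1) * (e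
  + 1))
   * (m * (e - 1) * (e + 1) - x * e * (m + 1) * (m * (e - 1) + 2))).
  rewrite pmulr_rgt0; last first.
    by rewrite !(mulr_gt0, divr_gt0, invr_gt0) //; lra.
  have xe : 0 <= x * e by rewrite mulr_ge0 //; lra.
  (* For m = 2 the bound x <= 1 / (d + 1) is used, for m >= 3 the bound x <= 1 / (m + 1). *)
  rewrite subr_gt0; case: hm' => [->|m3].
    have e20 : 0 < e + 2 by lra.
    rewrite -(ltr_pM2r e20); apply: (@le_lt_trans _ _ (6 * e * e)); last by nra.
    rewrite (_ : _ * (e + 2) = 6 * e * e * (x * (e + 1 + 1))); last by ring.
    by rewrite ler_piMr // mulr_ge0 //; lra.
  apply: (@le_lt_trans _ _ (e * (m * (e - 1) + 2))); last by nra.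
  rewrite ler_pM2r //; rewrite -[leRHS]mul1r -mulrAC ler_wpM2r //; lra.
field; repeat (apply/andP; split); apply: lt0r_neq0; lra.
Qed.

(** * The binomial transform *)

Section BinomialTransform.
Variables (R : comNzRingType) (m : nat).
Implicit Types (x y : R) (f : nat -> R) (d : nat).

(** On the generating function of f j t^(m+j) / (m+j)! this is multiplication by exp(x t), whence
    the additivity in x. In the recursion, d - j is the size of a flat and 'C(m + d, m + j) counts
    the subsets of that size. *)
Definition btrans x f d : R :=
  \sum_(j < d.+1) x ^+ (d - j) * f j *+ 'C(m + d, m + j).

Lemma btransD x f g d :
  btrans x (fun j => f j + g j) d = btrans x f d + btrans x g d.
Proof. by rewrite -big_split; apply: eq_bigr => j _; rewrite mulrDr mulrnDl. Qed.

Lemma btrans0 f d : btrans 0 f d = f d.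
Proof.
rewrite /btrans big_ord_recr /= subnn binn mul1r big1 ?add0r // => j _.
by rewrite expr0n subn_eq0 leqNgt ltn_ord mul0r mul0rn.
Qed.

Lemma btransM x y f d : btrans x (btrans y f) d = btrans (x + y) f d.
Proof.
rewrite /btrans.
transitivity (\sum_(j < d.+1) \sum_(k < d.+1 | (k <= j)%N)
    x ^+ (d - j) * (y ^+ (j - k) * f k) *+ ('C(m + d, m + k) * 'C(d - k, j - k))).
  apply: eq_bigr => j _; rewrite mulr_sumr -sumrMnl.
  rewrite (big_ord_widen d.+1 (fun k => x ^+ (d - j) *
    (y ^+ (j - k) * f k *+ 'C(m + j, m + k)) *+ 'C(m + d, m + j))) //.
  apply: eq_bigr => k kj; rewrite mulrnAr -mulrnA mulnC.
  have {}kj : (m + k <= m + j)%N by rewrite leq_add2l -ltnS.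
  rewrite (trinomial (m + d) kj); congr (_ *+ _).
  by congr (_ * 'C(_, _))%N; rewrite subnDl.
rewrite (exchange_big_dep predT) //=; apply: eq_bigr => k _.
rewrite exprDn mulr_suml -sumrMnl.
have kd : (k <= d)%N by rewrite -ltnS.
rewrite (eq_bigl (fun j : 'I_d.+1 => (k <= j)%N)) // -(big_geq_mkord _ _ predT
  (fun j => x ^+ (d - j) * (y ^+ (j - k) * f k) *+ ('C(m + d, m + k) * 'C(d - k, j - k)))).
rewrite -{1}[k : nat]add0n big_addn big_mkord subSn //.
apply: eq_bigr => j _; rewrite addnK mulnC mulrnA mulrnAl mulrA.
by congr (_ ^+ _ * _ * _ *+ _ *+ _); lia.
Qed.
End BinomialTransform.

Section LowCoefficients.
Variables (m : nat) (chi : nat -> {poly int}).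

(* As btrans m x is additive in x, chi = btrans m 'X Y for Y = btrans m (- 'X) chi,
   so btrans m ('X - 1) (btrans m 1 f) + chi = btrans m 'X (f + Y); its low half
   vanishes when f cancels the low half of Y. *)
Definition low_seq (d : nat) : {poly int} :=
  \poly_(i < uphalf d) - (btrans m (- 'X) chi d)`_i.

Definition low_sol : nat -> {poly int} := btrans m 1 low_seq.

Lemma low_sol_eq d i : (i.*2 < d)%N ->
  (btrans m ('X - 1) low_sol d + chi d)`_i = 0.
Proof.
move=> id; pose Y := btrans m (- 'X) chi.
have -> : chi d = btrans m 'X Y d by rewrite btransM subrr btrans0.
rewrite btransM subrK -btransD /btrans coef_sum big1 // => j _.
have jd : (j <= d)%N by rewrite -ltnS.
rewrite coefMn coefXnM; case: ltnP => h; first by rewrite mul0rn.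
(* From 2i < d and d - j <= i follows 2(i - (d - j)) < j: multiplication by 'X^(d - j) brings only
   low coefficients of the j-th term to index i. *)
rewrite coefD coef_poly ifT ?addNr ?mul0rn //.
by move: id jd h; lia.
Qed.

Lemma coef_low_sol d i : (low_sol d)`_i =
  \sum_(i.*2.+1 <= D < d.+1) - (btrans m (- 'X) chi D)`_i *+ 'C(m + d, m + D).
Proof.
rewrite big_geq_mkord /low_sol /btrans coef_sum [RHS]big_mkcond /=.
apply: eq_bigr => D _; rewrite expr1n mul1r coefMn coef_poly -double_ltP.
by case: ifP => _; rewrite ?mul0rn.
Qed.

Lemma coef_low_sol0 d i : (d <= i.*2)%N -> (low_sol d)`_i = 0.
Proof. by move=> di; rewrite coef_low_sol big_geq. Qed.
End LowCoefficients.

(** * Flats of sparse paving matroids *)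

Section Structure.
Variable T : finType.
Implicit Types (M : matroid T) (A B F G H : {set T}).

(** The consequence of sparse paving used from here on. It mentions only ranks and passes directly
    to contractions by independent sets, with no need to track duals of minors. *)
Definition sparse_rank M : Prop :=
  (forall A, A \subset ground M -> (#|A| < rk M)%N -> rkf M A = #|A|) /\
  (forall A, A \subset ground M -> (rk M < #|A|)%N -> rkf M A = rk M).

Lemma paving_indep M A : paving M -> A \subset ground M -> (#|A| < rk M)%N ->
  rkf M A = #|A|.
Proof.
move=> /forallP pM sA ltA; apply/eqP; rewrite eqn_leq rkf_card leqNgt.
apply/negP => dA; have dep : dependent M A by rewrite /dependent sA dA.
have [C /= minC sC] := minset_exists dep.
have /implyP/(_ minC) := pM C; rewrite leqNgt.
by rewrite (leq_ltn_trans (subset_leq_card sC) ltA).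
Qed.

(** A set with more than rk M elements has a complement smaller than the rank of the dual; that
    complement is independent there, so the set spans M. *)
Lemma sparse_paving_rank M : sparse_paving M -> sparse_rank M.
Proof.
case/andP=> pM pD; split=> [A sA|B sB ltB]; first exact: paving_indep.
have rkD : rk (dual M) = (#|ground M| - rk M)%N.
  by rewrite /rk /= ffunE setIid setDv rkf0 addn0.
have sA : ground M :\: B \subset ground (dual M) by exact: subsetDl.
have cA : #|ground M :\: B| = (#|ground M| - #|B|)%N by rewrite cardsD (setIidPr sB).
have leB := subset_leq_card sB.
have := paving_indep pD sA; rewrite rkD cA => /(_ (ltn_sub2l (leq_trans ltB leB) ltB)).
rewrite /= ffunE (setIidPl (subsetDl _ _)) setDDr setDv set0U (setIidPr sB) cA.
have [eB|neB] := eqVneq B (ground M); first by rewrite eB.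
have ltBE : (#|B| < #|ground M|)%N by rewrite proper_card // properEneq neB.
by have := rkf_le_rk M B; lia.
Qed.

Definition nonbases M : {set {set T}} :=
  [set H : {set T} | [&& H \subset ground M, #|H| == rk M & (rkf M H < rk M)%N]].

Lemma nonbasesP M H :
  reflect [/\ H \subset ground M, #|H| = rk M & (rkf M H < rk M)%N] (H \in nonbases M).
Proof.
by rewrite inE; apply: (iffP and3P) => -[sH /eqP cH rH]; split=> //; apply/eqP.
Qed.

Section SparseRank.
Variable M : matroid T.
Hypothesis spM : sparse_rank M.

Lemma nonbase_rkf H : H \in nonbases M -> (rkf M H).+1 = rk M.
Proof.
case/nonbasesP => sH cH rH; have rk0 : (0 < rk M)%N by exact: leq_ltn_trans rH.
have [x xH] : exists x, x \in H by apply/set0Pn; rewrite -card_gt0 cH.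
have := rkf_mono M (subsetDl H [set x]).
have cx := cardsD1 x H; rewrite xH cH add1n in cx.
rewrite (proj1 spM); first by lia.
  exact: subset_trans (subsetDl _ _) sH.
by rewrite cx.
Qed.

Lemma nonbase_subset H A : H \in nonbases M -> A \subset H -> (#|A| < rk M)%N ->
  rkf M A = #|A|.
Proof.
by case/nonbasesP => sH _ _ sA; apply: (proj1 spM); apply: subset_trans sH.
Qed.

Lemma circuit_rkf C : circuit M C -> (rkf M C).+1 = #|C|.
Proof.
move=> cC; have /andP[sC dC] := minsetp cC.
have [x xC] : exists x, x \in C.
  by apply/set0Pn; rewrite -card_gt0; apply: leq_ltn_trans dC.
have cx := cardsD1 x C; rewrite xC add1n in cx.
suff : (#|C :\ x| <= rkf M (C :\ x))%N.
  by have := rkf_mono M (subsetDl C [set x]); lia.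
rewrite leqNgt; apply/negP => dx.
have dep : dependent M (C :\ x).
  by rewrite /dependent dx (subset_trans (subsetDl _ _) sC).
have := minsetinf cC dep (subsetDl _ _) => /setP/(_ x).
by rewrite !inE eqxx xC.
Qed.

Lemma nonbase_flat H : H \in nonbases M -> H \in flats M.
Proof.
move=> nH; have rH := nonbase_rkf nH; case/nonbasesP: (nH) => sH cH ltH.
rewrite inE eqEsubset cl_ext // andbT; apply/subsetP => x.
rewrite inE => /andP[xE /eqP rx]; apply: contraT => xH.
have := proj2 spM (x |: H); rewrite subUset sub1set xE sH cardsU1 xH add1n cH.
by move=> /(_ isT (leqnn _)); lia.
Qed.

Lemma circuit_hyperplanesE : circuit_hyperplanes M = nonbases M.
Proof.
apply/setP => H; rewrite inE; apply/andP/idP => [[cH /andP[fH /eqP rH]]|nH].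
  have cE := circuit_rkf cH; apply/nonbasesP; split; first exact: flat_sub.
    by rewrite -cE.
  by rewrite -rH.
have rH := nonbase_rkf nH; case/nonbasesP: (nH) => sH cH ltH; split; last first.
  by rewrite /hyperplane nonbase_flat // rH eqxx.
apply/minsetP; split; first by rewrite /dependent sH cH.
move=> B /andP[sB dB] sBH; apply/eqP; rewrite eqEcard sBH cH leqNgt; apply/negP => ltB.
by move: dB; rewrite (proj1 spM) ?ltnn.
Qed.

(** The union has more than d elements and so has rank d, while both sets have rank d - 1.
    Submodularity gives the intersection rank at most d - 2, and being small it is independent. *)
Lemma nonbases_inter H H' : H \in nonbases M -> H' \in nonbases M -> H != H' ->
  (#|H :&: H'| < (rk M).-1)%N.
Proof.
move=> nH nH' neq; have r1 := nonbase_rkf nH; have r2 := nonbase_rkf nH'.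
case/nonbasesP: (nH) => sH cH ltH; case/nonbasesP: (nH') => sH' cH' ltH'.
have cU : (rk M < #|H :|: H'|)%N.
  rewrite -{1}cH; apply: proper_card; rewrite properEneq subsetUl andbT.
  apply: contraNneq neq => e; have s : H' \subset H by rewrite e subsetUr.
  by rewrite eq_sym eqEcard s cH cH' leqnn.
have := rkf_submod M H H'.
rewrite (proj2 spM _ _ cU) ?subUset ?sH ?sH' //.
have cI : (#|H :&: H'| < rk M)%N.
  rewrite -cH; apply: proper_card; rewrite properEneq subsetIl andbT.
  apply: contraNneq neq => /setIidPl s; rewrite eqEcard s cH cH' leqnn //.
rewrite (nonbase_subset nH (subsetIl _ _) cI); lia.
Qed.
End SparseRank.
End Structure.

(** * Counting circuit-hyperplanes *)

Section Counting.
Variables (T : finType) (M : matroid T).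
Implicit Types (A B F G H : {set T}).
Hypothesis spM : sparse_rank M.

Let d := rk M.
Let n := #|ground M|.

Lemma card_dep_pairs (S : {set {set T}}) (X : {set T} -> {set T}) k :
  (forall H, H \in S -> #|X H| = k) ->
  #|[set p : {set T} * T | (p.1 \in S) && (p.2 \in X p.1)]| = (#|S| * k)%N.
Proof.
move=> hX; rewrite -sum1_card (eq_bigl (fun p : {set T} * T => (p.1 \in S) && (p.2 \in X p.1))).
  rewrite -(pair_big_dep (fun H => H \in S) (fun H x => x \in X H) (fun _ _ => 1%N)) /=.
  by rewrite -sum_nat_const; apply: eq_bigr => H HS; rewrite sum1_card hX.
by move=> p; rewrite inE.
Qed.

Lemma nonbases_eq H H' : H \in nonbases M -> H' \in nonbases M ->
  (d.-1 <= #|H :&: H'|)%N -> H = H'.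
Proof.
move=> nH nH' h; apply/eqP; apply: contraT => ne.
by have := nonbases_inter spM nH nH' ne; rewrite ltnNge h.
Qed.

(** Deleting x from H sends the pairs with x in H injectively to (d - 1)-subsets, because two
    circuit-hyperplanes sharing d - 1 elements coincide. *)
Lemma nonbases_bound_lower : (#|nonbases M| * d <= 'C(n, d.-1))%N.
Proof.
rewrite -(@card_dep_pairs _ id d); last by move=> H /nonbasesP[].
rewrite -[X in (_ <= X)%N](cards_draws (ground M)).
set D := [set p | _].
have inj : {in D &, injective (fun p : {set T} * T => p.1 :\ p.2)}.
  case=> [H x] [H' x']; rewrite ![_ \in D]inE /= => /andP[nH xH] /andP[nH' xH'] e.
  case/nonbasesP: (nH) => sH cH _; case/nonbasesP: (nH') => sH' cH' _.
  have eH : H = H'.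
    apply: nonbases_eq => //; have := cardsD1 x H; rewrite xH cH => c.
    have : H :\ x \subset H :&: H' by rewrite subsetI subsetDl e subsetDl.
    by move/subset_leq_card; rewrite /d; lia.
  rewrite -eH in e xH' *; congr (_, _); apply/eqP; move/setP/(_ x): e.
  by rewrite !inE eqxx xH /= andbT => /esym/negbFE.
rewrite -(card_in_imset inj); apply: subset_leq_card; apply/subsetP => A.
case/imsetP => -[H x]; rewrite [_ \in D]inE /= => /andP[/nonbasesP[sH cH _] xH] ->; rewrite inE.
rewrite (subset_trans (subsetDl _ _) sH) /=.
by have := cardsD1 x H; rewrite xH cH /d => ->.
Qed.

(** The dual count adds an element outside H. Two circuit-hyperplanes inside one (d + 1)-set share
    at least d - 1 elements. *)
Lemma nonbases_bound_upper : (#|nonbases M| * (n - d) <= 'C(n, d.+1))%N.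
Proof.
rewrite -(@card_dep_pairs _ (fun H => ground M :\: H) (n - d)); last first.
  by move=> H /nonbasesP[sH cH _]; rewrite cardsD (setIidPr sH) cH.
rewrite -[X in (_ <= X)%N](cards_draws (ground M)).
set D := [set p | _].
have inj : {in D &, injective (fun p : {set T} * T => p.2 |: p.1)}.
  case=> [H x] [H' x']; rewrite ![_ \in D]inE /= !in_setD => /and3P[nH xH xE] /and3P[nH' xH' xE'] e.
  case/nonbasesP: (nH) => sH cH _; case/nonbasesP: (nH') => sH' cH' _.
  have eH : H = H'.
    apply: nonbases_eq => //; have := cardsUI H H'; rewrite cH cH'.
    have : H :|: H' \subset x |: H by rewrite subUset subsetUr e subsetUr.
    by move/subset_leq_card; rewrite cardsU1 xH cH /d; lia.
  rewrite -eH in e xH' *; congr (_, _); apply/eqP; move/setP/(_ x): e.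
  by rewrite !inE eqxx (negbTE xH) !orbF => /esym.
rewrite -(card_in_imset inj); apply: subset_leq_card; apply/subsetP => A.
case/imsetP => -[H x]; rewrite [_ \in D]inE /= in_setD => /and3P[/nonbasesP[sH cH _] xH xE] ->;
  rewrite inE.
by rewrite subUset sub1set xE sH cardsU1 xH cH /=.
Qed.

Lemma nonbases_le_m m : (0 < d)%N -> n = (m + d)%N ->
  (#|nonbases M| * m.+1 <= 'C(m + d, d))%N.
Proof.
move=> d0 nE; have := nonbases_bound_lower; rewrite nE.
have := mul_bin_left (m + d) d.-1; rewrite prednK //.
have -> : (m + d - d.-1 = m.+1)%N by lia.
move=> e h; rewrite -(leq_pmul2l d0) e mulnA mulnC leq_pmul2l //.
by rewrite mulnC.
Qed.

Lemma nonbases_le_d m : (0 < m)%N -> n = (m + d)%N ->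
  (#|nonbases M| * d.+1 <= 'C(m + d, d))%N.
Proof.
move=> m0 nE; have := nonbases_bound_upper; rewrite nE addnK => h.
have := mul_bin_left (m + d) d; rewrite addnK => e.
by rewrite -(leq_pmul2l m0) -e mulnA mulnC leq_pmul2l // mulnC.
Qed.

Lemma sum_subsets (V : nmodType) A (f : nat -> V) :
  \sum_(B : {set T} | B \subset A) f #|B| =
  \sum_(k < #|A|.+1) f k *+ 'C(#|A|, k).
Proof.
rewrite (partition_big (fun B : {set T} => inord #|B| : 'I_#|A|.+1) predT) //=.
apply: eq_bigr => k _; rewrite -(cards_draws A) -sumr_const.
apply: eq_big => [B|B /andP[sB /eqP <-]].
  rewrite inE; case sB: (B \subset A) => //=.
  by rewrite -val_eqE /= inordK // ltnS subset_leq_card.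
by rewrite inordK // ltnS subset_leq_card.
Qed.

Definition nonbases_above F : nat := #|[set H in nonbases M | F \subset H]|.

(** Double counting of the pairs F inside H. The subsets of a d-element H give the weights 'C(d, k),
    which is the source of the parameter m = 0 in [relax_poly]. *)
Lemma sum_nonbases_above (V : nmodType) (f : nat -> V) :
  \sum_(F : {set T} | F \subset ground M) f #|F| *+ nonbases_above F
  = (\sum_(k < d.+1) f k *+ 'C(d, k)) *+ #|nonbases M|.
Proof.
transitivity (\sum_(F : {set T} | F \subset ground M)
  \sum_(H in nonbases M | F \subset H) f #|F|).
  by apply: eq_bigr => F _; rewrite -sumr_const; apply: eq_bigl => H; rewrite inE.
rewrite (exchange_big_dep (fun H => H \in nonbases M)) /=; last by move=> F H _ /andP[].
rewrite -sumr_const; apply: eq_bigr => H nH; have [sH cH _] := nonbasesP _ _ nH.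
rewrite /d -cH -sum_subsets; apply: eq_bigl => F.
by rewrite nH andbC; case sF: (F \subset H); rewrite ?(subset_trans sF sH).
Qed.
End Counting.

Section Flats.
Variables (T : finType) (M : matroid T).
Implicit Types (A B F G H : {set T}).
Hypotheses (spM : sparse_rank M).

Let d := rk M.

Lemma small_rkf F : F \subset ground M -> (#|F| < d)%N -> rkf M F = #|F|.
Proof. exact: (proj1 spM). Qed.

(** An element of the closure of F outside F gives a dependent set one element larger. Its size must
    then be d, so it is a circuit-hyperplane above F. *)
Lemma small_flat F : F \subset ground M -> (#|F| < d)%N ->
  (F \in flats M) = ~~ ((#|F|.+1 == d) && (0 < nonbases_above M F)%N).
Proof.
move=> sF cF; rewrite inE eqEsubset cl_ext // andbT; apply/idP/idP.
  move=> clF; apply/negP => /andP[/eqP cF1]; rewrite card_gt0 => /set0Pn[H].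
  rewrite inE => /andP[nH sFH]; case/nonbasesP: (nH) => sH cH ltH.
  have [x xH xF] : exists2 x, x \in H & x \notin F.
    apply/subsetPn; apply/negP => sHF; have := subset_leq_card sHF.
    by rewrite cH leqNgt cF.
  have eH : x |: F = H.
    by apply/eqP; rewrite eqEcard subUset sub1set xH sFH cardsU1 xF cH add1n cF1 /=.
  have : x \in cl M F.
    rewrite inE (subsetP sH) // eH (small_rkf sF cF); apply/eqP.
    by apply: succn_inj; rewrite (nonbase_rkf spM nH).
  by move/(subsetP clF); rewrite (negbTE xF).
apply: contraR => /subsetPn[x]; rewrite inE => /andP[xE /eqP rx] xF.
have sxF : x |: F \subset ground M by rewrite subUset sub1set xE.
have cxF : #|x |: F| = #|F|.+1 by rewrite cardsU1 xF.
have cF1 : #|F|.+1 = d.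
  apply/eqP; rewrite eqn_leq cF leqNgt; apply/negP => lt.
  by have := small_rkf sxF; rewrite cxF rx small_rkf // => /(_ lt); lia.
rewrite cF1 eqxx card_gt0; apply/set0Pn; exists (x |: F).
by rewrite inE subsetUr andbT; apply/nonbasesP; rewrite cxF cF1 rx small_rkf.
Qed.

Lemma nonbases_above_le1 F : F \subset ground M -> #|F|.+1 = d ->
  (nonbases_above M F <= 1)%N.
Proof.
move=> sF cF; apply/card_le1_eqP => H H'; rewrite ![_ \in [set _ in _ | _]]inE.
move=> /andP[nH sFH] /andP[nH' sFH']; apply: (nonbases_eq spM nH' nH); rewrite setIC.
have := subset_leq_card (_ : F \subset H :&: H'); rewrite subsetI sFH sFH' => /(_ isT).
by move: cF; rewrite /d; lia.
Qed.

Lemma flat_cases F : (0 < d)%N ->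
  (F \in flats M) = [|| (F \subset ground M) && (#|F| < d)%N && (F \in flats M),
                        F \in nonbases M | F == ground M].
Proof.
move=> d0; apply/idP/idP => [fF|]; last first.
  by case/or3P => [/andP[]//|/(nonbase_flat spM)//|/eqP->]; exact: ground_flat.
have sF := flat_sub fF; rewrite fF sF /= andbT.
have [//|cF] := ltnP; have [->|neF] := eqVneq F (ground M); first by rewrite orbT.
have pF : F \proper ground M by rewrite properEneq neF.
have rF := flat_lt_rkf fF pF (subxx _).
rewrite orbF /=; apply/nonbasesP; split=> //; apply/eqP; rewrite eqn_leq cF andbT.
by rewrite leqNgt; apply/negP => /(proj2 spM _ sF) e; move: rF; rewrite e ltnn.
Qed.

Lemma sum_flats (V : nmodType) (f : {set T} -> V) : (0 < d)%N ->
  \sum_(F in flats M) f F =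
  \sum_(F : {set T} | (F \subset ground M) && (#|F| < d)%N && (F \in flats M)) f F
  + \sum_(F in nonbases M) f F + f (ground M).
Proof.
move=> d0; rewrite (bigD1 (ground M)) ?ground_flat //= addrC; congr (_ + _).
have gE : (d <= #|ground M|)%N by exact: rkf_card.
rewrite (bigID (fun F : {set T} => #|F| < d)%N) /=; congr (_ + _).
  apply: eq_bigl => F; case fF: (F \in flats M); rewrite ?andbF //= flat_sub // andbT.
  case cF: (#|F| < d)%N; rewrite ?andbF // andbT.
  by apply: contraTneq cF => ->; rewrite -leqNgt.
apply: eq_bigl => F; rewrite flat_cases //; case nF: (F \in nonbases M); rewrite /= ?orbT.
  case/nonbasesP: nF => sF cF ltF; rewrite cF ltnn andbT.
  by apply: contraTneq ltF => ->; rewrite -leqNgt.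
by case: eqP => _; case: (#|F| < d)%N; rewrite ?andbF.
Qed.
End Flats.

(** * Characteristic polynomials *)

Definition circuit_mobius (d : nat) : int :=
  - \sum_(k < d.-1) (-1) ^+ k *+ 'C(d, k).

Definition circuit_charpoly (d : nat) : {poly int} :=
  \sum_(k < d.-1) (-1) ^+ k * 'X^(d.-1 - k) *+ 'C(d, k) + (circuit_mobius d)%:P.

(** All Moebius values from the bottom sum to zero; this eliminates the value at the ground set and
    accounts for the summand -1. *)
Definition uniform_charpoly (m d : nat) : {poly int} :=
  \sum_(k < d) (-1) ^+ k * ('X^(d - k) - 1) *+ 'C(m + d, k).

Section CharPolys.
Variables (T : finType) (M : matroid T).
Implicit Types (A B F G H : {set T}).
Hypotheses (spM : sparse_rank M) (hl : loopless M).

Let d := rk M.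
Let L := flats M.

Lemma sub_small_flat F A : F \in L -> (#|F| < d)%N -> A \subset F -> A \in L.
Proof.
move=> fF cF sA; have sF := flat_sub fF; have sAE := subset_trans sA sF.
have [->//|neA] := eqVneq A F.
have ltA : (#|A| < #|F|)%N by rewrite proper_card // properEneq neA.
rewrite (small_flat spM) //; last exact: ltn_trans cF.
by rewrite (negbTE (_ : _ != _)) // neq_ltn (leq_ltn_trans ltA cF).
Qed.

Lemma sum_sign_subsets A : A != set0 ->
  \sum_(B : {set T} | B \subset A) (-1) ^+ #|B| = 0 :> int.
Proof.
move=> A0; rewrite (sum_subsets A (fun k => (-1) ^+ k)).
have := exprDn (1 : int) (-1) #|A|.
rewrite subrr expr0n cards_eq0 (negbTE A0) => h; apply: etrans (esym h).
by apply: eq_bigr => k _; rewrite expr1n mul1r.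
Qed.

Lemma mobius_small F : F \in L -> (#|F| < d)%N -> mobius L set0 F = (-1) ^+ #|F|.
Proof.
have [n] := ubnP #|F|; elim: n F => // n IH F ltn fF cF.
rewrite mobiusE eq_sym; have [->|F0] := eqVneq F set0; first by rewrite cards0.
have := sum_sign_subsets F0; rewrite (bigD1 F) //= => /eqP; rewrite addr_eq0 => /eqP ->.
congr (- _); apply: eq_big => [C|C /and3P[fC _ pC]].
  case sC: (C \subset F); rewrite sub0set properEneq sC ?andbF //=.
  by rewrite (sub_small_flat fF cF sC) andbT.
by apply: IH => //; have := proper_card pC; lia.
Qed.

Lemma nonbase_subflat H (C : {set T}) : H \in nonbases M -> C \subset H ->
  (C \in L) && (C != H) = (#|C| < d.-1)%N.
Proof.
move=> nH sC; have [sH cH ltH] := nonbasesP _ _ nH.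
have sCE := subset_trans sC sH; have d0 : (0 < d)%N by exact: leq_ltn_trans ltH.
have [->|neC] := eqVneq C H; first by rewrite andbF cH /d; lia.
have ltC : (#|C| < d)%N by rewrite /d -cH proper_card // properEneq neC.
have nb : (0 < nonbases_above M C)%N.
  by rewrite card_gt0; apply/set0Pn; exists H; rewrite inE nH.
by rewrite andbT (small_flat spM) // nb andbT -/d; lia.
Qed.

Lemma sum_lt_subsets (V : nmodType) H r (f : nat -> V) : (r <= #|H|)%N ->
  \sum_(C : {set T} | (C \subset H) && (#|C| < r)%N) f #|C| =
  \sum_(k < r) f k *+ 'C(#|H|, k).
Proof.
move=> rH; rewrite big_mkcondr /= (sum_subsets H (fun k => if (k < r)%N then f k else 0)).
rewrite (big_ord_widen #|H|.+1 (fun k => f k *+ 'C(#|H|, k))) ?leqW // [RHS]big_mkcond /=.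
by apply: eq_bigr => k _; case: ifP => _ //; rewrite mul0rn.
Qed.

Lemma mobius_nonbase H : H \in nonbases M -> mobius L set0 H = circuit_mobius d.
Proof.
move=> nH; have [sH cH ltH] := nonbasesP _ _ nH.
have d0 : (0 < d)%N by exact: leq_ltn_trans ltH.
rewrite mobiusE eq_sym -cards_eq0 cH eqn0Ngt d0 /=; congr (- _).
have rH : (d.-1 <= #|H|)%N by rewrite cH leq_pred.
have := sum_lt_subsets (fun k => (-1) ^+ k : int) rH; rewrite cH => <-.
apply: eq_big => [C|C /and3P[fC _ pC]].
  case sC: (C \subset H); rewrite sub0set properEneq sC ?andbF //=.
  by rewrite andbT nonbase_subflat.
apply: mobius_small => //; rewrite /d -cH; exact: proper_card.
Qed.

Lemma charpoly_small F : F \in L -> (#|F| < d)%N ->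
  char_poly_matroid (restr M F) = ('X - 1) ^+ #|F|.
Proof.
move=> fF cF; rewrite char_poly_restr //.
transitivity (\sum_(H : {set T} | H \subset F) (-1) ^+ #|H| * 'X^(#|F| - #|H|) : {poly int}).
  apply: eq_big => [H|H /andP[fH sH]].
    by case sH: (H \subset F); rewrite ?andbF // (sub_small_flat fF cF sH).
  have cH : (#|H| < d)%N by apply: leq_ltn_trans cF; exact: subset_leq_card.
  rewrite mobius_small // !(small_rkf spM) ?flat_sub //.
  by rewrite rmorphXn rmorphN1.
rewrite (sum_subsets F (fun k => (-1) ^+ k * 'X^(#|F| - k))) exprDn.
by apply: eq_bigr => k _; rewrite mulrC.
Qed.

Lemma charpoly_nonbase H : H \in nonbases M ->
  char_poly_matroid (restr M H) = circuit_charpoly d.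
Proof.
move=> nH; have [sH cH ltH] := nonbasesP _ _ nH; have fH := nonbase_flat spM nH.
have d0 : (0 < d)%N by exact: leq_ltn_trans ltH.
have rkH : rkf M H = d.-1 by rewrite /d -(nonbase_rkf spM nH).
rewrite char_poly_restr // (bigD1 H) /=; last by rewrite fH subxx.
rewrite mobius_nonbase // subnn mulr1 addrC /circuit_charpoly; congr (_ + _).
have rH : (d.-1 <= #|H|)%N by rewrite cH leq_pred.
have := sum_lt_subsets (fun k => (-1) ^+ k * 'X^(d.-1 - k) : {poly int}) rH.
rewrite cH => <-.
have dE k : (k < d.-1)%N -> (k < d)%N by move/leq_trans; apply; exact: leq_pred.
apply: eq_big => [C|C /andP[/andP[fC sC] neC]].
  by case sC: (C \subset H); rewrite ?andbF //= andbT nonbase_subflat.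
have := nonbase_subflat nH sC; rewrite fC neC => /esym/dE cC.
rewrite mobius_small // rkH (small_rkf spM) ?flat_sub //.
by rewrite rmorphXn rmorphN1.
Qed.

(** Compared with the uniform matroid, each circuit-hyperplane destroys d flats of size d - 1, each
    contributing (-1)^(d-1) ('X - 1), and adds itself as a flat of corank 1 with Moebius value
    [circuit_mobius d]. *)
Lemma charpoly_ground m : (0 < d)%N -> #|ground M| = (m + d)%N ->
  char_poly_matroid (restr M (ground M)) = uniform_charpoly m d -
  (('X - 1) * ((-1) ^+ d.-1 *+ d - (circuit_mobius d)%:P)) *+ #|nonbases M|.
Proof.
move=> d0 cE; have fE := ground_flat M.
rewrite char_poly_restr //.
transitivity (\sum_(H in L) (mobius L set0 H)%:P * ('X^(d - rkf M H) - 1)).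
  have : \sum_(C in L | (set0 \subset C) && (C \subset ground M)) mobius L set0 C = 0.
    rewrite sum_mobius_l ?sub0set //; case: eqP => // e.
    by move: d0; rewrite /d /rk -e rkf0.
  move=> s0; under [RHS]eq_bigr => H _ do rewrite mulrBr mulr1.
  rewrite sumrB -rmorph_sum /= [X in _ - X%:P](_ : _ = 0) ?subr0.
    by apply: eq_bigl => H; case fH: (H \in L); rewrite //= flat_sub.
  rewrite -[RHS]s0; apply: eq_bigl => H.
  by case fH: (H \in L); rewrite //= sub0set flat_sub.
rewrite sum_flats // subnn expr0 subrr mulr0 addr0.
rewrite [X in _ + X](_ : _ = ((circuit_mobius d)%:P * ('X - 1)) *+ #|nonbases M|); last first.
  rewrite -sumr_const; apply: eq_bigr => H nH.
  rewrite mobius_nonbase // (_ : d - rkf M H = 1)%N ?expr1 //.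
  by have := nonbase_rkf spM nH; rewrite /d; lia.
pose f k : {poly int} := if (k < d)%N then (-1) ^+ k * ('X^(d - k) - 1) else 0.
pose g k : {poly int} := if k.+1 == d then (-1) ^+ k * ('X - 1) else 0.
transitivity (\sum_(F : {set T} | F \subset ground M) (f #|F| - g #|F| *+ nonbases_above M F)
   + (circuit_mobius d)%:P * ('X - 1) *+ #|nonbases M|).
  congr (_ + _).
  rewrite (eq_bigl (fun F : {set T} => (F \subset ground M) &&
    ((#|F| < d)%N && (F \in L)))); last by move=> F; rewrite andbA.
  rewrite big_mkcondr /=; apply: eq_bigr => F sF.
  rewrite /f /g; have [cF|cF] := ltnP #|F| d; last first.
    by rewrite ifN ?mul0rn ?subrr //= gtn_eqF.
  have rF := small_rkf spM sF cF; have fE' := small_flat spM sF cF; rewrite -/d in fE'.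
  have flatE : F \in L -> (mobius L set0 F)%:P * ('X^(d - rkf M F) - 1) =
      (-1) ^+ #|F| * ('X^(d - #|F|) - 1).
    by move=> fF; rewrite (mobius_small fF cF) rF rmorphXn rmorphN1.
  case fF: (F \in L).
    rewrite flatE //; move: fE'; rewrite -/L fF; case: eqP => [_|_] /= h.
      by rewrite (_ : nonbases_above M F = 0%N) ?mulr0n ?subr0 //; lia.
    by rewrite mul0rn subr0.
  move: fE'; rewrite -/L fF => /esym/negbFE/andP[/eqP cF1 nF].
  have := nonbases_above_le1 spM sF cF1; rewrite -/d => le1.
  have -> : nonbases_above M F = 1%N by lia.
  by rewrite -cF1 eqxx subSnn expr1 mulr1n subrr.
rewrite sumrB (sum_subsets _ f) (sum_nonbases_above M g).
rewrite -addrA; congr (_ + _).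
  rewrite /uniform_charpoly cE (big_ord_widen (m + d).+1 (fun k => (-1) ^+ k * ('X^(d - k) - 1)
    *+ 'C(m + d, k))).
    rewrite [RHS]big_mkcond /=; apply: eq_bigr => k _; rewrite /f.
    by case: ifP => _; rewrite ?mul0rn.
  by rewrite ltnW // ltnS leq_addl.
rewrite -mulNrn -mulrnDl -[RHS]mulNrn; congr (_ *+ _).
have lt : (d.-1 < d.+1)%N by rewrite ltnS leq_pred.
rewrite (bigD1 (Ordinal lt)) //= big1 ?addr0; last first.
  move=> k ne; rewrite /g ifN ?mul0rn //; apply: contraNN ne => kd.
  by apply/eqP/val_inj/succn_inj; rewrite (eqP kd) /= prednK.
rewrite /g prednK // eqxx (_ : 'C(d, d.-1) = d); last first.
  by move: d0; case: (d) => // d' _; rewrite binSn.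
move: ((-1) ^+ d.-1) ('X - 1) (_%:P) => a b c.
by rewrite mulrBr mulrnAr opprB addrC ![b * _]mulrC.
Qed.
End CharPolys.

(** * The Kazhdan-Lusztig polynomial *)

Section Contraction.
Variables (T : finType) (M : matroid T) (F : {set T}).
Hypotheses (spM : sparse_rank M) (sF : F \subset ground M).

Lemma disjoint_of_contr (A : {set T}) : A \subset ground (contr M F) ->
  (A \subset ground M) /\ #|A :|: F| = (#|A| + #|F|)%N.
Proof.
rewrite subsetD => /andP[sA dA]; split=> //.
by rewrite cardsU (eqP (_ : A :&: F == set0)) ?setI_eq0 // cards0 subn0.
Qed.

Lemma sparse_rank_contr : rkf M F = #|F| -> sparse_rank (contr M F).
Proof.
move=> rF; split=> A /disjoint_of_contr[sA cA]; rewrite rk_contr // rF /= ffunE rF => ltA.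
  by rewrite (proj1 spM) ?subUset ?sA // cA ?addnK //; lia.
by rewrite (proj2 spM) ?subUset ?sA // cA; lia.
Qed.

Lemma nonbases_contr : rkf M F = #|F| -> (#|F| <= rk M)%N ->
  #|nonbases (contr M F)| = nonbases_above M F.
Proof.
move=> rF leF; rewrite /nonbases_above.
have inj : {in nonbases (contr M F) &, injective (fun A => A :|: F)}.
  move=> A B /nonbasesP[sA _ _] /nonbasesP[sB _ _] /(congr1 (fun X => X :\: F)).
  rewrite !setDUl setDv !setU0; move: sA sB; rewrite /= !subsetD => /andP[_ dA] /andP[_ dB].
  by rewrite (setDidPl dA) (setDidPl dB).
rewrite -(card_in_imset inj); apply: eq_card => H; apply/imsetP/idP.
  case=> A /nonbasesP[/disjoint_of_contr[sA cA] cA' rA] ->.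
  rewrite inE subsetUr andbT; move: cA' rA; rewrite rk_contr // rF /= ffunE rF => cA' rA.
  by apply/nonbasesP; split; [rewrite subUset sA | rewrite cA; lia | lia].
rewrite inE => /andP[/nonbasesP[sH cH rH] sFH]; exists (H :\: F); last first.
  by rewrite setUC setDUK.
have rFH := rkf_mono M sFH.
apply/nonbasesP; rewrite rk_contr // rF /= ffunE setUC setDUK // rF cardsD (setIidPr sFH) cH.
by split=> //; [exact: setSD | move: rFH; rewrite rF; lia].
Qed.

Lemma card_ground_contr : #|ground (contr M F)| = (#|ground M| - #|F|)%N.
Proof. by rewrite /= cardsD (setIidPr sF). Qed.
End Contraction.

Section NonbaseContraction.
Variables (T : finType) (P : matroid T -> {poly int}).
Hypothesis hP : is_KL P.
Implicit Types M : matroid T.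

Lemma coef_mul_top (p q : {poly int}) a b : (size p <= a.+1)%N -> (size q <= b)%N ->
  (p * q)`_(a + b) = 0.
Proof.
move=> sp sq; rewrite nth_default //; apply: leq_trans (size_polyMleq _ _) _; lia.
Qed.

(** Compare coefficients of degree rk M in the recursion. For a proper flat the degree bound keeps
    the product below that degree; the ground set contributes the leading coefficient 1 of the
    characteristic polynomial. *)
Lemma KL_coef0 M : loopless M -> (P M)`_0 = 1.
Proof.
move=> hl; have [k0 k1 k2] := hP hl.
have [r0|r0] := posnP (rk M); first by rewrite k0 // coef1.
have := congr1 (fun p : {poly int} => p`_(rk M)) k2.
rewrite /= coef_revp leqnn subnn => ->; rewrite coef_sum.
rewrite (bigD1 (ground M)) ?ground_flat //= [X in _ + X]big1 ?addr0; last first.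
  move=> F /andP[fF neF]; have sF := flat_sub fF.
  have ltF : (rkf M F < rk M)%N.
    by apply: (flat_lt_rkf fF); rewrite // properEneq neF.
  rewrite -(subnKC (ltnW ltF)) coef_mul_top ?size_char_poly_restr //.
  have [_ c1 _] := hP (loopless_contr fF).
  have := c1; rewrite rk_contr // subn_gt0 => /(_ ltF).
  by move: (size _) => s; lia.
have [kE _ _] := hP (loopless_contr (ground_flat M)).
rewrite kE ?mulr1; last by rewrite rk_contr // subnn.
rewrite char_poly_restr ?ground_flat // coef_sum (bigD1 set0) /=; last first.
  by rewrite set0_flat // sub0set.
rewrite mobiusE eqxx rkf0 subn0 coefCM coefXn eqxx mulr1 big1 ?addr0 // => F /andP[/andP[fF _] F0].
have := flat_rkf_gt0 hl fF F0; have := rkf_le_rk M F.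
rewrite coefCM coefXn => h1 h2; case: eqP; rewrite ?mulr0 // -/(rk M); lia.
Qed.

Lemma KL_rank1 M : loopless M -> rk M = 1%N -> P M = 1.
Proof.
move=> hl r1; have [_ k1 _] := hP hl; apply/polyP => -[|i]; first by rewrite KL_coef0 // coef1.
by rewrite coef1 nth_default //; move: k1; rewrite r1 => /(_ isT); move: (size _) => s; lia.
Qed.
End NonbaseContraction.

(* The terms that each circuit-hyperplane removes from the Kazhdan-Lusztig recursion of
   the uniform matroid. *)
Definition relax_charpoly (d : nat) : {poly int} :=
  ('X - 1) ^+ d.-1 *+ d - circuit_charpoly d +
  ('X - 1) * ((-1) ^+ d.-1 *+ d - (circuit_mobius d)%:P).

Definition uniform_poly (m : nat) : nat -> {poly int} := low_sol m (uniform_charpoly m).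
Definition relax_poly : nat -> {poly int} := low_sol 0 relax_charpoly.

Lemma low_sol_rec m chi d i : (i.*2 < d)%N ->
  (low_sol m chi d)`_i =
  - (\sum_(k < d | (0 < k)%N) ('X - 1) ^+ k * low_sol m chi (d - k)%N *+ 'C(m + d, k) + chi d)`_i.
Proof.
move=> id; have := low_sol_eq m chi id; rewrite /btrans.
rewrite (reindex_inj rev_ord_inj) /=.
under eq_bigr => k _.
  have kd : (k <= d)%N by rewrite -ltnS.
  rewrite subSS subKn // -[in X in _ *+ X]bin_sub; last by rewrite leq_add2l leq_subr.
  rewrite (_ : m + d - (m + (d - k)) = k)%N; last by lia.
  over.
have -> : \sum_(k < d.+1) ('X - 1) ^+ k * low_sol m chi (d - k) *+ 'C(m + d, k) =
  \sum_(k < d) ('X - 1) ^+ k * low_sol m chi (d - k) *+ 'C(m + d, k).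
  (* Truncation makes the value in rank 0 equal to 0 rather than 1: the contraction by the ground
     set is accounted for by [chi]. *)
  rewrite big_ord_recr /= subnn [low_sol m chi 0](_ : _ = 0) ?mulr0 ?mul0rn ?addr0 //.
  by apply/polyP => j; rewrite coef_low_sol0 // coef0.
case: d id => // d id.
rewrite (bigD1 ord0) //= expr0 mul1r subn0 bin0 mulr1n -addrA coefD => /eqP.
rewrite addr_eq0 => /eqP ->; congr (- (nth 0 (polyseq _) i)); congr (_ + _).
by apply: eq_bigl => k; rewrite lt0n.
Qed.

Lemma low_sol1 m chi : low_sol m chi 1 = (- (btrans m (- 'X) chi 1)`_0)%:P.
Proof.
apply/polyP => -[|i]; last by rewrite coefC coef_low_sol0 // doubleS.
by rewrite coefC coef_low_sol big_nat1 binn mulr1n.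
Qed.

Lemma btrans1_coef0 m (chi : nat -> {poly int}) : (btrans m (- 'X) chi 1)`_0 = (chi 1%N)`_0.
Proof.
rewrite /btrans big_ord_recl big_ord1 /= coefD coefMn expr1 mulNr coefN coefXM /=.
by rewrite oppr0 mul0rn add0r expr0 mul1r binn.
Qed.

Lemma uniform_poly1 m : uniform_poly m 1 = 1.
Proof.
rewrite /uniform_poly low_sol1 btrans1_coef0 /uniform_charpoly big_ord1 expr0 mul1r.
by rewrite bin0 mulr1n coefB coefX coef1 sub0r opprK.
Qed.

Lemma relax_poly1 : relax_poly 1 = 0.
Proof.
rewrite /relax_poly low_sol1 btrans1_coef0 /relax_charpoly /circuit_charpoly.
rewrite /circuit_mobius /= !big_ord0 oppr0 !addr0 !expr0 subr0 mulr1.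
by rewrite addrCA subrr addr0 coefX oppr0.
Qed.

Section KLFormula.
Variables (T : finType) (P : matroid T -> {poly int}).
Hypothesis hP : is_KL P.
Implicit Types M : matroid T.

Definition KL_formula M : Prop := forall m, #|ground M| = (m + rk M)%N ->
  P M = uniform_poly m (rk M) - relax_poly (rk M) *+ #|nonbases M|.

(** A set of size d - 1 inside a circuit-hyperplane is not a flat, so its whole uniform term, with
    rank 1 factor 1, has to be removed. [relax_poly 1] is 0 and would not record this. *)
Definition relax_term (d k : nat) : {poly int} :=
  ('X - 1) ^+ k * (if (d - k == 1)%N then 1 else relax_poly (d - k)).

Lemma nonbases_rank1 M : loopless M -> rk M = 1%N -> nonbases M = set0.
Proof.
move=> /looplessP hl r1; apply/setP => H; rewrite in_set0; apply/negP => /nonbasesP[sH].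
rewrite r1 => /eqP/cards1P[x Hx]; rewrite Hx in sH *.
by rewrite sub1set in sH; have := hl x sH; lia.
Qed.

Lemma KL_small_term M (F : {set T}) m : loopless M -> sparse_rank M -> #|ground M| = (m + rk M)%N ->
  (forall N : matroid T, loopless N -> sparse_rank N -> (0 < rk N < rk M)%N -> KL_formula N) ->
  F \subset ground M -> (0 < #|F| < rk M)%N ->
  (if F \in flats M then char_poly_matroid (restr M F) * P (contr M F) else 0) =
  ('X - 1) ^+ #|F| * uniform_poly m (rk M - #|F|) - relax_term (rk M) #|F| *+ nonbases_above M F.
Proof.
move=> hl spM cE IH sF /andP[F0 Fd]; rewrite /relax_term.
have rF := small_rkf spM sF Fd; have flatE := small_flat spM sF Fd.
case: ifP => fF; last first.
  move: flatE; rewrite fF => /esym/negbFE/andP[/eqP cF1 nF].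
  have := nonbases_above_le1 spM sF cF1 => le1.
  have -> : nonbases_above M F = 1%N by lia.
  by rewrite -cF1 subSnn eqxx uniform_poly1 mulr1n subrr.
rewrite charpoly_small // (IH (contr M F) _ _ _ m); first last.
- by rewrite card_ground_contr // rk_contr // rF cE; lia.
- by rewrite rk_contr // rF; lia.
- exact: sparse_rank_contr.
- exact: loopless_contr.
rewrite rk_contr // rF nonbases_contr ?(ltnW Fd) // mulrBr -mulrnAr; congr (_ - _ * _).
case: eqP => // e1; move: flatE; rewrite fF.
rewrite (_ : #|F|.+1 == rk M); last by apply/eqP; lia.
by rewrite /= lt0n negbK => /esym/eqP->; rewrite !mulr0n.
Qed.

Lemma sum_positive_sizes (V : nmodType) (f : nat -> V) n d : (d <= n.+1)%N ->
  \sum_(k < n.+1) (if (0 < k < d)%N then f k else 0) *+ 'C(n, k) =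
  \sum_(k < d | (0 < k)%N) f k *+ 'C(n, k).
Proof.
move=> dn; rewrite (big_ord_widen_cond n.+1 (fun k => 0 < k)%N (fun k => f k *+ 'C(n, k))) //.
rewrite [RHS]big_mkcond /=; apply: eq_bigr => k _.
by case: ifP => _; rewrite ?mul0rn.
Qed.

Lemma relax_term_sum d : (1 < d)%N ->
  \sum_(k < d | (0 < k)%N) relax_term d k *+ 'C(d, k) =
  \sum_(k < d | (0 < k)%N) ('X - 1) ^+ k * relax_poly (d - k) *+ 'C(d, k)
  + ('X - 1) ^+ d.-1 *+ d.
Proof.
case: d => [|[|d]] // _; rewrite [LHS]big_mkcond [in RHS]big_mkcond [LHS]big_ord_recr [X in _ =
  X + _]big_ord_recr /=.
rewrite /relax_term !subSnn eqxx relax_poly1 mulr0 mul0rn addr0 mulr1 binSn; congr (_ + _).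
apply: eq_bigr => k _; case: ifP => // _; rewrite ifN //.
by have := ltn_ord k; lia.
Qed.

Lemma KL_rest_sparse M m : loopless M -> sparse_rank M -> (0 < rk M)%N ->
  #|ground M| = (m + rk M)%N ->
  (forall N : matroid T, loopless N -> sparse_rank N -> (0 < rk N < rk M)%N -> KL_formula N) ->
  KL_rest P M =
  (\sum_(k < rk M | (0 < k)%N) ('X - 1) ^+ k * uniform_poly m (rk M - k) *+ 'C(m + rk M, k)
    + uniform_charpoly m (rk M)) -
  (\sum_(k < rk M | (0 < k)%N) ('X - 1) ^+ k * relax_poly (rk M - k) *+ 'C(0 + rk M, k)
    + relax_charpoly (rk M)) *+ #|nonbases M|.
Proof.
move=> hl spM d0 cE IH; rewrite /KL_rest big_mkcondr /= sum_flats //.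
have gE : ground M != set0 by apply: contraTneq d0; rewrite -leqNgt /rk => ->; rewrite rkf0.
rewrite gE.
have [kE _ _] := hP (loopless_contr (ground_flat M)).
rewrite kE ?mulr1; last by rewrite rk_contr // subnn.
rewrite (charpoly_ground spM hl d0 cE).
rewrite [X in _ + X + _](_ : _ = circuit_charpoly (rk M) *+ #|nonbases M|); last first.
  rewrite -sumr_const; apply: eq_bigr => H nH; have fH := nonbase_flat spM nH.
  have rH := nonbase_rkf spM nH; have [_ cH _] := nonbasesP _ _ nH.
  rewrite ifT; last by rewrite -card_gt0 cH.
  rewrite (charpoly_nonbase spM hl nH) (KL_rank1 hP) ?mulr1 ?loopless_contr //.
  by rewrite rk_contr ?flat_sub //; lia.
set d := rk M in d0 cE *; set NB := #|nonbases M|.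
pose f k := if (0 < k < d)%N then ('X - 1) ^+ k * uniform_poly m (d - k) else 0.
pose g k := if (0 < k < d)%N then relax_term d k else 0.
rewrite [X in X + _ + _](_ : _ = \sum_(F : {set T} | F \subset ground M)
    (f #|F| - g #|F| *+ nonbases_above M F)); last first.
  rewrite (eq_bigl (fun F : {set T} => (F \subset ground M) &&
    ((#|F| < d)%N && (F \in flats M)))); last by move=> F; rewrite andbA.
  rewrite big_mkcondr /=; apply: eq_bigr => F sF; rewrite /f /g -card_gt0.
  have [F0|F0] := posnP #|F|; first by rewrite F0 /= mul0rn subr0 if_same.
  case: ltnP => [Fd|_] /=; last by rewrite mul0rn subr0.
  by rewrite -(KL_small_term hl spM cE IH sF) ?F0.
rewrite sumrB (sum_subsets _ f) (sum_nonbases_above M g) cE.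
have dn : (d <= (m + d).+1)%N by rewrite leqW ?leq_addl.
rewrite [X in X - _ *+ _](sum_positive_sizes (fun k => ('X - 1) ^+ k * uniform_poly m (d - k)) dn).
rewrite [X in _ - X *+ _](sum_positive_sizes (relax_term d) (leqnSn d)).
rewrite add0n /relax_charpoly -/NB.
(* In rank 1 a circuit-hyperplane would be a loop, so the correction is absent. *)
have [d1|d1] : d = 1%N \/ (1 < d)%N by lia.
  have -> : NB = 0%N by rewrite /NB (nonbases_rank1 hl d1) cards0.
  by rewrite !mulr0n !subr0 !addr0.
rewrite relax_term_sum //.
move: (circuit_charpoly d) (('X - 1) * _) (_ *+ d) => c v e.
move: (\sum_(_ < _ | _) _) (\sum_(_ < _ | _) _) (uniform_charpoly _ _) => a b u.
by rewrite !mulrnDl !mulNrn; ring.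
Qed.

(** For 2i < rk M the reversed polynomial has zero i-th coefficient, so the recursion determines
    that of P as minus the one of [KL_rest], which is the recursion [low_sol_rec]. *)
Theorem KL_sparse M : loopless M -> sparse_rank M -> (0 < rk M)%N -> KL_formula M.
Proof.
have [n] := ubnP (rk M); elim: n M => // n IH M ltn hl spM d0 m cE.
have [_ p1 p2] := hP hl; rewrite KL_sumE // in p2.
have small j : (rk M <= j.*2)%N -> (P M)`_j = 0.
  move=> hj; apply: nth_default; move: (p1 d0) hj.
  by move: (size (P M)) (rk M) => s r; lia.
apply/polyP => i; rewrite coefB coefMn.
case: (ltnP i.*2 (rk M)) => hi; last by rewrite small // !coef_low_sol0 // mul0rn subr0.
have := congr1 (fun p : {poly int} => p`_i) p2.
rewrite /= coefD coef_revp small ?if_same; last by lia.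
move=> /esym/eqP; rewrite addr_eq0 => /eqP ->.
rewrite (KL_rest_sparse hl spM d0 cE); last first.
  by move=> N hN sN /andP[N0 ltN]; apply: IH => //; lia.
rewrite !low_sol_rec // coefB coefMn.
move: (_`_i) (_`_i) => a b.
by rewrite mulNrn opprB opprK addrC.
Qed.
End KLFormula.

(** * Coefficients of the transformed characteristic polynomials *)

Lemma alt_sum_binomial_low (R : comNzRingType) n j :
  \sum_(k < j.+1) (-1) ^+ k * 'C(n.+1, k)%:R = (-1) ^+ j * 'C(n, j)%:R :> R.
Proof.
elim: j => [|j IH]; first by rewrite big_ord1 !bin0.
by rewrite big_ord_recr /= IH binS natrD exprS; ring.
Qed.

Lemma sign_sub (R : comNzRingType) j k : (k <= j)%N -> (-1) ^+ (j - k) = (-1) ^+ (j + k) :> R.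
Proof. by move=> kj; rewrite -[in RHS](subnK kj) -addnA exprD addnn -muln2 exprM sqrr_sign
  mulr1. Qed.

Lemma coef_signM (R : comNzRingType) a (p : {poly R}) i : ((-1) ^+ a * p)`_i = (-1) ^+ a * p`_i.
Proof. by rewrite (_ : (-1) ^+ a = ((-1) ^+ a)%:P) ?coefCM // rmorphXn rmorphN1. Qed.

Lemma coef_btransX m (chi : nat -> {poly int}) D i : (i <= D)%N ->
  (btrans m (- 'X) chi D)`_i =
  \sum_(a < i.+1) (-1) ^+ a * 'C(m + D, a)%:R * (chi (D - a)%N)`_(i - a).
Proof.
move=> iD; rewrite /btrans (reindex_inj rev_ord_inj) /= coef_sum.
rewrite (big_ord_widen D.+1 (fun a => (-1) ^+ a * 'C(m + D, a)%:R * (chi (D - a)%N)`_(i - a))) //.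
rewrite [RHS]big_mkcond /=; apply: eq_bigr => a _.
have aD : (a <= D)%N by rewrite -ltnS.
rewrite subSS subKn // coefMn [(- 'X) ^+ _]exprNn -[in LHS]mulrA coef_signM coefXnM.
rewrite -(@bin_sub _ (m + (D - a))); last by rewrite leq_add2l leq_subr.
rewrite (_ : m + D - (m + (D - a)) = a)%N; last by lia.
rewrite ltnS; case: ltnP => _; first by rewrite mulr0 mul0rn.
by rewrite mulrAC mulr_natr.
Qed.

Lemma coef_uniform_charpoly m j l : (0 < l)%N -> (l <= j)%N ->
  (uniform_charpoly m j)`_l = (-1) ^+ (j - l) * 'C(m + j, j - l)%:R.
Proof.
move=> l0 lj; rewrite /uniform_charpoly coef_sum.
have lt : (j - l < j)%N by lia.
rewrite (bigD1 (Ordinal lt)) //= big1 ?addr0.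
  rewrite coefMn coef_signM coefB coefXn coef1 (gtn_eqF l0) subKn // eqxx subr0.
  by rewrite mulr1 mulr_natr.
move=> k ne; rewrite coefMn coef_signM coefB coefXn coef1 (gtn_eqF l0).
rewrite (_ : l == j - k :> nat = false)%N ?subrr ?mulr0 ?mul0rn //.
apply: contraNF ne => /eqP e; apply/eqP/val_inj => /=; have := ltn_ord k; lia.
Qed.

Lemma coef0_uniform_charpoly m j :
  (uniform_charpoly m j.+1)`_0 = (-1) ^+ j.+1 * 'C(m + j, m)%:R.
Proof.
rewrite /uniform_charpoly coef_sum.
transitivity (- \sum_(k < j.+1) (-1) ^+ k * 'C((m + j).+1, k)%:R : int).
  rewrite -sumrN; apply: eq_bigr => k _.
  rewrite coefMn coef_signM coefB coefXn coef1.
  rewrite (_ : 0 == j.+1 - k :> nat = false)%N; last by have := ltn_ord k; lia.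
  by rewrite sub0r mulrN1 mulNrn mulr_natr addnS.
by rewrite alt_sum_binomial_low -bin_sub ?leq_addl // addnK exprS; ring.
Qed.

Lemma btrans_uniform m D i : (0 < i)%N -> (i < D)%N ->
  (btrans m (- 'X) (uniform_charpoly m) D)`_i =
  (-1) ^+ D * ('C(m + D, i)%:R * 'C((m + D - i).-1, m)%:R
     - 'C(m + D, D - i)%:R * 'C((m + i).-1, m)%:R).
Proof.
(* The last index a = i picks the constant coefficient of the characteristic polynomial, which
   follows a formula of its own. *)
move=> i0 iD; rewrite coef_btransX ?(ltnW iD) // big_ord_recr /= subnn.
rewrite [in X in _ + X](_ : D - i = (D - i).-1.+1)%N; last by lia.
rewrite coef0_uniform_charpoly prednK; last by lia.
rewrite (_ : m + (D - i).-1 = (m + D - i).-1)%N; last by lia.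
have -> : \sum_(a < i) (-1) ^+ a * 'C(m + D, a)%:R * (uniform_charpoly m (D - a))`_(i - a)
   = (-1) ^+ (D - i) * 'C(m + D, D - i)%:R * \sum_(a < i) (-1) ^+ a * 'C(m + i, a)%:R.
  rewrite mulr_sumr; apply: eq_bigr => a _; have ai := ltn_ord a.
  rewrite coef_uniform_charpoly ?subn_gt0 ?leq_sub2r //; last exact: ltnW.
  rewrite (_ : D - a - (i - a) = D - i)%N; last by lia.
  have := @trinomial (m + D) (D - i + a) a (leq_addl _ _).
  have := @trinomial (m + D) (D - i + a) (D - i) (leq_addr _ _).
  rewrite addnK [in 'C(m + D - _, _)](_ : D - i + a - (D - i) = a)%N; last by lia.
  rewrite (_ : m + D - (D - i) = m + i)%N; last by lia.
  rewrite (_ : m + D - a = m + (D - a))%N; last by lia.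
  rewrite -[in 'C(_, D - i)](bin_sub (leq_addr a (D - i))) addKn => -> e.
  have {}e := congr1 (fun x => x%:R : int) e; rewrite !natrM in e.
  by transitivity ((-1) ^+ (D - i) * (-1) ^+ a * ('C(m + D, a)%:R * 'C(m + (D - a), D - i)%:R) :
    int);
    [ring | rewrite -e; ring].
case: i i0 iD => // i _ iD; rewrite addnS alt_sum_binomial_low /=.
rewrite -[in 'C(m + i, i)]bin_sub ?leq_addl // addnK sign_sub ?(ltnW iD) // !exprD exprS.
have s2 : (-1) ^+ i * (-1) ^+ i = 1 :> int by rewrite -expr2 sqrr_sign.
move: ((-1) ^+ i) s2 ((-1) ^+ D) => s s2 t.
move: 'C(_, _)%:R 'C(_, _)%:R 'C(_, _)%:R 'C(_, _)%:R => a b c e.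
by apply: etrans (_ : _ = s * s * (t * (b * a - e * c))) _; [ring | rewrite s2 mul1r].
Qed.

Lemma coef_uniform_poly m d i : (0 < i)%N -> (uniform_poly m d)`_i = uniform_coef int m d i.
Proof.
move=> i0; rewrite coef_low_sol /uniform_coef !big_nat; apply: eq_bigr => D /andP[iD _].
rewrite btrans_uniform //; last by move: iD; lia.
by rewrite [RHS]mulrAC [RHS]mulr_natr exprS mulN1r mulNr.
Qed.

Lemma circuit_mobiusE j : circuit_mobius j.+1 = (-1) ^+ j * j%:R.
Proof.
rewrite /circuit_mobius /=; case: j => [|j]; first by rewrite big_ord0 oppr0 mulr0.
under eq_bigr => k _ do rewrite -mulr_natr.
by rewrite alt_sum_binomial_low binSn exprS; ring.
Qed.

Lemma coef_circuit_charpoly j l :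
  (circuit_charpoly j.+1)`_l.+1 = (-1) ^+ (j + l).+1 * 'C(j.+1, l.+2)%:R.
Proof.
rewrite /circuit_charpoly /= coefD coefC addr0 coef_sum.
have [lj|jl] := ltnP l j; last first.
  rewrite bin_small // mulr0 big1 // => k _; rewrite coefMn coef_signM coefXn.
  rewrite (_ : l.+1 == j - k = false)%N ?mulr0 ?mul0rn //; have := ltn_ord k; lia.
have lt : (j - l.+1 < j)%N by lia.
rewrite (bigD1 (Ordinal lt)) //= big1 ?addr0.
  rewrite coefMn coef_signM coefXn subKn // eqxx mulr1 [RHS]mulr_natr sign_sub // addnS; congr
    (_ *+ _).
  by rewrite -bin_sub; [congr 'C(_, _) | ]; lia.
move=> k ne; rewrite coefMn coef_signM coefXn.
rewrite (_ : l.+1 == j - k :> nat = false)%N ?mulr0 ?mul0rn //.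
apply: contraNF ne => /eqP e; apply/eqP/val_inj => /=; have := ltn_ord k; lia.
Qed.

Lemma coef_XsubC_exp j l : (('X - 1) ^+ j : {poly int})`_l = (-1) ^+ (j + l) * 'C(j, l)%:R.
Proof.
rewrite -[1]/(1%:P) addrC -polyCN exprDn coef_sum.
have [lj|jl] := leqP l j; last first.
  rewrite bin_small // mulr0 big1 // => k _; rewrite -rmorphXn coefMn coefCM coefXn.
  rewrite (_ : l == k :> nat = false)%N ?mulr0 ?mul0rn //; have := ltn_ord k; lia.
rewrite (bigD1 (Ordinal (_ : l < j.+1)%N)) //= big1 ?addr0.
  by rewrite -rmorphXn coefMn coefCM coefXn eqxx mulr1 [RHS]mulr_natr sign_sub.
move=> k ne; rewrite -rmorphXn coefMn coefCM coefXn.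
rewrite (_ : l == k :> nat = false)%N ?mulr0 ?mul0rn //.
by apply: contraNF ne => /eqP e; apply/eqP/val_inj.
Qed.

(** As (j + 1) 'C(j, l) = (l + 1) 'C(j + 1, l + 1), subtracting the circuit polynomial leaves the
    factor l. The isolated term at l = 1 comes from (-1)^j ('X - 1). *)
Lemma coef_relax_charpoly j l :
  (relax_charpoly j.+1)`_l = (-1) ^+ (j + l) * l%:R * 'C(j.+1, l.+1)%:R + (-1) ^+ j * (l == 1)%:R.
Proof.
have -> : relax_charpoly j.+1 = ('X - 1) ^+ j *+ j.+1 - circuit_charpoly j.+1 + (-1) ^+ j * ('X
  - 1).
  rewrite /relax_charpoly /= circuit_mobiusE; congr (_ + _).
  rewrite rmorphM rmorphXn rmorphN1 /= rmorph_nat -mulr_natr -natr1.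
  by move: 'X ((-1) ^+ j) (j%:R) => x s a; ring.
rewrite !coefD coefN coefMn coef_signM coefB coefX coef1 coef_XsubC_exp.
case: l => [|l].
  rewrite /circuit_charpoly /= coefD coefC eqxx circuit_mobiusE coef_sum big1 ?add0r; last first.
    move=> k _; rewrite coefMn coef_signM coefXn.
    rewrite (_ : 0 == j - k = false)%N ?mulr0 ?mul0rn //; have := ltn_ord k; lia.
  by rewrite bin0 addn0 -mulr_natr -natr1; move: ((-1) ^+ j) => s; ring.
rewrite coef_circuit_charpoly eqSS subr0; congr (_ + _).
have e : 'C(j, l.+1)%:R *+ j.+1 = l.+1%:R * 'C(j.+1, l.+2)%:R + 'C(j.+1, l.+2)%:R :> int.
  rewrite -mulrnA mulnC (mul_bin_diag j.+1) -natrM -natrD; congr (_%:R); ring.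
by rewrite -mulrnAr e addnS; ring.
Qed.

Lemma btrans_relax D i : (0 < i)%N -> (i < D)%N ->
  (btrans 0 (- 'X) relax_charpoly D)`_i =
  (-1) ^+ D * ('C(D, i.+1)%:R - 'C(D, i.-1)%:R).
Proof.
case: i => // i _ iD; rewrite coef_btransX ?(ltnW iD) // add0n.
have sE (a : 'I_i.+2) : (-1) ^+ a * 'C(D, a)%:R * (relax_charpoly (D - a))`_(i.+1 - a) =
    (-1) ^+ (D + i) * 'C(D, i.+2)%:R * ((-1) ^+ a * ((i.+1 - a)%:R * 'C(i.+2, a)%:R))
    - (-1) ^+ D * 'C(D, a)%:R * (a == i :> nat)%:R.
  have ai : (a <= i.+1)%N by rewrite -ltnS.
  rewrite (_ : D - a = (D - a).-1.+1)%N; last by lia.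
  rewrite coef_relax_charpoly prednK; last by lia.
  rewrite (_ : (i.+1 - a == 1)%N = (a == i :> nat)); last by lia.
  have := @trinomial D i.+2 a (leqW ai); rewrite subSn // => e.
  have {}e := congr1 (fun x => x%:R : int) e; rewrite !natrM in e.
  have aD : (a <= D)%N by lia.
  have Da : (0 < D - a)%N by lia.
  have s1 : (-1) ^+ (D - a).-1 = - ((-1) ^+ D * (-1) ^+ a) :> int.
    by rewrite -exprD -sign_sub // -{2}(prednK Da) exprS; ring.
  have s2 : (-1) ^+ (i.+1 - a) = - ((-1) ^+ i * (-1) ^+ a) :> int by rewrite sign_sub // addSn
    exprS exprD; ring.
  have s3 : (-1) ^+ a * (-1) ^+ a = 1 :> int by rewrite -expr2 sqrr_sign.
  rewrite exprD s1 s2 exprD.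
  move: ((-1) ^+ a) ((-1) ^+ D) ((-1) ^+ i) s3 e => s t u s3.
  move: (i.+1 - a)%:R (_ == _)%:R ('C(D, a)%:R) ('C(i.+2, a)%:R) 'C(D, i.+2)%:R 'C(D - a, _)%:R
    => l b x y z w e.
  transitivity (s * s * (s * t * u * l * (x * w) - x * t * b)); first by ring.
  by rewrite s3 -e; ring.
rewrite (eq_bigr _ (fun a _ => sE a)) sumrB -mulr_sumr.
rewrite [X in _ - X](_ : _ = (-1) ^+ D * 'C(D, i)%:R); last first.
  have lt : (i < i.+2)%N by lia.
  rewrite (bigD1 (Ordinal lt)) //= eqxx mulr1 big1 ?addr0 // => k ne.
  by rewrite (_ : _ == _ = false) ?mulr0 //; apply: contraNF ne => /eqP e; apply/eqP/val_inj.
rewrite (_ : \sum_(a < i.+2) _ = (-1) ^+ i).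
  have s2 : (-1) ^+ i * (-1) ^+ i = 1 :> int by rewrite -expr2 sqrr_sign.
  rewrite exprD; move: ((-1) ^+ i) s2 ((-1) ^+ D) => s s2 t.
  transitivity (s * s * (t * 'C(D, i.+2)%:R) - t * 'C(D, i)%:R); first by ring.
  by rewrite s2; ring.
(* The factor i + 1 - a is (i + 2 - a) - 1, and (i + 2 - a) 'C(i + 2, a) = (i + 2) 'C(i + 1, a). *)
transitivity (\sum_(a < i.+2) (i.+2%:R * ((-1) ^+ a * 'C(i.+1, a)%:R) - (-1) ^+ a * 'C(i.+2,
  a)%:R) : int).
  apply: eq_bigr => a _; have ai : (a <= i.+1)%N by rewrite -ltnS.
  have e := esym (mul_bin_down i.+2 a).
  have {}e := congr1 (fun x => x%:R : int) e; rewrite /= subSn // !natrM -[(_ - _).+1%:R]natr1 in e.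
  by rewrite [i.+2%:R * _]mulrCA -e; ring.
rewrite sumrB -mulr_sumr !alt_sum_binomial_low bin_small // binn exprS; ring.
Qed.

Lemma coef_relax_poly d i : (0 < i)%N -> (relax_poly d)`_i = relax_coef int d i.
Proof.
move=> i0; rewrite coef_low_sol /relax_coef !big_nat; apply: eq_bigr => D /andP[iD _].
rewrite btrans_relax //; last by move: iD; lia.
by rewrite [RHS]mulrAC [RHS]mulr_natr exprS mulN1r mulNr !add0n.
Qed.

(** * Modes *)

Lemma nondecreasing_upto (p : nat -> int) k : (forall i, (i < k)%N -> p i <= p i.+1) ->
  forall i, (i <= k)%N -> p i <= p k.
Proof.
elim: k => [|k IH] up i; first by rewrite leqn0 => /eqP->.
rewrite leq_eqVlt => /predU1P[->//|ik]; apply: le_trans (up k (ltnSn k)).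
by apply: IH => // j jk; apply: up; apply: ltnW.
Qed.

Lemma nonincreasing_from (p : nat -> int) k : (forall i, (k <= i)%N -> p i.+1 <= p i) ->
  forall i, (k <= i)%N -> p i <= p k.
Proof.
move=> dn; elim=> [|i IH]; first by rewrite leqn0 => /eqP->.
rewrite leq_eqVlt => /predU1P[<-//|ki]; exact: le_trans (dn i ki) (IH ki).
Qed.

Lemma mode_of_unimodal (p : {poly int}) k :
  (forall i, (i < k)%N -> p`_i <= p`_i.+1) -> (forall i, (k <= i)%N -> p`_i.+1 <= p`_i) ->
  0 < p`_k -> is_mode p k.
Proof.
move=> up dn pk; split=> [|j _].
  by rewrite ltnNge; apply: contraTN pk => h; rewrite nth_default // ltxx.
have [jk|/ltnW kj] := leqP j k; first exact: (@nondecreasing_upto (nth 0 p)).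
exact: (@nonincreasing_from (nth 0 p)).
Qed.

(** Strict inequalities next to the peak suffice: by the weak ones, any other coefficient is at most
    a neighbour of the peak. *)
Lemma unique_mode_of_unimodal (p : {poly int}) k :
  (forall i, (i < k)%N -> p`_i <= p`_i.+1) -> p`_k < p`_k.+1 ->
  p`_k.+2 < p`_k.+1 -> (forall i, (k.+1 < i)%N -> p`_i.+1 <= p`_i) ->
  0 < p`_k.+1 -> is_unique_mode p k.+1.
Proof.
move=> up upk dnk dn pk; have hm : is_mode p k.+1.
  apply: mode_of_unimodal => // i.
    by rewrite ltnS leq_eqVlt => /predU1P[->|/up//]; apply: ltW.
  by rewrite leq_eqVlt => /predU1P[<-|/dn//]; apply: ltW.
split=> // j [_ hj]; have {hj} hj := hj _ (proj1 hm).
case: (ltngtP j k.+1) => // jk.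
  have h := nondecreasing_upto (p := nth 0 p) up.
  by move: (le_trans hj (h j jk)); rewrite leNgt upk.
have h := nonincreasing_from (p := nth 0 p) dn.
by move: (le_trans hj (h j jk)); rewrite leNgt dnk.
Qed.

Lemma sparse_coef_intr m d lambda i :
  (sparse_coef int m d lambda i)%:~R = sparse_coef rat m d lambda i.
Proof.
rewrite /sparse_coef /uniform_coef /relax_coef rmorphB rmorphM /= !rmorph_sum /= rmorph_nat.
congr (_ - _ * _); apply: eq_bigr => D _;
  by rewrite !rmorphM rmorphB ?rmorphM /= !rmorphXn rmorphN1 !rmorph_nat.
Qed.

Section SparseCoefSteps.
Variables (m d lambda : nat).
Let x : rat := lambda%:R / 'C(m + d, d)%:R.
Let c i := sparse_coef int m d lambda i.

Lemma density_bound n : (lambda * n.+1 <= 'C(m + d, d))%N -> x * (n%:R + 1) <= 1.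
Proof.
move=> h; rewrite /x natr1 mulrAC ler_pdivrMr ?ltr0n ?bin_gt0 ?leq_addl //.
by rewrite mul1r -natrM ler_nat.
Qed.

Lemma coef_large i : (d <= i.*2)%N -> c i = 0.
Proof. by move=> h; rewrite /c /sparse_coef uniform_coef_large // relax_coef_large // mulr0
  subr0. Qed.

Lemma step_factor_gt0 i : (0 < i)%N -> (i.*2 < d)%N ->
  0 < coef_unit m d i / ((i%:R + 1) * i%:R * ((d - i)%:R - 1)).
Proof.
move=> i0 id; rewrite divr_gt0 ?coef_unit_gt0 // !mulr_gt0 ?ltr0n //.
  by rewrite ltr_wpDl ?ler0n.
rewrite subr_gt0 ltr1n; lia.
Qed.

Hypothesis m2 : (2 <= m)%N.

Lemma coef_step_le i : (0 < i)%N -> (i.*2 < d)%N -> (c i <= c i.+1) = (0 <= step_sign (d - i) i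
  m x).
Proof.
move=> i0 id; rewrite -(ler_int rat) !sparse_coef_intr -subr_ge0 sparse_coef_step //; last
  exact: ltnW.
by rewrite pmulr_rge0 ?step_factor_gt0.
Qed.

Lemma coef_step_ge i : (0 < i)%N -> (i.*2 < d)%N -> (c i.+1 <= c i) = (step_sign (d - i) i m x
  <= 0).
Proof.
move=> i0 id; rewrite -(ler_int rat) !sparse_coef_intr -subr_le0 sparse_coef_step //; last
  exact: ltnW.
by rewrite pmulr_rle0 ?step_factor_gt0.
Qed.

Hypothesis d5 : (5 <= d)%N.
Hypotheses (le_d : (lambda * d.+1 <= 'C(m + d, d))%N) (le_m : (lambda * m.+1 <= 'C(m + d, d))%N).

Lemma small_density_sparse i : (i <= d)%N -> small_density (d - i) i m x.
Proof.
move=> id; split; first by rewrite divr_ge0 ?ler0n.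
  by rewrite -natrD subnK // density_bound.
exact: density_bound.
Qed.

Lemma coef_ascent i : (0 < i)%N -> (3 * i + 3 <= d)%N -> c i <= c i.+1.
Proof.
move=> i0 id; have i2 : (i.*2 < d)%N by lia.
have h : (2 * i + 3 <= d - i)%N by lia.
have hx : small_density (d - i) i m x by apply: small_density_sparse; lia.
by rewrite coef_step_le //; apply: ascent_sign hx _ _ _.
Qed.

Lemma coef_descent i : (2 <= i)%N -> (d <= 3 * i + 1)%N -> c i.+1 <= c i.
Proof.
move=> i2 id; have [h|h] := leqP d i.*2; first by rewrite !coef_large // doubleS !leqW.
have [ie ei] : (i < d - i)%N /\ (d - i <= 2 * i + 1)%N by lia.
have i0 := ltnW i2.
have hx : small_density (d - i) i m x by apply: small_density_sparse; lia.
by rewrite coef_step_ge //; apply: descent_sign hx _ _ _ _.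
Qed.

(** Integrality turns positivity into a comparison with the constant coefficient 1, which is the
    first ascent. *)
Lemma coef1_ge1 : 1 <= c 1.
Proof.
have := sparse_coef1_gt0 m2 d5 (density_bound le_d) (density_bound le_m).
by rewrite -sparse_coef_intr ltr0z.
Qed.

Lemma coef_gt0 i : (0 < i)%N -> (3 * i <= d)%N -> 0 < c i.
Proof.
case: i => // i _; elim: i => [|i IH] id; first exact: coef1_ge1.
by apply: lt_le_trans (IH _) _; [lia | apply: coef_ascent; lia].
Qed.
End SparseCoefSteps.

(** * Exact comparisons at the four exceptional pairs *)

Lemma step_sign_7_1_5 e x : e%:R = 7 :> rat ->
  step_sign e 1 5 x = e.-2`!%:R * (12 * ((7 * 1000 + 441) - (39 * 1000 + 501) * x)).
Proof. step_eval e he e2 e2E F F0. Qed.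

Lemma step_sign_9_2_6 e x : e%:R = 9 :> rat ->
  step_sign e 2 6 x = e.-2`!%:R * (432 * ((13 * 1000 + 579) / 7 - (11 * 1000 + 297) * x)).
Proof. step_eval e he e2 e2E F F0. Qed.

Section Thresholds.
Variable lambda : nat.

Lemma fact_pmulr_ge0 n (a : rat) : (0 <= n`!%:R * a) = (0 <= a).
Proof. by rewrite pmulr_rge0 // ltr0n fact_gt0. Qed.

Lemma fact_pmulr_le0 n (a : rat) : (n`!%:R * a <= 0) = (a <= 0).
Proof. by rewrite pmulr_rle0 // ltr0n fact_gt0. Qed.

Lemma affine_threshold (a b : rat) N t : (0 < N)%N -> 0 < b ->
  b * t%:R <= a * N%:R -> a * N%:R < b * t.+1%:R ->
  (0 <= a - b * (lambda%:R / N%:R)) = (lambda <= t)%N.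
Proof.
move=> N0 b0 h1 h2; rewrite subr_ge0 mulrA ler_pdivrMr ?ltr0n //.
apply/idP/idP => [h|lt].
  by rewrite -ltnS -(ltr_nat rat) -(ltr_pM2l b0); apply: le_lt_trans h h2.
by apply: le_trans h1; rewrite ler_pM2l // ler_nat.
Qed.

(** The difference is a positive multiple of 8 - 336 lambda / 126, which vanishes at lambda = 3:
    there the two coefficients tie. The next pair has a tie too, at lambda = 25. *)
Lemma step_4_5 : (sparse_coef int 4 5 lambda 1 <= sparse_coef int 4 5 lambda 2) = (lambda <= 3)%N.
Proof.
rewrite (@coef_step_le 4 5 lambda isT 1 isT isT).
rewrite (step_sign_4_1_4 _ (erefl : (5 - 1)%N%:R = 4)) fact_pmulr_ge0.
have -> : ('C(4 + 5, 5) = 126)%N by apply/eqP; vm_compute.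
by apply: affine_threshold; [exact: isT | lra..].
Qed.

Lemma step_5_5 : (sparse_coef int 5 5 lambda 1 <= sparse_coef int 5 5 lambda 2) = (lambda <= 25)%N.
Proof.
rewrite (@coef_step_le 5 5 lambda isT 1 isT isT).
rewrite (step_sign_4_1_5 _ (erefl : (5 - 1)%N%:R = 4)) fact_pmulr_ge0.
have -> : ('C(5 + 5, 5) = 252)%N by apply/eqP; vm_compute.
by apply: affine_threshold; [exact: isT | lra..].
Qed.

Lemma step_5_8 : (sparse_coef int 5 8 lambda 2 <= sparse_coef int 5 8 lambda 3) = (lambda <= 82)%N.
Proof.
rewrite (@coef_step_le 5 8 lambda isT 2 isT isT).
rewrite (step_sign_6_2_5 _ (erefl : (8 - 2)%N%:R = 6)) fact_pmulr_ge0.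
have -> : ('C(5 + 8, 8) = 1287)%N by apply/eqP; vm_compute.
by apply: affine_threshold; [exact: isT | lra..].
Qed.

Lemma step_6_11 : (sparse_coef int 6 11 lambda 3 <= sparse_coef int 6 11 lambda 4) = (lambda <=
  939)%N.
Proof.
rewrite (@coef_step_le 6 11 lambda isT 3 isT isT).
rewrite (step_sign_8_3_6 _ (erefl : (11 - 3)%N%:R = 8)) fact_pmulr_ge0.
have -> : ('C(6 + 11, 11) = 136 * 91)%N by apply/eqP; vm_compute.
by apply: affine_threshold; [exact: isT | rewrite ?natrM; lra..].
Qed.
End Thresholds.

(** Uniqueness of the mode needs the last ascent to be strict, which the general sign lemma does not
    give. *)
Lemma ascent_5_8 lambda : (lambda * 9 <= 'C(5 + 8, 8))%N ->
  sparse_coef int 5 8 lambda 1 < sparse_coef int 5 8 lambda 2.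
Proof.
move=> /(@density_bound 5 8 lambda 8) hx; rewrite ltNge (@coef_step_ge 5 8 lambda isT 1 isT isT).
rewrite (step_sign_7_1_5 _ (erefl : (8 - 1)%N%:R = 7)) fact_pmulr_le0 -ltNge.
by move: hx; move: (_ / _) => x hx; lra.
Qed.

Lemma ascent_6_11 lambda : (lambda * 12 <= 'C(6 + 11, 11))%N ->
  sparse_coef int 6 11 lambda 2 < sparse_coef int 6 11 lambda 3.
Proof.
move=> /(@density_bound 6 11 lambda 11) hx; rewrite ltNge (@coef_step_ge 6 11 lambda isT 2 isT isT).
rewrite (step_sign_9_2_6 _ (erefl : (11 - 2)%N%:R = 9)) fact_pmulr_le0 -ltNge.
by move: hx; move: (lambda%:R / _) => x hx; rewrite pmulr_rgt0; lra.
Qed.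

(** For d = 5 the ascent to be made strict starts at the constant coefficient 1, so the value itself
    is required; the density bound gives lambda <= 21. *)
Lemma sparse_coef_4_5_1 lambda : sparse_coef int 4 5 lambda 1 = 117 - lambda%:R * 4.
Proof.
rewrite /sparse_coef /uniform_coef /relax_coef; congr (_ - _ * _).
  rewrite unlock; vm_compute; exact: erefl.
rewrite unlock; vm_compute; exact: erefl.
Qed.

Lemma sparse_coef_5_5_1 lambda : sparse_coef int 5 5 lambda 1 = 200 - lambda%:R * 4.
Proof.
rewrite /sparse_coef /uniform_coef /relax_coef; congr (_ - _ * _).
  rewrite unlock; vm_compute; exact: erefl.
rewrite unlock; vm_compute; exact: erefl.
Qed.

Lemma critical_ascent m k lambda : (0 < k)%N -> (k + 3 <= m)%N ->
  (lambda * (3 * k + 2).+1 <= 'C(m + (3 * k + 2), 3 * k + 2))%N ->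
  (lambda * m.+1 <= 'C(m + (3 * k + 2), 3 * k + 2))%N ->
  ~ exceptional m (3 * k + 2) lambda ->
  sparse_coef int m (3 * k + 2) lambda k <= sparse_coef int m (3 * k + 2) lambda k.+1.
Proof.
move=> k0 km le_d le_m nex.
have [|hne] := boolP ((k, m) \in [:: (1, 4); (1, 5); (2, 5); (3, 6)]%N).
  rewrite !inE => /or4P[]/eqP[ke me]; move: nex; rewrite ke me => nex.
  - by rewrite step_4_5 leqNgt; apply/negP => h; apply: nex; apply: Or41.
  - by rewrite step_5_5 leqNgt; apply/negP => h; apply: nex; apply: Or42.
  - by rewrite step_5_8 leqNgt; apply/negP => h; apply: nex; apply: Or43.
  - by rewrite step_6_11 leqNgt; apply/negP => h; apply: nex; apply: Or44.
have m2 : (2 <= m)%N by lia.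
have kd : (k <= 3 * k + 2)%N by lia.
have hx := small_density_sparse le_d le_m kd.
have dk : (3 * k + 2 - k = 2 * k + 2)%N by lia.
rewrite coef_step_le //; last by lia.
by rewrite dk in hx *; apply: critical_ascent_sign.
Qed.

Lemma critical_descent m k lambda : (0 < k)%N -> (2 <= m <= k + 2)%N ->
  sparse_coef int m (3 * k + 2) lambda k.+1 <= sparse_coef int m (3 * k + 2) lambda k.
Proof.
move=> k0 mk; have m2 : (2 <= m)%N by lia.
rewrite coef_step_ge //; last by lia.
rewrite (_ : 3 * k + 2 - k = 2 * k + 2)%N; last by lia.
by apply: critical_descent_sign => //; rewrite divr_ge0 ?ler0n.
Qed.

Section Modes.
Variables (p : {poly int}) (m d lambda : nat).
Hypotheses (m2 : (2 <= m)%N) (d5 : (5 <= d)%N).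
Hypotheses (le_d : (lambda * d.+1 <= 'C(m + d, d))%N) (le_m : (lambda * m.+1 <= 'C(m + d, d))%N).
Hypotheses (p0 : p`_0 = 1) (pE : forall i, (0 < i)%N -> p`_i = sparse_coef int m d lambda i).

Lemma ascent_below i : (3 * i + 3 <= d)%N -> p`_i <= p`_i.+1.
Proof.
case: i => [|i] id; first by rewrite p0 pE // coef1_ge1.
by rewrite !pE // coef_ascent.
Qed.

Lemma descent_above i : (2 <= i)%N -> (d <= 3 * i + 1)%N -> p`_i.+1 <= p`_i.
Proof. by move=> i2 id; rewrite !pE ?coef_descent //; apply: ltnW. Qed.

Lemma below_third_gt0 i : (3 * i <= d)%N -> 0 < p`_i.
Proof. by case: i => [|i] id; rewrite ?p0 // pE // coef_gt0. Qed.

Lemma kappa_mode : ~ exceptional m d lambda -> is_mode p (kappa m d).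
Proof.
move=> nex; rewrite /kappa; have [d3|d3] := boolP (d %% 3 == 2)%N; last first.
  (* As d >= 5 is not 2 modulo 3, d is at least 6, so the descent starts at an index at least 2, as
     [descent_above] requires. *)
  rewrite andbF; apply: mode_of_unimodal => [i ik|i ki|].
  - by apply: ascent_below; lia.
  - by apply: descent_above; lia.
  - by apply: below_third_gt0; lia.
rewrite andbT; have [k dk] : exists k, d = (3 * k + 2)%N by exists (d %/ 3)%N; lia.
have k0 : (0 < k)%N by lia.
have -> : (d %/ 3 = k)%N by lia.
have down i : (k.+1 <= i)%N -> p`_i.+1 <= p`_i by move=> ki; apply: descent_above; lia.
have up i : (i < k)%N -> p`_i <= p`_i.+1 by move=> ik; apply: ascent_below; lia.
have pk : 0 < p`_k by apply: below_third_gt0; lia.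
(* With d = 3k + 2 this condition reads m >= k + 3. *)
have [dm|dm] := boolP (d + 7 <= 3 * m)%N.
  have step : p`_k <= p`_k.+1.
    rewrite !pE // dk; apply: critical_ascent; rewrite -?dk //; lia.
  apply: mode_of_unimodal => // [i|]; last exact: lt_le_trans pk step.
  by rewrite ltnS leq_eqVlt => /predU1P[->|/up].
apply: mode_of_unimodal => // i; rewrite leq_eqVlt => /predU1P[<-|/down//].
by rewrite !pE // dk; apply: critical_descent; lia.
Qed.

Lemma exceptional_mode : exceptional m d lambda -> is_unique_mode p (d %/ 3).
Proof.
(* The peak is at k + 1, so the failing critical step is the one from k + 1 to k + 2; k is 0, 0, 1,
   2 in the four cases. *)
have uniq k : d = (3 * k.+1 + 2)%N -> p`_k < p`_k.+1 -> p`_k.+2 < p`_k.+1 ->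
    is_unique_mode p (d %/ 3).
  move=> dk up dn; have -> : (d %/ 3 = k.+1)%N by lia.
  apply: unique_mode_of_unimodal => // [i ik|i ki|].
  - by apply: ascent_below; lia.
  - by apply: descent_above; lia.
  - by apply: below_third_gt0; lia.
case=> -[[me de] hl]; move: uniq le_d; rewrite me de => uniq led.
- apply: (uniq 0%N) => //; last by rewrite !pE // me de ltNge step_4_5 -ltnNge.
  rewrite p0 pE // me de sparse_coef_4_5_1.
  by move: led; rewrite (_ : 'C(4 + 5, 5) = 126)%N // natz; lia.
- apply: (uniq 0%N) => //; last by rewrite !pE // me de ltNge step_5_5 -ltnNge.
  rewrite p0 pE // me de sparse_coef_5_5_1.
  by move: led; rewrite (_ : 'C(5 + 5, 5) = 252)%N // natz; lia.
- apply: (uniq 1%N) => //; last by rewrite !pE // me de ltNge step_5_8 -ltnNge.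
  by rewrite !pE // me de ascent_5_8.
- apply: (uniq 2%N) => //; last by rewrite !pE // me de ltNge step_6_11 -ltnNge.
  by rewrite !pE // me de ascent_6_11.
Qed.
End Modes.

Theorem theorem1p2 (T : finType) (P : matroid T -> {poly int})
    (M : matroid T) (m d lambda : nat)
    (hP : is_KL P)
    (hloop : loopless M) (hsp : sparse_paving M)
    (hrk : rk M = d) (hcard : #|ground M| = (m + d)%N)
    (hlambda : lambda = #|circuit_hyperplanes M|)
    (hm : (2 <= m)%N) (hd : (5 <= d)%N) :
  (~ exceptional m d lambda -> is_mode (P M) (kappa m d)) /\
  (exceptional m d lambda -> is_unique_mode (P M) (d %/ 3)).
Proof.
have spM := sparse_paving_rank hsp.
rewrite (circuit_hyperplanesE spM) in hlambda.
have d0 : (0 < rk M)%N by rewrite hrk; apply: leq_trans hd.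
rewrite -hrk in hcard.
have le_d := nonbases_le_d spM (ltnW hm) hcard.
have le_m := nonbases_le_m spM d0 hcard.
have pE i : (0 < i)%N -> (P M)`_i = sparse_coef int m d lambda i.
  move=> i0; rewrite (KL_sparse hP hloop spM d0 hcard) hrk coefB coefMn.
  by rewrite coef_uniform_poly // coef_relax_poly // /sparse_coef -hlambda mulr_natl.
have p0 := KL_coef0 hP hloop.
rewrite -hlambda hrk in le_d le_m.
by split; [apply: kappa_mode | apply: exceptional_mode].
Qed.
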